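(* For a positive integer $r$, let $$a_i=1+\frac i{r+1}=\frac{r+1+i}{r+1}\quad\text{and}\quad b_i=1+\frac{i+1}r=\frac{r+1+i}r\qquad\text{for each }1\leq i\leq r,$$ and let $(P_n(x))_{n\in\mathbb N}$ be the polynomial sequence defined by $$P_n(x)=\frac{(-1)^n(a_1)_n\cdots(a_r)_n}{\left(b_1^{(n-1)}\right)_n\cdots\left(b_r^{(n-1)}\right)_n}\;{}_{r+1}F_r\left(\left.\begin{matrix}-n,b_1^{(n-1)},\dots,b_r^{(n-1)}\\ a_1,\dots,a_r\end{matrix}\,\right|\,x\right),\qquad b_j^{(n-1)}=b_j+\left\lceil\frac{n-j}{r}\right\rceil.$$ Then: (a) $(P_n(x))_{n\in\mathbb N}$ satisfies the recurrence relation with constant coefficients $$P_{n+1}(x)=x\,P_n(x)-\sum_{k=0}^{\min(n,r)}\binom{r+1}{k+1}\left(\frac{r^r}{(r+1)^{r+1}}\right)^{k+1}P_{n-k}(x).$$ (b) $(P_n(x))_{n\in\mathbb N}$ can be explicitly written as $$P_n(x)=\binom{n+r}{r}\left(\frac{-r^r}{(r+1)^{r+1}}\right)^n{}_{r+1}F_r\left(\left.\begin{matrix}-n,\frac{n+r+1}r,\dots,\frac{n+2r}r\\ \frac{r+2}{r+1},\dots,\frac{2r+1}{r+1}\end{matrix}\,\right|\,x\right)\qquad\text{for any }n\in\mathbb N.$$ (c) $(P_n(x))_{n\in\mathbb N}$ is $r$-orthogonal with respect to the vector of measures $(\mu_0,\dots,\mu_{r-1})$ supported on $(0,1)$ with densities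 $$\mathrm d\mu_k(x)=\kappa_k\;G^{\,r,0}_{\,r,r}\left(\left.\begin{matrix}\left(\frac{k+i+1}r\right)_{i=1,\dots,r}\\[1mm] \left(\frac{k+i}{r+1}\right)_{i=1,\dots,r+1,\ i\neq r+1-k}\end{matrix}\,\right|\,x\right)\mathrm dx\qquad\text{for }0\leq k\leq r-1,$$ where $\kappa_k=\dfrac{\prod_{i=1}^{r}\Gamma\left(\frac{r+1+k+i}{r}\right)}{\prod_{1\leq i\leq r+1,\,i\neq r+1-k}\Gamma\left(\frac{r+1+k+i}{r+1}\right)}$ is the constant normalising $\mu_k$ to total mass $1$, and moments $$\int_0^1x^n\,\mathrm d\mu_k(x)=\left(\frac{r^r}{(r+1)^{r+1}}\right)^n\frac1{n+1}\binom{(r+1)(n+1)+k}{n}\qquad\text{for any }0\leq k\leq r-1\text{ and }n\in\mathbb N.$$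
   Context: $\mathbb N=\{0,1,2,\dots\}$; $(z)_0=1$, $(z)_n=z(z+1)\cdots(z+n-1)$ for $n\ge1$; ${}_pF_q\left(\left.\begin{matrix}c_1,\dots,c_p\\ d_1,\dots,d_q\end{matrix}\,\right|\,x\right)=\sum_{n\ge0}\frac{(c_1)_n\cdots(c_p)_n}{(d_1)_n\cdots(d_q)_n}\frac{x^n}{n!}$. The Meijer G-function is defined by the Mellin-Barnes integral $$G^{\,r,0}_{\,s,r}\left(\left.\begin{matrix}b_1,\dots,b_s\\ a_1,\dots,a_r\end{matrix}\,\right|\,x\right)=\frac1{2\pi i}\int_{c-i\infty}^{c+i\infty}\frac{\Gamma(a_1+u)\cdots\Gamma(a_r+u)}{\Gamma(b_1+u)\cdots\Gamma(b_s+u)}\,x^{-u}\,\mathrm du,\qquad c>-\min_{1\le i\le r}\mathrm{Re}(a_i).$$ In (c), the lists in parentheses in the upper and lower rows are lists of parameters (not Pochhammer symbols). A sequence $(P_n(x))_{n\in\mathbb N}$ of monic polynomials with $\deg P_n=n$ is $r$-orthogonal with respect to $(\mu_0,\dots,\mu_{r-1})$ if, for all $j\in\{0,\dots,r-1\}$ and $k,n\in\mathbb N$, $\int x^kP_n(x)\,\mathrm d\mu_j(x)\neq0$ if $n=rk+j$ and $\int x^kP_n(x)\,\mathrm d\mu_j(x)=0$ if $n\geq rk+j+1$. *)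

(* Defs.v *)
From HB Require Import structures.
From mathcomp Require Import all_boot all_order all_algebra.
From mathcomp Require Import all_classical all_reals all_analysis.
From mathcomp Require Import complex.

Set Implicit Arguments.
Unset Strict Implicit.
Unset Printing Implicit Defensive.
Import Order.TTheory GRing.Theory Num.Theory.
Import numFieldNormedType.Exports.

Local Open Scope classical_set_scope.
Local Open Scope ring_scope.
Local Open Scope complex_scope.

Definition poch (K : pzRingType) (z : K) (n : nat) : K :=
  \prod_(i < n) (z + i%:R).

Section SpecialFunctions.
Context {R : realType}.

Definition pFq (cs ds : seq R) (x : R) : R :=
  limn (series (fun n : nat =>
    (\prod_(c <- cs) poch c n) / (\prod_(d <- ds) poch d n)
    * (x ^+ n / n`!%:R))).

(* x ^ z for x > 0, with the principal (real) logarithm of x. *)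
Definition cpow (x : R) (z : R[i]) : R[i] :=
  (expR (complex.Re z * ln x))%:C
  * (cos (complex.Im z * ln x) +i* sin (complex.Im z * ln x)).

Definition cintegral (D : set R) (f : R -> R[i]) : R[i] :=
  (\int[lebesgue_measure]_(t in D) complex.Re (f t))
  +i* (\int[lebesgue_measure]_(t in D) complex.Im (f t)).

(* The least m : nat such that 0 < Re z + m. *)
Definition gamma_shift (z : R[i]) : nat :=
  if 0 < complex.Re z then 0%N else (Num.truncn (- complex.Re z)).+1.

(* Euler's integral, continued to Re z <= 0 through
   Gamma (z + m) = z (z + 1) ... (z + m - 1) Gamma z.
   At the poles the value is 0, so that (Gamma z)^-1 is everywhere the
   reciprocal Gamma function. *)
Definition Gamma (z : R[i]) : R[i] :=
  let m := gamma_shift z in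
  cintegral `]0, +oo[ (fun t => cpow t (z + m%:R - 1) * (expR (- t))%:C)
  / poch z m.

(* G^{r,0}_{s,r} with upper parameters bs, lower parameters as_, and with the
   line of integration Re u = c parametrised by u = c + i t, du = i dt. *)
Definition meijerG (bs as_ : seq R[i]) (c x : R) : R[i] :=
  ((2 * pi)%:C * 'i)^-1 *
  cintegral setT (fun t => let u := c +i* t in
    (\prod_(a <- as_) Gamma (a + u)) / (\prod_(b <- bs) Gamma (b + u))
    * cpow x (- u) * 'i).

End SpecialFunctions.

(* c > - min Re a *)
Definition meijer_line (R : realType) (as_ : seq R[i]) (c : R) : Prop :=
  forall a, a \in as_ -> - complex.Re a < c.

(* mu is carried by D, with density f with respect to Lebesgue measure; f is
   written as a complex-valued function, and 0 <= f x in R[i] says that f x is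
   real and nonnegative. *)
Definition has_density (R : realType)
    (mu : {measure set (measurableTypeR R) -> \bar R})
    (D : set R) (f : R -> R[i]) : Prop :=
  (forall x, D x -> 0 <= f x) /\
  (forall A, measurable A ->
     mu A =
     (\int[lebesgue_measure]_(x in A `&` D) (complex.Re (f x))%:E)%E).

Definition r_orthogonal (R : realType) (r : nat) (P : nat -> R -> R)
    (mu : 'I_r -> {measure set (measurableTypeR R) -> \bar R}) : Prop :=
  (forall n, exists p : {poly R},
     [/\ p \is monic, size p = n.+1 & forall x, P n x = p.[x]]) /\
  (forall (j : 'I_r) (k n : nat),
     let f := fun x : R => (x ^+ k * P n x)%:E in
     [/\ (mu j).-integrable setT f,
         n = (r * k + j)%N -> (\int[mu j]_x f x != 0)%E
       & (r * k + j + 1 <= n)%N -> (\int[mu j]_x f x = 0)%E]).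

Section ConstantRecurrence.
Context {R : realType}.
Variable r : nat.

Definition a_par (i : nat) : R := 1 + i%:R / r.+1%:R.
Definition b_par (i : nat) : R := 1 + i.+1%:R / r%:R.

(* b_j^{(n-1)} *)
Definition b_shift (n j : nat) : R :=
  b_par j + (Num.ceil ((n%:R - j%:R) / r%:R : R))%:~R.

Definition P (n : nat) (x : R) : R :=
  (-1) ^+ n * (\prod_(1 <= i < r.+1) poch (a_par i) n)
  / (\prod_(1 <= j < r.+1) poch (b_shift n j) n)
  * pFq (- n%:R :: [seq b_shift n j | j <- iota 1 r])
        [seq a_par i | i <- iota 1 r] x.

(* Parameters of the G-function in the density of mu_k. *)
Definition G_upper (k : nat) : seq R[i] :=
  [seq ((k + i + 1)%:R / r%:R)%:C | i <- iota 1 r].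
Definition G_lower (k : nat) : seq R[i] :=
  [seq ((k + i)%:R / r.+1%:R)%:C | i <- iota 1 r.+1 & i != (r + 1 - k)%N].

Definition kappa (k : nat) : R[i] :=
  (\prod_(1 <= i < r.+1) Gamma (((r + 1 + k + i)%:R / r%:R : R)%:C))
  / (\prod_(1 <= i < r.+2 | i != (r + 1 - k)%N)
       Gamma (((r + 1 + k + i)%:R / r.+1%:R : R)%:C)).

End ConstantRecurrence.

(* Main.v *)
(* Written out with factorials, the polynomials are
     P_n(x) = sum_(m <= n) 'C(n + r + r m, n - m) (- rho)^(n - m) x^m,
   with generating function 1 / ((1 + rho t)^(r+1) - x t), and (a) compares
   coefficients.

   For (c), pair the j-th lower parameter a_j with the j-th upper parameter b_j.
   Then 0 < a_j < b_j, and Gamma(a_j + u) / Gamma(b_j + u) is, up to the factor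
   Gamma(b_j - a_j), the Mellin transform of the beta weight
   x^(a_j - 1) (1 - x)^(b_j - a_j - 1). So the Mellin-Barnes integral is the
   Fourier inversion formula for the logarithm of a product of independent beta
   variables. The characteristic function of this law is
   O(|t|^(- sum_j (b_j - a_j))) = O(|t|^(-3/2)), hence integrable, and the
   G-function is the density of the law; in particular it is nonnegative.

   The moments are products of ratios of Pochhammer symbols. The integral of
   x^k P_n is then a multiple of sum_m (-1)^m 'C(n, m) q(m). For n > r k + j, q
   is a polynomial of degree n - 1 and the sum vanishes. For n = r k + j, q is a
   product of n linear factors divided by r m + n + r + 1, and only the remainder
   of that division, a nonzero constant, contributes. *)
Require Import Defs.
From HB Require Import structures.
From mathcomp Require Import all_boot all_order all_algebra.
From mathcomp Require Import all_classical all_reals all_analysis.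
From mathcomp Require Import measurable_realfun complex ring lra zify.

Set Implicit Arguments.
Unset Strict Implicit.
Unset Printing Implicit Defensive.
Import Order.TTheory GRing.Theory Num.Theory.
Import numFieldNormedType.Exports.

Local Open Scope classical_set_scope.
Local Open Scope ring_scope.

(** * Densities and changes of variables *)

(** The abscissa c of the Mellin-Barnes line is arbitrary. On the logarithmic scale, changing it is
    an exponential tilt of the law; the measure itself sits at c = 1, where the Mellin transform is
    the total mass. The decay t^(-s) of a beta characteristic function comes from a half-period
    argument: scaling x by e^(-pi/t) flips the sign of the oscillating factor, and only the mass
    near x = 1 survives. This works for s <= 1, but a gap b_j - a_j may exceed 1 (it is 3/2 for r =
    1), so a law with s < 2 is first split into two factors of exponent s/2. That splitting, like
    the G-function itself, divides by Gamma at complex points; Gamma has no zero in the right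
    half-plane because the log-gamma law concentrates around ln a for large a and zeros propagate
    under z -> z + 1. Inversion is done with the Abel factor e^(-e |t|): its transform is the Cauchy
    kernel, whose primitive is an arctangent. Oscillating integrals are evaluated with 1 + cos in
    place of cos, so that Tonelli and monotone arguments for nonnegative functions apply. *)

Section density.
Local Open Scope ereal_scope.
Context d (T : measurableType d) (R : realType).
Variable mu : {measure set T -> \bar R}.

Lemma density_measure (w : T -> R) :
  measurable_fun setT w -> (forall x, 0 <= w x)%R ->
  exists m : {measure set T -> \bar R},
    forall A, measurable A -> m A = \int[mu]_(x in A) (w x)%:E.
Proof.
move=> mw w0.
pose m (A : set T) := \int[mu]_(x in A) (w x)%:E.
have m0 : m set0 = 0 by rewrite /m integral_set0.
have mge0 A : 0 <= m A by apply: integral_ge0 => x _; rewrite lee_fin.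
have ms : semi_sigma_additive m.
  move=> /= F mF tF mUF; rewrite /m; apply: cvg_toP.
    apply: ereal_nondecreasing_is_cvgn => i j ij.
    by apply: lee_sum_nneg_natr => // k _ _; apply: integral_ge0 => x _; rewrite lee_fin.
  rewrite ge0_integral_bigcup//=.
    by apply/measurable_funTS/measurableT_comp.
  by move=> x _; rewrite lee_fin.
pose M := isMeasure.Build _ _ _ m m0 mge0 ms.
pose m' : {measure set T -> \bar R} := HB.pack m M.
by exists m'.
Qed.

Import HBNNSimple.

Lemma ge0_integral_density (w : T -> R) (m : {measure set T -> \bar R}) :
  measurable_fun setT w -> (forall x, 0 <= w x)%R ->
  (forall A, measurable A -> m A = \int[mu]_(x in A) (w x)%:E) ->
  forall g : T -> \bar R, measurable_fun setT g -> (forall x, 0 <= g x) ->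
  \int[m]_x g x = \int[mu]_x (g x * (w x)%:E).
Proof.
move=> mw w0 mE g mg g0.
pose h := nnsfun_approx measurableT mg.
have hg x : g x = limn (fun n => (h n x)%:E).
  by apply/esym/cvg_lim => //; apply: cvg_nnsfun_approx.
have hw n x : 0 <= (h n x)%:E * (w x)%:E by rewrite mule_ge0// lee_fin.
transitivity (limn (fun n => \int[m]_x (h n x)%:E)).
  rewrite -monotone_convergence//.
  - by apply: eq_integral => x _; rewrite hg.
  - by move=> n; exact/measurable_EFinP/measurable_funTS.
  - by move=> n x _; rewrite lee_fin.
  - by move=> x _ a b ab; rewrite lee_fin; exact/lefP/nd_nnsfun_approx.
transitivity (limn (fun n => \int[mu]_x ((h n x)%:E * (w x)%:E))); last first.
  rewrite -monotone_convergence//.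
  - apply: eq_integral => x _; apply/cvg_lim => //.
    by apply: cvgeZr => //; apply: cvg_nnsfun_approx.
  - by move=> n; apply/measurable_EFinP/measurable_funM => //; exact/measurable_funTS.
  - move=> x _ a b ab; apply: lee_wpmul2r; first by rewrite lee_fin.
    by rewrite lee_fin; exact/lefP/nd_nnsfun_approx.
congr (limn _); apply/funext => n.
transitivity (\int[m]_x (\sum_(y \in range (h n)) (y * \1_(h n @^-1` [set y]) x)%:E)).
  by apply: eq_integral => t _; rewrite /= fimfunE -fsumEFin.
have indich r : measurable_fun setT (fun x => (r * \1_(h n @^-1` [set r]) x)%:E).
  by apply/measurable_EFinP; exact: measurable_funM.
rewrite ge0_integral_fsum//; last by move=> r x _; exact: nnfun_muleindic_ge0.
transitivity (\int[mu]_x (\sum_(y \in range (h n))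
    (y * \1_(h n @^-1` [set y]) x)%:E * (w x)%:E)); last first.
  apply: eq_integral => x _.
  rewrite -ge0_mule_fsuml => [|y]; last exact: nnfun_muleindic_ge0.
  by rewrite fsumEFin // -(fimfunE _ x).
rewrite ge0_integral_fsum//; last 2 first.
  - by move=> y; apply: emeasurable_funM => //; apply/measurable_EFinP.
  - by move=> r x _; apply: mule_ge0; [exact: nnfun_muleindic_ge0|rewrite lee_fin].
apply: eq_fsbigr => r rhn.
under eq_integral do rewrite EFinM.
rewrite integralZl_indic_nnsfun //.
under [RHS]eq_integral do rewrite EFinM -muleA.
rewrite ge0_integralZl//.
- rewrite integral_indic// setIT mE//; congr (_ * _).
  rewrite integral_mkcond; apply: eq_integral => x _.
  by rewrite epatch_indic muleC.
- by apply/measurable_EFinP; exact: measurable_funM.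
- by move=> t _; rewrite mule_ge0 ?lee_fin.
- by move: rhn; rewrite inE => -[t _ <-]; rewrite lee_fin.
Qed.
End density.

Section lebesgue_substitution.
Context {R : realType}.
Local Notation leb := (@lebesgue_measure R).
Implicit Types f : R -> \bar R.
Local Open Scope ereal_scope.

(** Pushing Lebesgue measure forward by the translation gives a measure with the same values on
    half-open intervals, and these determine it. The scaling lemma follows the same scheme. *)
Lemma ge0_integral_shift (b : R) f : measurable_fun setT f ->
  (forall x, 0 <= f x) ->
  \int[leb]_x f (x + b)%R = \int[leb]_x f x.
Proof.
move=> mf f0.
have mphi : measurable_fun setT ((fun x => x + b)%R : R -> measurableTypeR R).
  by apply: measurable_funD.
transitivity (\int[pushforward leb ((fun x => x + b)%R : R -> measurableTypeR R)]_x f x).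
  by rewrite ge0_integral_pushforward.
apply: eq_measure_integral => A mA _; apply/esym.
apply: lebesgue_measure_unique => //= _ [[u v]] _ <-.
rewrite /pushforward/= (_ : _ @^-1` _ = `](u - b)%R, (v - b)%R]%classic).
  rewrite !lebesgue_measure_itv/= !lte_fin ltrD2r -!EFinB.
  by case: ifP => // _; congr EFin; ring.
by apply/seteqP; split => x /=; rewrite !in_itv/= ltrBlDr lerBrDr.
Qed.

Lemma ge0_integral_scale (a : R) f : (0 < a)%R -> measurable_fun setT f ->
  (forall x, 0 <= f x) ->
  \int[leb]_x f (a * x)%R = a^-1%:E * \int[leb]_x f x.
Proof.
move=> a0 mf f0.
have ai0 : (0 <= a)%R by exact: ltW.
have mphi : measurable_fun setT (( *%R a) : R -> measurableTypeR R).
  by apply: measurable_funM.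
transitivity (\int[pushforward leb (( *%R a) : R -> measurableTypeR R)]_x f x).
  by rewrite ge0_integral_pushforward.
pose m h : {measure set (measurableTypeR R) -> \bar R} :=
  mscale (NngNum ai0) (@measure_function_pushforward__canonical__measure_function_Measure _ _ _ _ _ leb (( *%R a) : R -> measurableTypeR R) h).
have -> : \int[leb]_x f x = \int[m mphi]_x f x.
  apply: (@eq_measure_integral _ (measurableTypeR R)) => A mA _.
  apply: lebesgue_measure_unique => //= _ [[u v]] _ <-.
  rewrite /m /mscale/= /pushforward/= (_ : _ @^-1` _ = `](u / a)%R, (v / a)%R]%classic).
    rewrite !lebesgue_measure_itv/= !lte_fin ltr_pM2r ?invr_gt0// -!EFinB.
    case: ifP => [_|_]; last by rewrite mule0.
    by rewrite -EFinM; congr EFin; field; exact: lt0r_neq0.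
  by apply/seteqP; split => x /=; rewrite !in_itv/= ltr_pdivrMr// ler_pdivlMr// ![(a * x)%R]mulrC.
rewrite ge0_integral_mscale//= muleA -EFinM mulVf ?mul1e//.
exact: lt0r_neq0.
Qed.

Lemma ge0_integral_opp f : measurable_fun setT f ->
  (forall x, 0 <= f x) ->
  \int[leb]_x f (- x)%R = \int[leb]_x f x.
Proof.
move=> mf f0.
have mphi : measurable_fun setT ((-%R) : R -> measurableTypeR R).
  exact: oppr_measurable.
transitivity (\int[pushforward leb ((fun x => - x)%R : R -> measurableTypeR R)]_x f x).
  by rewrite ge0_integral_pushforward.
apply: eq_measure_integral => A mA _. exact: lebesgue_measureN.
Qed.

Lemma integral_itv_FTC (f F : R -> R) (a b : R) : (a < b)%R ->
  {in `[a, b], forall x, is_derive x (1%R : R) F (f x)} ->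
  {in `[a, b], continuous f}%R ->
  \int[leb]_(x in `[a, b]) (f x)%:E = (F b)%:E - (F a)%:E.
Proof.
move=> ab dF cf.
have cF x : x \in `[a, b] -> {for x, continuous F}.
  move=> xab; apply: differentiable_continuous; apply/derivable1_diffP.
  by have [] := dF _ xab.
apply: continuous_FTC2 => //.
- by apply: continuous_in_subspaceT => x /set_mem; exact: cf.
- split=> [x xab||].
  + by have [] := dF _ (subset_itv_oo_cc xab).
  + by apply: cvg_at_right_filter; apply: cF; rewrite in_itv/= lexx ltW.
  + by apply: cvg_at_left_filter; apply: cF; rewrite in_itv/= lexx ltW.
- by move=> x xab; rewrite derive1E; have [_ <-] := dF _ (subset_itv_oo_cc xab).
Qed.

(** The image of dx / x on (0, oo) under [ln] is Lebesgue measure: on a half-open interval ]u, v]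
    this is the fundamental theorem of calculus between e^u and e^v with primitive [ln]. *)
Lemma ge0_integral_ln f : measurable_fun setT f ->
  (forall x, 0 <= f x) ->
  \int[leb]_x f x = \int[leb]_(x in `]0%R, +oo[) (f (ln x) * x^-1%:E).
Proof.
move=> mf f0.
pose w (x : R) : R := (expR (- ln x) * \1_(`]0%R, +oo[) x)%R.
have wE x : w x = if (0 < x)%R then x^-1%R else 0%R.
  rewrite /w indicE mem_setE in_itv/= andbT.
  by case: ifPn => x0; rewrite ?mulr0// mulr1 expRN lnK.
have mw : measurable_fun setT w.
  apply: measurable_funM; last exact: measurable_indic.
  apply: (measurableT_comp (@measurable_expR R)).
  apply: (measurableT_comp (@oppr_measurable R setT)).
  exact: measurable_ln.
have w0 x : (0 <= w x)%R by rewrite wE; case: ifPn => // /ltW; rewrite invr_ge0.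
have [m mE] := @density_measure _ (measurableTypeR R) _ leb _ mw w0.
have mln : measurable_fun setT (@ln R : measurableTypeR R -> measurableTypeR R).
  exact: measurable_ln.
transitivity (\int[pushforward m (@ln R : measurableTypeR R -> measurableTypeR R)]_x f x).
  apply: eq_measure_integral => A mA _.
  apply: lebesgue_measure_unique => //= _ [[u v]] _ <-.
  rewrite /pushforward/= mE; last first.
    by rewrite -[X in measurable X]setTI; exact: mln.
  set S := _ @^-1` _.
  have xS x : (x \in S) = (u < ln x <= v)%R.
    by apply/idP/idP; rewrite inE /S/= in_itv.
  transitivity (\int[leb]_(x in `]expR u, expR v]) (x^-1)%:E).
    rewrite lebesgue_measure_itv/= lte_fin; case: ltP => uv; last first.
      by rewrite set_itv_ge ?integral_set0// bnd_simp -leNgt ler_expR.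
    have cV : {in `[expR u, expR v], continuous (fun x : R => x^-1)}%R.
      move=> x; rewrite in_itv/= => /andP[ux _]; apply: inv_continuous.
      by rewrite gt_eqF// (lt_le_trans (expR_gt0 u)).
    rewrite integral_itv_obnd_cbnd; last first.
      apply/measurable_EFinP; apply: (@measurable_funS _ _ _ _ `[expR u, expR v]) => //.
        exact: subset_itv_oc_cc.
      apply: subspace_continuous_measurable_fun => //.
      by apply: continuous_in_subspaceT => x /set_mem; exact: cV.
    rewrite (@integral_itv_FTC (fun x => x^-1)%R (@ln R)) ?ltr_expR ?expRK//.
    move=> x; rewrite in_itv/= => /andP[ux _].
    exact/is_derive1_ln/(lt_le_trans (expR_gt0 u)).
  rewrite [LHS]integral_mkcond [RHS]integral_mkcond; apply: eq_integral => x _.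
  rewrite !patchE xS mem_setE/= in_itv/= wE.
  case: (ltP 0%R x) => [x0|x0].
    have -> : (expR u < x <= expR v)%R = (u < ln x <= v)%R.
      by rewrite -{1 2}(lnK x0) ltr_expR ler_expR.
    by [].
  case: ifPn => [/andP[]|_].
    by move=> ux _; move: (lt_le_trans (lt_trans (expR_gt0 u) ux) x0); rewrite ltxx.
  by case: ifPn.
rewrite ge0_integral_pushforward// preimage_setT.
rewrite (@ge0_integral_density _ (measurableTypeR R) R leb w m mw w0 mE); first last.
- by move=> x; exact: f0.
- exact: (measurableT_comp mf (@measurable_ln R)).
rewrite [RHS]integral_mkcond; apply: eq_integral => x _ /=.
by rewrite patchE mem_setE/= in_itv/= andbT wE; case: ifP => //; rewrite mule0.
Qed.

End lebesgue_substitution.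

(** * Laws, convolutions and characteristic functions *)

Section finite_of.
Context d (T : measurableType d) (R : realType).
Variables (m : {measure set T -> \bar R}) (mfin : fin_num_fun m).

(** The alias carries the proof [mfin], so that the finite-measure instance can be attached to
    it. *)
Definition finite_of of fin_num_fun m : set T -> \bar R := m.
HB.instance Definition _ := Measure.on (finite_of mfin).
HB.instance Definition _ := Measure_isFinite.Build _ _ _ (finite_of mfin) mfin.

Lemma finite_measureE : exists m' : {finite_measure set T -> \bar R},
  (m' : set T -> \bar R) = m.
Proof. by exists (finite_of mfin). Qed.

End finite_of.

Section log_measures.
Context {R : realType}.
Local Notation TR := (measurableTypeR R).
Local Notation leb := (@lebesgue_measure R).

(** Signed [f] are covered as well: multiplication by the nonnegative [w] commutes with taking
    positive and negative parts. *)
Lemma finite_measure_of_density d (T : measurableType d) (mu : {measure set T -> \bar R})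
    (w : T -> R) :
  measurable_fun setT w -> (forall x, 0 <= w x) ->
  (\int[mu]_x (w x)%:E < +oo)%E ->
  exists m : {finite_measure set T -> \bar R},
    forall f : T -> \bar R, measurable_fun setT f ->
      (\int[m]_x f x = \int[mu]_x (f x * (w x)%:E))%E.
Proof.
move=> mw w0 wfin.
have [m mE] := density_measure mu mw w0.
have mfin : fin_num_fun m.
  apply: lty_fin_num_fun; rewrite mE//.
have [m' m'E] := finite_measureE mfin.
exists m' => f mf.
have E (g : T -> \bar R) : measurable_fun setT g -> (forall x, 0 <= g x)%E ->
    (\int[m']_x g x = \int[mu]_x (g x * (w x)%:E))%E.
  by apply: ge0_integral_density => // A mA; rewrite -mE// -m'E.
rewrite [LHS]integralE [RHS]integralE E//; last exact: measurable_funepos.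
rewrite E//; last exact: measurable_funeneg.
congr (_ - _)%E; apply: eq_integral => x _.
- by rewrite !funeposE maxe_pMl// ?lee_fin// mul0e.
- by rewrite !funenegE maxe_pMl// ?lee_fin// mul0e mulNe.
Qed.

Lemma log_measure (w : R -> R) :
  measurable_fun setT w -> (forall x, 0 <= w x) ->
  (\int[leb]_x (w x)%:E < +oo)%E ->
  exists m : {finite_measure set TR -> \bar R},
    forall f : R -> \bar R, measurable_fun setT f ->
      (\int[m]_x f x = \int[leb]_x (f (ln x) * (w x)%:E))%E.
Proof.
move=> mw w0 wfin.
have [m mE] := @finite_measure_of_density _ TR leb w mw w0 wfin.
have mln : measurable_fun setT (@ln R : TR -> TR) by exact: measurable_ln.
have nufin : fin_num_fun (pushforward m (@ln R : TR -> TR)).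
  by move=> A mA; apply: fin_num_measure; rewrite -[X in measurable X]setTI; exact: mln.
have [nu nuE] := finite_measureE nufin.
exists nu => f mf.
have mfln : measurable_fun setT (f \o @ln R).
  exact: (measurableT_comp mf (@measurable_ln R)).
rewrite -[RHS](mE (f \o @ln R))//.
rewrite [LHS]integralE [RHS]integralE.
have E (g : R -> \bar R) : measurable_fun setT g -> (forall x, 0 <= g x)%E ->
    (\int[nu]_x g x = \int[m]_x g (ln x))%E.
  move=> mg g0.
  transitivity (\int[pushforward m (@ln R : TR -> TR)]_x g x)%E.
    by apply: eq_measure_integral => A mA _; rewrite -nuE.
  by rewrite ge0_integral_pushforward.
congr (_ - _)%E; rewrite E//.
- by apply: eq_integral => x _; rewrite !funeposE.
- exact: measurable_funepos.
- by apply: eq_integral => x _; rewrite !funenegE.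
- exact: measurable_funeneg.
Qed.

(** The characteristic function is handled through two real integrals, matching the componentwise
    [cintegral] in which [Gamma] and [meijerG] are defined. *)
Definition cosT (nu : {finite_measure set TR -> \bar R}) (t : R) : R :=
  \int[nu]_y cos (t * y).
Definition sinT (nu : {finite_measure set TR -> \bar R}) (t : R) : R :=
  \int[nu]_y sin (t * y).
Definition charf (nu : {finite_measure set TR -> \bar R}) (t : R) : R[i] :=
  (cosT nu t +i* sinT nu t)%C.

Lemma bounded_integrable (nu : {finite_measure set TR -> \bar R}) (f : R -> R) (M : R) :
  measurable_fun setT f -> (forall x, `|f x| <= M) -> nu.-integrable setT (EFin \o f).
Proof.
move=> mf fM; apply: measurable_bounded_integrable => //.
  exact: fin_num_fun_lty.
exists M; split; first by rewrite num_real.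
by move=> y My x _; apply: le_trans (fM x) (ltW My).
Qed.

(** The witness is the image of the product measure under addition, the law of a sum of independent
    variables. Fubini and the addition formulas for cosine and sine then give the product rule for
    characteristic functions. *)
Lemma convolution_measure (m1 m2 : {finite_measure set TR -> \bar R}) :
  exists2 nu : {finite_measure set TR -> \bar R},
    (forall f : R -> \bar R, measurable_fun setT f -> (forall x, 0 <= f x)%E ->
      (\int[nu]_x f x = \int[m1]_x \int[m2]_y f (x + y)%R)%E)
  & (forall t, charf nu t = charf m1 t * charf m2 t).
Proof.
pose phi (p : TR * TR) : TR := p.1 + p.2.
have mphi : measurable_fun setT phi.
  by apply: measurable_funD.
have mass : ((m1 \x m2) setT < +oo)%E.
  rewrite -setXTT product_measure1E//= lte_mul_pinfty//.
    exact: fin_num_measure.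
  by apply: fin_num_fun_lty; exact: fin_num_measure.
have nufin : fin_num_fun (pushforward (m1 \x m2)%E phi).
  move=> A mA; apply: (lty_fin_num_fun mass).
  by rewrite -[X in measurable X]setTI; exact: mphi.
have [nu nuE] := finite_measureE nufin.
have E (f : R -> \bar R) : measurable_fun setT f ->
    (m1 \x m2)%E.-integrable setT (f \o phi) ->
    (\int[nu]_x f x = \int[m1]_x \int[m2]_y f (x + y)%R)%E.
  move=> mf intf.
  transitivity (\int[pushforward (m1 \x m2)%E phi]_x f x)%E.
    by apply: eq_measure_integral => A mA _; rewrite -nuE.
  rewrite integral_pushforward//.
  by rewrite preimage_setT -integral12_prod_meas1.
exists nu => [f mf f0|t].
  transitivity (\int[pushforward (m1 \x m2)%E phi]_x f x)%E.
    by apply: eq_measure_integral => A mA _; rewrite -nuE.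
  rewrite ge0_integral_pushforward// preimage_setT (fubini_tonelli1 (f \o phi))//.
    exact: (measurableT_comp mf mphi).
  by move=> x; exact: f0.
have ER (f : R -> R) : measurable_fun setT f -> (forall x, `|f x| <= 1) ->
    \int[nu]_x f x = \int[m1]_x \int[m2]_y f (x + y).
  move=> mf f1; rewrite /Rintegral E.
  - congr fine; apply: eq_integral => x _; rewrite fineK//.
    apply: integrable_fin_num => //.
    apply: (@bounded_integrable m2 (fun y => f (x + y)) 1) => //.
    by apply: (measurableT_comp mf); exact: measurable_funD.
  - exact/measurable_EFinP.
  - apply: (measurable_bounded_integrable measurableT mass).
      exact: (measurableT_comp mf mphi).
    exists 1; split; first by rewrite num_real.
    by move=> y y1 x _ /=; apply: le_trans (f1 _) (ltW y1).
have mcos u : measurable_fun setT (fun y : R => cos (u * y)).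
  apply: (measurableT_comp (continuous_measurable_fun (@continuous_cos R))).
  exact: measurable_funM.
have msin u : measurable_fun setT (fun y : R => sin (u * y)).
  apply: (measurableT_comp (continuous_measurable_fun (@continuous_sin R))).
  exact: measurable_funM.
have ic (m : {finite_measure set TR -> \bar R}) : m.-integrable setT (EFin \o (fun y : R => cos (t * y))).
  by apply: (@bounded_integrable m _ 1) => // x; exact: cos_max.
have isn (m : {finite_measure set TR -> \bar R}) : m.-integrable setT (EFin \o (fun y : R => sin (t * y))).
  by apply: (@bounded_integrable m _ 1) => // x; exact: sin_max.
have ic1 := ic m1; have ic2 := ic m2; have is1 := isn m1; have is2 := isn m2.
rewrite /charf; congr Complex.
- rewrite /cosT ER//; last by move=> x; exact: cos_max.
  transitivity (\int[m1]_x (cos (t * x) * cosT m2 t - sin (t * x) * sinT m2 t)).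
    apply: eq_Rintegral => x _.
    under eq_Rintegral do rewrite mulrDr cosD.
    rewrite RintegralB//; last 2 first.
    - exact: (integrableZl _ (cos (t * x)) (ic m2)).
    - exact: (integrableZl _ (sin (t * x)) (isn m2)).
    by rewrite !RintegralZl//.
  rewrite RintegralB//; last 2 first.
  - exact: (integrableZr _ (cosT m2 t) (ic m1)).
  - exact: (integrableZr _ (sinT m2 t) (isn m1)).
  by rewrite !RintegralZr//.
- rewrite /sinT ER//; last by move=> x; exact: sin_max.
  transitivity (\int[m1]_x (sin (t * x) * cosT m2 t + cos (t * x) * sinT m2 t)).
    apply: eq_Rintegral => x _.
    under eq_Rintegral do rewrite mulrDr sinD.
    rewrite RintegralD//; last 2 first.
    - exact: (integrableZl _ (sin (t * x)) (ic m2)).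
    - exact: (integrableZl _ (cos (t * x)) (isn m2)).
    by rewrite !RintegralZl//.
  rewrite RintegralD//; last 2 first.
  - exact: (integrableZr _ (cosT m2 t) (isn m1)).
  - exact: (integrableZr _ (sinT m2 t) (ic m1)).
  by rewrite !RintegralZr// addrC.
Qed.


End log_measures.

Section exp_cos.
Context {R : realType}.
Local Notation leb := (@lebesgue_measure R).
Variables (a t th : R).
Hypothesis a0 : 0 < a.

Let F (y : R) : R := - (expR (- a * y) / a)
  + expR (- a * y) * (t * sin (t * y + th) - a * cos (t * y + th)) / (a ^+ 2 + t ^+ 2).
Let f (y : R) : R := expR (- a * y) * (1 + cos (t * y + th)).

Let D0 : a ^+ 2 + t ^+ 2 != 0.
Proof. by rewrite gt_eqF// ltr_wpDr ?sqr_ge0// exprn_gt0. Qed.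

Let dF y : is_derive y (1 : R) F (f y).
Proof.
apply: is_derive_eq.
rewrite /f /GRing.scale/=.
have ? : a != 0 by rewrite gt_eqF.
by field; rewrite D0.
Qed.

(** The summand 1 keeps the integrand nonnegative, so the fundamental theorem on a half-line applies
    to the explicit primitive [F]. The free phase [th] delivers the cosine and the sine transform of
    the exponential law from one formula. *)
Lemma integral_exp_cos :
  (\int[leb]_(y in `[0%R, +oo[) (expR (- a * y) * (1 + cos (t * y + th)))%:E
   = (a^-1 + (a * cos th - t * sin th) / (a ^+ 2 + t ^+ 2))%:E)%E.
Proof.
rewrite (@ge0_continuous_FTC2y _ f F 0 0).
- rewrite -EFinB; congr EFin; rewrite /F !mulr0 expR0 !add0r; field.
  by rewrite D0 gt_eqF.
- by move=> x _; rewrite mulr_ge0 ?expR_ge0// -lerBlDl sub0r; have := cos_geN1 (t * x + th).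
- apply: continuous_subspaceT => x.
  apply: differentiable_continuous; apply/derivable1_diffP.
  exact: ex_derive.
- pose M := a^-1 + (`|t| + a) / (a ^+ 2 + t ^+ 2).
  have D1 : 0 < a ^+ 2 + t ^+ 2 by rewrite lt_neqAle eq_sym D0 addr_ge0 ?sqr_ge0.
  have FM y : `|F y| <= M * expR (- a * y).
    rewrite /F /M mulrDl (le_trans (ler_normD _ _))// lerD//.
      by rewrite normrN normrM !gtr0_norm ?invr_gt0 ?expR_gt0// mulrC.
    rewrite -mulrA normrM gtr0_norm ?expR_gt0// mulrC ler_wpM2r ?expR_ge0//.
    rewrite normrM [X in _ * X]gtr0_norm ?invr_gt0// ler_wpM2r ?invr_ge0 ?(ltW D1)//.
    rewrite (le_trans (ler_normB _ _))// lerD// normrM.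
      by rewrite ler_piMr// sin_max.
    by rewrite (gtr0_norm a0) ler_piMr ?(ltW a0)// cos_max.
  have e0 : expR (- a * y) @[y --> +oo%R] --> (0 : R).
    rewrite (_ : (fun y => expR (- a * y)) = (fun z => expR (- z)) \o (fun z => a * z)); last first.
      by apply: eq_fun => y; rewrite mulNr.
    apply: (@cvg_comp _ _ _ _ _ _ (pinfty_nbhs R)); last exact: cvgr_expR.
    exact: gt0_cvgMry.
  have Me0 : M * expR (- a * y) @[y --> +oo%R] --> (0 : R).
    by rewrite -[X in _ --> X](mulr0 M); apply: cvgM => //; exact: cvg_cst.
  have Me1 : - (M * expR (- a * y)) @[y --> +oo%R] --> (0 : R).
    by rewrite -oppr0; exact: cvgN.
  apply: (squeeze_cvgr _ Me1 Me0).
  by near=> y; rewrite -ler_norml FM.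
- by move=> x _; have [] := dF x.
- apply: cvg_at_right_filter. apply: differentiable_continuous; apply/derivable1_diffP.
  by have [] := dF 0.
- by move=> x _; rewrite derive1E; have [_ ->] := dF x.
Unshelve. all: by end_near. Qed.
End exp_cos.

(** * Gamma and beta laws on the logarithmic scale *)

Section gamma_beta_weights.
Context {R : realType}.
Local Notation TR := (measurableTypeR R).
Local Notation leb := (@lebesgue_measure R).
Implicit Types (a s x y p : R).

(** [gw] is the gamma weight x^(a-1) e^(-x) on x > 0 and [bw] the beta weight x^(a-1) (1-x)^(s-1) on
    0 < x < 1, both unnormalised. As exponentials, their products are compared by comparing
    exponents. *)
Definition gw a x : R := if 0 < x then expR ((a - 1) * ln x - x) else 0.
Definition bw a s x : R :=
  if 0 < x < 1 then expR ((a - 1) * ln x + (s - 1) * ln (1 - x)) else 0.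

Lemma gw_ge0 a x : 0 <= gw a x.
Proof. by rewrite /gw; case: ifP => // _; exact: expR_ge0. Qed.

Lemma bw_ge0 a s x : 0 <= bw a s x.
Proof. by rewrite /bw; case: ifP => // _; exact: expR_ge0. Qed.

Lemma measurable_gw a : measurable_fun setT (gw a).
Proof.
apply: measurable_fun_ifT.
- by apply: measurable_fun_ltr; [exact: measurable_cst|exact: measurable_id].
- apply: (measurableT_comp (@measurable_expR R)).
  apply: measurable_funB => //.
  by apply: measurable_funM => //; exact: measurable_ln.
- exact: measurable_cst.
Qed.

Lemma measurable_bw a s : measurable_fun setT (bw a s).
Proof.
apply: measurable_fun_ifT.
- apply: measurable_and.
    by apply: measurable_fun_ltr; [exact: measurable_cst|exact: measurable_id].
  by apply: measurable_fun_ltr; [exact: measurable_id|exact: measurable_cst].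
- apply: (measurableT_comp (@measurable_expR R)).
  apply: measurable_funD; apply: measurable_funM; try exact: measurable_cst.
    exact: measurable_ln.
  apply: (measurableT_comp (@measurable_ln R)).
  by apply: measurable_funB => //; exact: measurable_cst.
- exact: measurable_cst.
Qed.

(** A gamma(a + s) total x and an independent beta(a, s) fraction y = p / x split the total into p
    and x - p; the joint weight factors into independent gamma weights of the two pieces, x^-1 being
    the Jacobian. *)
Lemma beta_gamma_weight a s x p :
  0 < x -> bw a s (p / x) * (x^-1 * gw (a + s) x) = gw a p * gw s (x - p).
Proof.
move=> x0; rewrite /bw /gw x0 subr_gt0 ltr_pdivrMr// mul1r.
rewrite (_ : (0 < p / x) = (0 < p)); last by rewrite pmulr_lgt0 ?invr_gt0.
case: (ltP 0 p) => [p0|]; last by rewrite !mul0r.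
case: (ltP p x) => [px|]; last by rewrite mul0r mulr0.
have xp0 : 0 < x - p by rewrite subr_gt0.
rewrite (_ : 1 - p / x = (x - p) / x); last by field; rewrite gt_eqF.
have xE : x^-1 = expR (- ln x) by rewrite expRN lnK.
rewrite !ln_div ?posrE// [X in _ * (X * _)]xE -!expRD.
by congr expR; ring.
Qed.

Local Open Scope ereal_scope.

Definition Gr a : \bar R := \int[leb]_x (gw a x)%:E.
Definition Br a s : \bar R := \int[leb]_x (bw a s x)%:E.

(** Substitute p = x y in the inner integral, apply [beta_gamma_weight], exchange by Tonelli; for
    fixed p the integral over x - p is [Gr s]. Taking [g] constant yields the beta integral and the
    functional equation, composing [g] with [ln] yields the law of the product. *)
Lemma beta_gamma_integral a s (g : R -> \bar R) :
  measurable_fun setT g -> (forall x, 0 <= g x) ->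
  \int[leb]_x ((\int[leb]_y (g (x * y)%R * (bw a s y)%:E)) * (gw (a + s) x)%:E)
  = Gr s * \int[leb]_p (g p * (gw a p)%:E).
Proof.
move=> mg g0.
pose f (xp : TR * TR) : \bar R := g xp.2 * ((gw a xp.2)%:E * (gw s (xp.1 - xp.2))%:E).
have mf : measurable_fun setT f.
  apply: emeasurable_funM; first exact: (measurableT_comp mg measurable_snd).
  apply/measurable_EFinP; apply: measurable_funM.
    exact: (measurableT_comp (measurable_gw a) measurable_snd).
  apply: (measurableT_comp (measurable_gw s)).
  by apply: measurable_funB; [exact: measurable_fst|exact: measurable_snd].
have f0 z : 0 <= f z by rewrite /f !mule_ge0// lee_fin gw_ge0.
transitivity (\int[leb]_x \int[leb]_p f (x, p)).
  apply: eq_integral => x _; case: (ltP 0%R x) => x0; last first.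
    rewrite {1}/gw ltNge x0/= mule0 integral0_eq// => p _.
    rewrite /f/= /gw; case: ltP => p0; last by rewrite mul0e mule0.
    by rewrite subr_gt0 ltNge (le_trans x0 (ltW p0))/= !mule0.
  pose h p : \bar R := g p * (bw a s (p / x))%:E.
  have mh : measurable_fun setT h.
    apply: emeasurable_funM => //; apply/measurable_EFinP.
    by apply: (measurableT_comp (measurable_bw a s)); exact: measurable_funM.
  have h0 p : 0 <= h p by rewrite /h mule_ge0// lee_fin bw_ge0.
  transitivity (\int[leb]_y h (x * y)%R * (gw (a + s) x)%:E).
    have hE y : h (x * y)%R = g (x * y)%R * (bw a s y)%:E.
      by rewrite /h [(x * y / x)%R]mulrAC mulfV ?mul1r// gt_eqF.
    by under eq_integral do rewrite -hE.
  rewrite ge0_integral_scale// muleC muleA -EFinM -ge0_integralZl//; last first.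
    by rewrite lee_fin mulr_ge0 ?gw_ge0// invr_ge0 ltW.
  apply: eq_integral => p _; rewrite /h /f/= muleCA -!EFinM; congr (_ * _%:E).
  by rewrite -beta_gamma_weight//; ring.
rewrite fubini_tonelli// -ge0_integralZl//; last 3 first.
- by apply: emeasurable_funM => //; apply/measurable_EFinP; exact: measurable_gw.
- by move=> p _; rewrite mule_ge0// lee_fin gw_ge0.
- by apply: integral_ge0 => p _; rewrite lee_fin gw_ge0.
apply: eq_integral => p _.
have mgw := measurable_gw s.
have -> : Gr s = \int[leb]_x (gw s (x - p))%:E.
  rewrite (ge0_integral_shift (- p) (f := fun x => (gw s x)%:E))//.
    exact/measurable_EFinP.
  by move=> x; rewrite lee_fin gw_ge0.
rewrite -ge0_integralZr; first last.
- by rewrite mule_ge0// lee_fin gw_ge0.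
- by move=> x _; rewrite lee_fin gw_ge0.
- apply/measurable_EFinP/(measurableT_comp mgw).
  by apply: measurable_funB => //; exact: measurable_cst.
- exact: measurableT.
by apply: eq_integral => x _; rewrite /f/= [RHS]muleC muleA.
Qed.

Lemma integral_exp0y a : (0 < a)%R ->
  \int[leb]_(x in `]0%R, +oo[) (a * expR (- a * x))%:E = 1.
Proof.
move=> a0; rewrite -(integral_exponential_pdf a0) integral_itv_obnd_cbnd; last first.
  apply/measurable_EFinP/measurable_funTS/measurable_funM; first exact: measurable_cst.
  apply: (measurableT_comp (@measurable_expR R)).
  by apply: measurable_funM => //; exact: measurable_cst.
rewrite integral_mkcond; apply: eq_integral => x _.
by rewrite /exponential_pdf !patchE; case: ifP.
Qed.

(** The substitution x = e^(-y) turns x^(a-1) dx on (0, 1) into e^(-a y) dy on (0, oo), which is 1/a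
    times the exponential density. *)
Lemma integral_pow01 a : (0 < a)%R -> Br a 1 = a^-1%:E.
Proof.
move=> a0.
pose f (y : R) : \bar R := (if (0 < y)%R then expR (- a * y) else 0%R)%:E.
have mf : measurable_fun setT f.
  apply/measurable_EFinP/measurable_fun_ifT.
  - by apply: measurable_fun_ltr; [exact: measurable_cst|exact: measurable_id].
  - apply: (measurableT_comp (@measurable_expR R)).
    by apply: measurable_funM => //; exact: measurable_cst.
  - exact: measurable_cst.
have f0 y : 0 <= f y by rewrite /f lee_fin; case: ifP => // _; exact: expR_ge0.
have -> : Br a 1 = \int[leb]_x f x.
  rewrite -ge0_integral_opp// ge0_integral_ln; last 2 first.
  - exact: (measurableT_comp mf (@oppr_measurable R setT)).
  - by move=> x; exact: f0.
  rewrite [RHS]integral_mkcond; apply: eq_integral => x _ /=.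
  rewrite patchE mem_setE/= in_itv/= andbT /bw /f; case: (ltP 0%R x) => //= x0.
  have [x1|x1] := ltP x 1%R.
    rewrite oppr_gt0 ln_lt0 ?x0//.
    rewrite -[x^-1%R]lnK ?posrE ?invr_gt0// lnV// -EFinM -expRD.
    by congr (expR _)%:E; ring.
  by rewrite oppr_gt0 ltNge ln_ge0//= mul0e.
have [_ <-] : (a != 0)%R /\ a^-1%:E * (a%:E * \int[leb]_x f x) = \int[leb]_x f x.
  by split; [rewrite gt_eqF|rewrite muleA -EFinM mulVf ?mul1e ?gt_eqF].
rewrite -[RHS]mule1; congr (_ * _).
rewrite -(integral_exp0y a0) -ge0_integralZl//; last by rewrite lee_fin ltW.
rewrite [RHS]integral_mkcond; apply: eq_integral => x _ /=.
rewrite patchE mem_setE/= in_itv/= andbT /f; case: ifP => //.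
by rewrite mule0.
Qed.

Lemma Gr1 : Gr 1 = 1.
Proof.
rewrite -(integral_exp0y (@ltr01 R)).
rewrite [RHS]integral_mkcond; apply: eq_integral => x _ /=.
rewrite patchE mem_setE/= in_itv/= andbT /gw; case: ifP => // _.
by congr _%:E; rewrite mul1r; congr expR; ring.
Qed.

Lemma BrGr a s : Br a s * Gr (a + s) = Gr s * Gr a.
Proof.
transitivity (\int[leb]_x ((\int[leb]_y (cst 1 (x * y)%R * (bw a s y)%:E)) * (gw (a + s) x)%:E)).
  rewrite -ge0_integralZl; first last.
  - by apply: integral_ge0 => x _; rewrite lee_fin bw_ge0.
  - by move=> x _; rewrite lee_fin gw_ge0.
  - by apply/measurable_EFinP; exact: measurable_gw.
  - exact: measurableT.
  by apply: eq_integral => x _; congr (_ * _); apply: eq_integral => y _; rewrite /= mul1e.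
rewrite (beta_gamma_integral a s (g := cst 1))//.
by congr (_ * _); apply: eq_integral => x _; rewrite mul1e.
Qed.

(** This is [BrGr] at s = 1, where the beta integral is 1/a and [Gr 1] is 1. *)
Lemma GrS a : (0 < a)%R -> Gr (a + 1) = a%:E * Gr a.
Proof.
move=> a0; rewrite -[RHS]mul1e -Gr1 muleCA -BrGr integral_pow01// muleA.
by rewrite -EFinM mulfV ?mul1e ?gt_eqF.
Qed.

Lemma Gr_ge0 a : 0 <= Gr a.
Proof. by apply: integral_ge0 => x _; rewrite lee_fin gw_ge0. Qed.

(** Positive integers follow from [GrS] by induction. For b >= 1 with integer part n, the weight of
    b is at most the sum of those of n and n + 1, according to the sign of ln x. For 0 < a < 1
    finiteness at a + 1 passes back to a through [GrS]. *)
Lemma Gr_fin a : (0 < a)%R -> Gr a \is a fin_num.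
Proof.
have Gn n : Gr n.+1%:R \is a fin_num.
  elim: n => [|n IHn]; first by rewrite Gr1.
  by rewrite -[in n.+2]addn1 natrD GrS// fin_numM.
suff G1 b : (1 <= b)%R -> Gr b \is a fin_num.
  move=> a0; have := G1 (a + 1)%R; rewrite lerDr ltW// => /(_ isT).
  rewrite GrS//; case: (Gr a) => [//||]; first by rewrite gt0_muley.
  by rewrite gt0_muleNy.
move=> b1.
have /andP[nb bn] := truncn_itv (le_trans ler01 b1).
set n := Num.truncn b in nb bn.
have n0 : (0 < n)%N by rewrite lt0n; apply/eqP => n0; move: bn; rewrite n0 ltNge b1.
rewrite ge0_fin_numE ?Gr_ge0//.
apply: (@le_lt_trans _ _ (Gr n%:R + Gr n.+1%:R)); last first.
  by rewrite lte_add_pinfty// -ge0_fin_numE ?Gr_ge0// -(prednK n0).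
rewrite /Gr -ge0_integralD//=; try (by move=> ? _; rewrite lee_fin gw_ge0).
- apply: ge0_le_integral => //=; try (by move=> ? _; rewrite lee_fin gw_ge0).
  + by apply/measurable_EFinP; exact: measurable_gw.
  + by apply: emeasurable_funD; apply/measurable_EFinP; exact: measurable_gw.
  move=> x _; rewrite -EFinD lee_fin /gw; case: ifP => [x0|]; last by rewrite addr0.
  case: (leP 0%R (ln x)) => lx.
    apply: (@le_trans _ _ (expR ((n.+1%:R - 1) * ln x - x))); last by rewrite lerDr expR_ge0.
    by rewrite ler_expR lerD2r ler_wpM2r// lerD2r ltW.
  apply: (@le_trans _ _ (expR ((n%:R - 1) * ln x - x))); last by rewrite lerDl expR_ge0.
  by rewrite ler_expR lerD2r ler_wnM2r ?(ltW lx)// lerD2r.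
- by apply/measurable_EFinP; exact: measurable_gw.
- by apply/measurable_EFinP; exact: measurable_gw.
Qed.

Lemma Gr_gt0 a : (0 < a)%R -> 0 < Gr a.
Proof.
move=> a0; rewrite lt_neqAle Gr_ge0 andbT; apply/eqP => G0.
(* On [1, 2] one has 0 <= ln x <= 1 and x <= 2, hence this lower bound for the weight on an interval
   of length 1. *)
have : (expR (- `|a - 1| - 2))%:E <= Gr a.
  rewrite -[leLHS]mule1.
  have -> : 1 = leb `[1%R, 2%R] :> \bar R.
    by rewrite lebesgue_measure_itv/= lte_fin ltr1n -EFinB; congr EFin; ring.
  rewrite -integral_cst//= integral_mkcond.
  apply: ge0_le_integral => //.
  - by move=> x _; rewrite patchE; case: ifP => // _; rewrite lee_fin expR_ge0.
  - by apply/(measurable_restrictT _ _).1 => //; exact: measurable_cst.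
  - by apply/measurable_EFinP; exact: measurable_gw.
  move=> x _; rewrite patchE mem_setE/= in_itv/=; case: ifP => [/andP[x1 x2]|]; last by rewrite lee_fin gw_ge0.
  have x0 : (0 < x)%R by apply: lt_le_trans x1.
  rewrite lee_fin /gw x0 ler_expR lerD ?lerN2//.
  have l0 : (0 <= ln x)%R by rewrite ln_ge0.
  have l1 : (ln x <= 1)%R.
    have xm1 : (-1 < x - 1)%R by lra.
    have := le_ln1Dx xm1; rewrite addrC subrK; lra.
  rewrite -[leLHS]mulr1 (@le_trans _ _ (- `|a - 1| * ln x))%R//.
    by rewrite !mulNr lerN2 ler_wpM2l.
  by rewrite ler_wpM2r// lerNl -normrN ler_norm.
by rewrite -G0 lee_fin leNgt expR_gt0.
Qed.

End gamma_beta_weights.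

(** * Gamma on vertical lines as a characteristic function, and its zero-free half-plane *)

Section charf_gamma.
Context {R : realType}.
Local Notation TR := (measurableTypeR R).
Local Notation leb := (@lebesgue_measure R).
Implicit Types (a s t x y p : R).
Implicit Types nu : {finite_measure set TR -> \bar R}.

Lemma measurable_cos_affine t th : measurable_fun setT (fun y : R => cos (t * y + th)).
Proof.
apply: (measurableT_comp (continuous_measurable_fun (@continuous_cos R))).
apply: measurable_funD; last exact: measurable_cst.
by apply: measurable_funM => //; exact: measurable_cst.
Qed.


Lemma integrable_cos nu t th : nu.-integrable setT (EFin \o (fun y : R => cos (t * y + th))).
Proof.
apply: (@bounded_integrable _ nu _ 1); first exact: measurable_cos_affine.
by move=> x; exact: cos_max.
Qed.

Lemma integrable_cos0 nu t : nu.-integrable setT (EFin \o (fun y : R => cos (t * y))).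
Proof.
have := integrable_cos nu t 0.
by congr (_.-integrable _ _); apply/funext => y /=; rewrite addr0.
Qed.

Lemma integrable_sin0 nu t : nu.-integrable setT (EFin \o (fun y : R => sin (t * y))).
Proof.
apply: (@bounded_integrable _ nu _ 1); last by move=> x; exact: sin_max.
apply: (measurableT_comp (continuous_measurable_fun (@continuous_sin R))).
by apply: measurable_funM => //; exact: measurable_cst.
Qed.

(** A nonnegative integrand that determines the characteristic function: phase 0 isolates [cosT] and
    a phase of pi/2 or -pi/2 isolates [sinT], up to the total mass. *)
Lemma integral_1Dcos nu t th :
  (\int[nu]_y (1 + cos (t * y + th))%:E =
   (fine (nu setT) + (cosT nu t * cos th - sinT nu t * sin th))%:E)%E.
Proof.
have i1 : nu.-integrable setT (EFin \o cst 1).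
  exact: finite_measure_integrable_cst.
have ic := integrable_cos nu t th.
have ic0 := integrable_cos0 nu t.
have is0 := integrable_sin0 nu t.
rewrite integralD_EFin//= integral_cst// mul1e EFinD fineK ?fin_num_measure//.
congr (_ + _)%E.
rewrite -[LHS]fineK; last exact: integrable_fin_num.
congr EFin; rewrite -/(Rintegral _ _ _).
under eq_Rintegral do rewrite cosD.
rewrite RintegralB//.
- by rewrite !RintegralZr.
- exact: (integrableZr _ (cos th) ic0).
- exact: (integrableZr _ (sin th) is0).
Qed.

(** The condition 0 < a stands under the existential so that [glm] is a total function of a; the
    Dirac mass is a dummy value for a <= 0. For a > 0 the measure is the law of ln X with X of gamma
    weight. The beta case below is arranged in the same way. *)
Lemma gamma_log_measure_ex a : exists nu, 0 < a ->
  forall f : R -> \bar R, measurable_fun setT f ->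
    (\int[nu]_x f x = \int[leb]_x (f (ln x) * (gw a x)%:E))%E.
Proof.
have [a0|] := ltP 0 a; last by exists (dirac (0 : TR)).
have [//|||nu H] := @log_measure R (gw a).
- exact: measurable_gw.
- exact: gw_ge0.
- by rewrite -ge0_fin_numE ?Gr_fin ?Gr_ge0.
by exists nu.
Qed.

Definition glm a := projT1 (cid (gamma_log_measure_ex a)).

Lemma glmE a (f : R -> \bar R) : 0 < a -> measurable_fun setT f ->
  (\int[glm a]_x f x = \int[leb]_x (f (ln x) * (gw a x)%:E))%E.
Proof. by move=> a0; rewrite /glm; case: cid => nu /= /(_ a0); exact. Qed.

Lemma Br_fin a s : 0 < a -> 0 < s -> Br a s \is a fin_num.
Proof.
move=> a0 s0; have as0 : 0 < a + s by rewrite addr_gt0.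
have := BrGr a s.
have : (0 <= Br a s)%E by apply: integral_ge0 => x _; rewrite lee_fin bw_ge0.
case: (Br a s) => [//||//]; rewrite gt0_mulye ?Gr_gt0// => _ H.
have : (Gr s * Gr a)%E \is a fin_num by rewrite fin_numM ?Gr_fin.
by rewrite -H.
Qed.

Lemma beta_log_measure_ex a s : exists nu, 0 < a -> 0 < s ->
  forall f : R -> \bar R, measurable_fun setT f ->
    (\int[nu]_x f x = \int[leb]_x (f (ln x) * (bw a s x)%:E))%E.
Proof.
have [a0|] := ltP 0 a; last by exists (dirac (0 : TR)).
have [s0|] := ltP 0 s; last by exists (dirac (0 : TR)).
have [//|||nu H] := @log_measure R (bw a s).
- exact: measurable_bw.
- exact: bw_ge0.
- rewrite -ge0_fin_numE ?Br_fin//.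
  by apply: integral_ge0 => x _; rewrite lee_fin bw_ge0.
by exists nu.
Qed.

Definition blm a s := projT1 (cid (beta_log_measure_ex a s)).

Lemma blmE a s (f : R -> \bar R) : 0 < a -> 0 < s -> measurable_fun setT f ->
  (\int[blm a s]_x f x = \int[leb]_x (f (ln x) * (bw a s x)%:E))%E.
Proof. by move=> a0 s0; rewrite /blm; case: cid => nu /= /(_ a0 s0); exact. Qed.

Local Open Scope complex_scope.

Lemma measurable_sin0 t : measurable_fun setT (fun y : R => sin (t * y)).
Proof.
apply: (measurableT_comp (continuous_measurable_fun (@continuous_sin R))).
by apply: measurable_funM => //; exact: measurable_cst.
Qed.

Lemma measurable_cos0 t : measurable_fun setT (fun y : R => cos (t * y)).
Proof.
apply: (measurableT_comp (continuous_measurable_fun (@continuous_cos R))).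
by apply: measurable_funM => //; exact: measurable_cst.
Qed.

(** For a > 0 the shift in [Gamma] is 0, and x^(a - 1 + i t) = x^(a-1) e^(i t ln x), so Euler's
    integral is an integral of e^(i t y) with y = ln x. *)
Lemma Gamma_charf a t : 0 < a -> Gamma (a +i* t) = charf (glm a) t.
Proof.
move=> a0; rewrite /Gamma /gamma_shift/= a0 /poch big_ord0 divr1.
rewrite /cintegral /charf; congr Complex.
- rewrite /cosT /Rintegral glmE//; last by apply/measurable_EFinP; exact: measurable_cos0.
  rewrite integral_mkcond; congr fine; apply: eq_integral => x _.
  rewrite patchE mem_setE/= in_itv/= andbT /gw; case: ifP => x0; last by rewrite mule0.
  rewrite -EFinM; congr EFin; rewrite /cpow/=.
  by rewrite !addr0 !subr0 !(mul0r, mulr0) !subr0 expRD; ring.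
- rewrite /sinT /Rintegral glmE//; last by apply/measurable_EFinP; exact: measurable_sin0.
  rewrite integral_mkcond; congr fine; apply: eq_integral => x _.
  rewrite patchE mem_setE/= in_itv/= andbT /gw; case: ifP => x0; last by rewrite mule0.
  rewrite -EFinM; congr EFin; rewrite /cpow/=.
  by rewrite !addr0 !subr0 !(mul0r, mulr0) !add0r !addr0 expRD; ring.
Qed.

Lemma Gamma_real a : 0 < a -> Gamma a%:C = (fine (Gr a))%:C.
Proof.
move=> a0; rewrite (Gamma_charf 0 a0) /charf; congr Complex.
  rewrite /cosT /Rintegral; congr fine.
  under eq_integral do rewrite mul0r cos0.
  rewrite glmE//.
  by apply: eq_integral => x _; rewrite mul1e.
rewrite /sinT; under eq_Rintegral do rewrite mul0r sin0.
by rewrite Rintegral_cst// mul0r.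
Qed.

(* The law of a product of independent gamma and beta variables is gamma. *)
Lemma charf_beta_gamma a s t : 0 < a -> 0 < s ->
  charf (blm a s) t * Gamma ((a + s) +i* t) = Gamma s%:C * Gamma (a +i* t).
Proof.
move=> a0 s0; have as0 : 0 < a + s by rewrite addr_gt0.
have [nu nuE nuC] := convolution_measure (glm (a + s)) (blm a s).
rewrite Gamma_charf// Gamma_real// Gamma_charf// mulrC -nuC.
(* [nu] is the law of ln (X Y). The factor [Gr s] appears because the beta weight is not
   normalised. *)
have H (f : R -> \bar R) : measurable_fun setT f -> (forall x, 0 <= f x)%E ->
    (\int[nu]_x f x = Gr s * \int[glm a]_x f x)%E.
  move=> mf f0; rewrite nuE// glmE//; last first.
    pose h (p : TR * TR) : \bar R := f (p.1 + p.2).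
    have mh : measurable_fun setT h.
      apply: (measurableT_comp mf).
      by apply: measurable_funD; [exact: measurable_fst|exact: measurable_snd].
    have h0 (p : TR * TR) : (0 <= h p)%E by exact: f0.
    exact: (@measurable_fun_fubini_tonelli_F _ _ TR TR R (blm a s) h mh h0).
  rewrite glmE//.
  have mfln : measurable_fun setT (f \o @ln R).
    exact: (measurableT_comp mf (@measurable_ln R)).
  rewrite -(beta_gamma_integral a s mfln); last by move=> x; exact: f0.
  apply: eq_integral => x _.
  rewrite /gw; case: ifPn => x0; last by rewrite !mule0.
  congr (_ * _)%E; rewrite blmE//; last first.
    apply: (measurableT_comp mf).
    by apply: measurable_funD => //; exact: measurable_cst.
  apply: eq_integral => y _; rewrite /bw; case: ifPn => [/andP[y0 _]|_]; last by rewrite !mule0.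
  by rewrite /= lnM// posrE.
have HR (f : R -> R) : measurable_fun setT f ->
    (glm a).-integrable setT (EFin \o f) ->
    \int[nu]_x f x = fine (Gr s) * \int[glm a]_x f x.
  move=> mf intf; rewrite /Rintegral.
  have G0 := Gr_fin s0.
  have mfE : measurable_fun setT (EFin \o f) by exact/measurable_EFinP.
  rewrite [in LHS]integralE (H _ (measurable_funepos mfE))//.
  rewrite (H _ (measurable_funeneg mfE))//.
  rewrite -(fineK G0) -muleBr//; last first.
    by rewrite fin_num_adde_defl// fin_numN integrable_neg_fin_num.
  by rewrite -integralE fineM// integrable_fin_num.
rewrite /charf /cosT /sinT (HR (fun y => cos (t * y))); last 2 first.
- exact: measurable_cos0.
- exact: integrable_cos0.
rewrite (HR (fun y => sin (t * y))); last 2 first.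
- exact: measurable_sin0.
- exact: integrable_sin0.
by congr Complex; rewrite /= ?(mul0r, subr0, addr0).
Qed.

(** For s = 1 the variable y = -ln x is exponential of rate a, up to the total mass 1/a. *)
Lemma blm1E a (f : R -> \bar R) : 0 < a ->
  measurable_fun setT f -> (forall x, 0 <= f x)%E ->
  (\int[blm a 1]_x f x =
   \int[leb]_(y in `[0%R, +oo[) (f (- y)%R * (expR (- a * y))%:E))%E.
Proof.
move=> a0 mf f0; rewrite blmE//.
pose g (y : R) : \bar R := (f (- y)%R * (if (0 < y)%R then expR (- a * y) else 0%R)%:E)%E.
have mg : measurable_fun setT g.
  apply: emeasurable_funM.
    exact: (measurableT_comp mf (@oppr_measurable R setT)).
  apply/measurable_EFinP/measurable_fun_ifT.
  - by apply: measurable_fun_ltr; [exact: measurable_cst|exact: measurable_id].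
  - apply: (measurableT_comp (@measurable_expR R)).
    by apply: measurable_funM => //; exact: measurable_cst.
  - exact: measurable_cst.
have g0 y : (0 <= g y)%E.
  by rewrite /g mule_ge0// lee_fin; case: ifP => // _; exact: expR_ge0.
transitivity (\int[leb]_x g x)%E.
  rewrite -[RHS]ge0_integral_opp// [RHS]ge0_integral_ln; last 2 first.
  - exact: (measurableT_comp mg (@oppr_measurable R setT)).
  - by move=> x; exact: g0.
  rewrite [RHS]integral_mkcond; apply: eq_integral => x _ /=.
  rewrite patchE mem_setE/= in_itv/= andbT /bw /g; case: (ltP 0 x) => //= x0; last by rewrite mule0.
  rewrite opprK -muleA; congr (_ * _)%E.
  have [x1|x1] := ltP x 1.
    rewrite oppr_gt0 ln_lt0 ?x0//.
    rewrite -[x^-1]lnK ?posrE ?invr_gt0// lnV// -EFinM -expRD.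
    by congr (expR _)%:E; ring.
  by rewrite oppr_gt0 ltNge ln_ge0//= mul0e.
rewrite -integral_itv_obnd_cbnd; last first.
  apply: measurable_funTS; apply: emeasurable_funM.
    exact: (measurableT_comp mf (@oppr_measurable R setT)).
  apply/measurable_EFinP.
  apply: (measurableT_comp (@measurable_expR R)).
  by apply: measurable_funM => //; exact: measurable_cst.
rewrite [RHS]integral_mkcond; apply: eq_integral => x _.
rewrite patchE mem_setE/= in_itv/= andbT /g; case: ifP => //.
by rewrite mule0.
Qed.

Lemma charf_blm1 a t : 0 < a -> charf (blm a 1) t * (a +i* t) = 1.
Proof.
move=> a0.
have E th : fine (blm a 1 setT) + (cosT (blm a 1) t * cos th - sinT (blm a 1) t * sin th)
    = a^-1 + (a * cos th + t * sin th) / (a ^+ 2 + t ^+ 2).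
  apply: EFin_inj; rewrite -integral_1Dcos blm1E//; first last.
  - apply/measurable_EFinP; apply: measurable_funD; first exact: measurable_cst.
    exact: measurable_cos_affine.
  have := integral_exp_cos t (- th) a0; rewrite cosN sinN mulrN opprK => <-.
  apply: eq_integral => y _; rewrite -EFinM mulrC; congr (_ * (1 + _))%:E.
  by rewrite -[LHS]cosN; congr cos; ring.
have M : fine (blm a 1 setT) = a^-1.
  rewrite -[blm a 1 setT]mul1e -integral_cst// blmE//.
  under eq_integral do rewrite mul1e.
  by rewrite -/(Br a 1) integral_pow01.
(* After cancelling the mass 1/a, these two phases give the cosine transform a / (a^2 + t^2) and the
   sine transform -t / (a^2 + t^2), the components of 1 / (a + i t). *)
have := E 0; have := E (pi / 2).
rewrite M cos_pihalf sin_pihalf cos0 sin0 !mulr0 !mulr1 !sub0r !addr0 subr0.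
move=> /addrI h1 /addrI h2.
have D0 : a ^+ 2 + t ^+ 2 != 0 by rewrite gt_eqF// ltr_wpDr ?sqr_ge0// exprn_gt0.
rewrite /charf h2 -[sinT _ _]opprK h1.
apply/eqP; rewrite eq_complex/=; apply/andP; split; apply/eqP; field; exact: D0.
Qed.

Lemma GammaD1 a t : 0 < a -> Gamma ((a + 1) +i* t) = (a +i* t) * Gamma (a +i* t).
Proof.
move=> a0; have := charf_beta_gamma t a0 (@ltr01 R).
rewrite Gamma_real// Gr1/= mul1r => <-.
by rewrite mulrA mulrC [_ * charf _ _]mulrC charf_blm1// mulr1.
Qed.

Lemma cos_ge_quadratic (u : R) : 1 - u ^+ 2 / 2 <= cos u.
Proof.
have sinE (v : R) : 0 < v -> `|sin v| <= v.
  move=> v0; have [c _] : exists2 c, c \in `]0, v[%R & sin v - sin 0 = cos c * (v - 0).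
    apply: (MVT v0).
    exact/continuous_subspaceT/continuous_sin.
  rewrite sin0 !subr0 => ->; rewrite normrM (gtr0_norm v0) ler_piMl ?(ltW v0)//.
  exact: cos_max.
have sin2 (v : R) : sin v ^+ 2 <= v ^+ 2.
  rewrite -real_normK ?num_real// -[leRHS]real_normK ?num_real// ler_pXn2r ?nnegrE//.
  have [v0|v0|<-] := ltgtP 0 v; last by rewrite sin0.
    by rewrite (gtr0_norm v0) sinE.
  by rewrite -normrN -sinN (ltr0_norm v0) sinE// oppr_gt0.
have := sin2 (u / 2); have := cos2Dsin2 (u / 2).
have := cos_mulr2n (u / 2).
rewrite (_ : u / 2 *+ 2 = u); last by rewrite -mulr_natr divfK.
rewrite -mulr_natr => ->.
have -> : (u / 2) ^+ 2 = u ^+ 2 / 4 by field.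
lra.
Qed.

(** With h = ln z / 2 the right side is 4 (e^h - e^(-h))^2, and |e^h - e^(-h)| >= |h| by e^h >= 1 +
    h. This majorant is chosen because z and 1/z have explicit integrals against a gamma weight. *)
Lemma sqr_ln_le (z : R) : 0 < z -> ln z ^+ 2 <= 4 * (z - 2 + z^-1).
Proof.
move=> z0; pose h := ln z / 2; pose w := expR h; pose w' := expR (- h).
have ww : w * w' = 1 by rewrite -expRD subrr expR0.
have zE : z = w * w by rewrite -expRD -splitr lnK.
have ziE : z^-1 = w' * w'.
  by rewrite -expRD -opprD expRN -splitr lnK.
have -> : z - 2 + z^-1 = (w - w') ^+ 2 by rewrite ziE zE sqrrB ww; ring.
have -> : ln z ^+ 2 = 4 * h ^+ 2 by rewrite /h; field.
rewrite ler_pM2l// -real_normK ?num_real// -[leRHS]real_normK ?num_real//.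
rewrite ler_pXn2r ?nnegrE//.
have w1 : 1 + h <= w by exact: expR_ge1Dx.
have w'1 : 1 - h <= w' by exact: expR_ge1Dx.
have [h0|h0] := leP 0 h.
  have w'2 : w' <= 1 by rewrite -expR0 ler_expR oppr_le0.
  by rewrite !ger0_norm//; lra.
have w2 : w <= 1 by rewrite -expR0 ler_expR ltW.
by rewrite !ler0_norm//; lra.
Qed.

Lemma glm_mass a : 0 < a -> glm a setT = Gr a.
Proof.
move=> a0; rewrite -[glm a setT]mul1e -integral_cst// glmE//.
by apply: eq_integral => x _; rewrite mul1e.
Qed.

Lemma glm_tilt a c : 0 < a -> (\int[glm a]_y (expR (c * y))%:E = Gr (a + c))%E.
Proof.
move=> a0; rewrite glmE//; last first.
  apply/measurable_EFinP/(measurableT_comp (@measurable_expR R)).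
  by apply: measurable_funM => //; exact: measurable_cst.
apply: eq_integral => x _; rewrite /gw; case: ifP => _; last by rewrite mule0.
by rewrite -EFinM -expRD; congr (expR _)%:E; ring.
Qed.

(** For large a the log-gamma law concentrates near ln a. If the characteristic function vanished at
    t, the integral of 1 + cos (t (y - ln a)) would equal the mass. With z = e^y / a, however, it is
    at least the integral of 2 - 2 t^2 (z - 2 + 1/z). Under the normalised law z has mean 1 and 1/z
    has mean a / (a - 1), so this is the mass times 2 - 2 t^2 / (a - 1), more than the mass. *)
Lemma charf_glm_neq0 a t : 1 < a -> 2 * t ^+ 2 < a - 1 -> charf (glm a) t != 0.
Proof.
move=> a1 ta; have a0 : 0 < a by exact: lt_trans a1.
apply/eqP => -[c0 s0].
have am1 : 0 < a - 1 by rewrite subr_gt0.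
have := integral_1Dcos (glm a) t (- (t * ln a)).
rewrite c0 s0 !mul0r subr0 addr0 => I0.
pose g : R := fine (Gr a).
have g0 : 0 < g by rewrite fine_gt0// Gr_gt0//= -ge0_fin_numE ?Gr_fin ?Gr_ge0.
have gE : Gr a = g%:E by rewrite fineK// Gr_fin.
have GS : Gr (a + 1) = (a * g)%:E by rewrite GrS// gE.
have GP : Gr (a - 1) = (g / (a - 1))%:E.
  have := GrS am1; rewrite subrK gE => /esym h.
  have := Gr_fin am1; move: h; case: (Gr (a - 1)) => // r [rE] _.
  by rewrite -rE mulrC mulKf// gt_eqF.
have : (\int[glm a]_y ((2 + 4 * t ^+ 2)%:E) <=
   \int[glm a]_y ((1 + cos (t * y - t * ln a))%:E
     + ((2 * t ^+ 2 / a * expR (1 * y))%:E + (2 * t ^+ 2 * a * expR (-1 * y))%:E)))%E.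
  apply: ge0_le_integral => //.
  - by move=> y _; rewrite lee_fin; nra.
  - apply: emeasurable_funD; first apply/measurable_EFinP.
      apply: measurable_funD; first exact: measurable_cst.
      exact: measurable_cos_affine.
    apply: emeasurable_funD; apply/measurable_EFinP; apply: measurable_funM;
      try exact: measurable_cst.
      apply: (measurableT_comp (@measurable_expR R)).
      by apply: measurable_funM => //; exact: measurable_cst.
    apply: (measurableT_comp (@measurable_expR R)).
    by apply: measurable_funM => //; exact: measurable_cst.
  move=> y _; rewrite -!EFinD lee_fin mul1r mulN1r.
  pose z := expR y / a.
  have z0 : 0 < z by rewrite divr_gt0// expR_gt0.
  have lz : ln z = y - ln a by rewrite ln_div ?posrE ?expR_gt0// expRK.
  have ziE : z^-1 = a * expR (- y) by rewrite /z invf_div expRN.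
  have := sqr_ln_le z0; rewrite lz ziE /z => h1.
  have := cos_ge_quadratic (t * y - t * ln a); rewrite -mulrBr exprMn => h2.
  have h3 := ler_wpM2l (sqr_ge0 t) h1.
  lra.
have -> : (\int[glm a]_y (2 + 4 * t ^+ 2)%:E = ((2 + 4 * t ^+ 2) * g)%:E)%E.
  by rewrite integral_cst// EFinM -gE; congr (_ * _)%E; exact: glm_mass.
have mE c k : measurable_fun setT (fun y => (k * expR (c * y))%:E).
  apply/measurable_EFinP; apply: measurable_funM; first exact: measurable_cst.
  apply: (measurableT_comp (@measurable_expR R)).
  by apply: measurable_funM => //; exact: measurable_cst.
have t20 : 0 <= 2 * t ^+ 2 by rewrite mulr_ge0// sqr_ge0.
have k1 : 0 <= 2 * t ^+ 2 / a by rewrite divr_ge0// ltW.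
have k2 : 0 <= 2 * t ^+ 2 * a by rewrite mulr_ge0// ltW.
have p1 y : (0 <= (2 * t ^+ 2 / a * expR (1 * y))%:E)%E by rewrite lee_fin mulr_ge0// expR_ge0.
have p2 y : (0 <= (2 * t ^+ 2 * a * expR (-1 * y))%:E)%E by rewrite lee_fin mulr_ge0// expR_ge0.
rewrite ge0_integralD//; last 3 first.
- apply/measurable_EFinP; apply: measurable_funD; first exact: measurable_cst.
  exact: measurable_cos_affine.
- by move=> y _; apply: adde_ge0.
- by apply: emeasurable_funD; exact: mE.
rewrite I0 ge0_integralD//; try exact: mE.
have tilt c k : 0 <= k -> (\int[glm a]_y (k * expR (c * y))%:E = k%:E * Gr (a + c))%E.
  move=> k0; rewrite -(glm_tilt c a0) -ge0_integralZl//.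
  apply/measurable_EFinP/(measurableT_comp (@measurable_expR R)).
  by apply: measurable_funM => //; exact: measurable_cst.
rewrite !tilt// GS GP. rewrite glm_mass// gE/= -!EFinM -!EFinD lee_fin.
apply/negP; rewrite -ltNge.
have aN0 : a != 0 by rewrite gt_eqF.
have bN0 : a - 1 != 0 by rewrite gt_eqF.
have -> : g + (2 * t ^+ 2 / a * (a * g) + 2 * t ^+ 2 * a * (g / (a - 1)))
   = (1 + 4 * t ^+ 2 + 2 * t ^+ 2 / (a - 1)) * g by field; rewrite ?aN0 ?bN0.
rewrite ltr_pM2r// -subr_gt0.
have : 2 * t ^+ 2 / (a - 1) < 1 by rewrite ltr_pdivrMr// mul1r.
lra.
Qed.

(** A zero at a + i t would propagate by [GammaD1] to a + n + i t for every n, and [charf_glm_neq0]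
    forbids it as soon as a + n - 1 exceeds 2 t^2. *)
Lemma Gamma_neq0 a t : 0 < a -> Gamma (a +i* t) != 0.
Proof.
move=> a0; apply/negP => /eqP G0.
have H n : Gamma ((a + n%:R) +i* t) = 0.
  elim: n => [|n IHn]; first by rewrite addr0.
  by rewrite -addn1 natrD addrA GammaD1 ?IHn ?mulr0// ltr_wpDr.
pose n := (Num.truncn (2 * t ^+ 2)).+2.
have nt : 2 * t ^+ 2 < n%:R - 1.
  have := truncnS_gt (2 * t ^+ 2); rewrite /n.
  by rewrite -(natrB _ (isT : (1 <= _.+2)%N)) subSS subn0.
have := H n; rewrite Gamma_charf; last by rewrite ltr_wpDr.
apply/eqP/charf_glm_neq0.
  have n1 : 1 <= n%:R :> R by rewrite ler1n.
  lra.
by rewrite (lt_le_trans nt)// lerD2r lerDr ltW.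
Qed.

End charf_gamma.

(** * Fourier inversion *)

Section Rdominated.
Context d (T : measurableType d) (R : realType) (mu : {measure set T -> \bar R}).
Variables (D : set T) (mD : measurable D).

Lemma Rdominated_cvg (f_ : nat -> T -> R) (f : T -> R) (g : T -> R) :
  (forall n, measurable_fun D (f_ n)) ->
  (forall x, D x -> f_ ^~ x @ \oo --> f x) ->
  mu.-integrable D (EFin \o g) ->
  (forall n x, D x -> `|f_ n x| <= g x) ->
  mu.-integrable D (EFin \o f) /\
  \int[mu]_(x in D) f_ n x @[n --> \oo] --> \int[mu]_(x in D) f x.
Proof.
move=> mf ff ig fg.
have mF : measurable_fun D f by exact: (measurable_fun_cvg mf ff).
have [If _ H] : [/\ mu.-integrable D (EFin \o f),
   [sequence \int[mu]_(x in D) `|(f_ n x)%:E - (f x)%:E|]_n @ \oo --> 0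
  & [sequence \int[mu]_(x in D) (f_ n x)%:E]_n @ \oo --> \int[mu]_(x in D) (f x)%:E]%E.
  apply: (dominated_convergence mD (g := EFin \o g)) => //.
  - by move=> n; exact/measurable_EFinP.
  - exact/measurable_EFinP.
  - by apply: aeW => x Dx; apply: cvg_EFin; [exact: nearW|exact: ff].
  - by apply: aeW => x n Dx; rewrite /= lee_fin fg.
split => //; apply: fine_cvg.
by rewrite /Rintegral fineK ?integrable_fin_num.
Qed.
End Rdominated.

Section poisson_kernel.
Context {R : realType}.
Local Notation TR := (measurableTypeR R).
Local Notation leb := (@lebesgue_measure R).
Implicit Types (e w t y z : R).

(** The integrand is even, so this is twice the half-line integral with phase 0. The term e / (e^2 +
    w^2) is the Cauchy kernel that smooths the law in the inversion. *)
Lemma integral_poisson_cos e w : 0 < e ->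
  (\int[leb]_t ((1 + cos (t * w)) * expR (- (e * `|t|)))%:E
   = (2 * (e^-1 + e / (e ^+ 2 + w ^+ 2)))%:E)%E.
Proof.
move=> e0; rewrite ge0_symfun_integralT; last 3 first.
- by move=> t; rewrite mulr_ge0 ?expR_ge0// -lerBlDl sub0r; have := cos_geN1 (t * w).
- move=> t; apply: cvgM.
    have : {for t, continuous (fun t : R => 1 + cos (t * w))}.
      by apply: differentiable_continuous; apply/derivable1_diffP; exact: ex_derive.
    by [].
  apply: continuous_cvg; first exact: continuous_expR.
  by apply: cvgN; apply: cvgM; [exact: cvg_cst|exact: norm_continuous].
- by move=> t /=; rewrite normrN mulNr cosN.
rewrite -set_itvcy EFinM; congr (_ * _)%E.
have := integral_exp_cos w 0 e0; rewrite cos0 sin0 mulr1 mulr0 subr0 => <-.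
apply: eq_integral => t; rewrite inE/= in_itv/= andbT => t0.
by rewrite ger0_norm// addr0 mulrC mulNr [w * t]mulrC.
Qed.

Lemma integral_cauchy_itv e z (u v : R) : 0 < e -> u < v ->
  (\int[leb]_(y in `[u, v]) (e / (e ^+ 2 + (z - y) ^+ 2))%:E
   = (atan ((v - z) / e) - atan ((u - z) / e))%:E)%E.
Proof.
move=> e0 uv.
rewrite (@integral_itv_FTC R _ (fun y => atan ((y - z) / e)))//.
- move=> y _; have -> : e / (e ^+ 2 + (z - y) ^+ 2) = (1 + ((y - z) / e) ^+ 2)^-1 * e^-1.
    have eN0 : e != 0 by rewrite gt_eqF.
    have D0 : e ^+ 2 + (z - y) ^+ 2 != 0 by rewrite gt_eqF// ltr_pwDl ?sqr_ge0// exprn_gt0.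
    have D1 : 1 + ((y - z) / e) ^+ 2 != 0 by rewrite gt_eqF// ltr_pwDl ?sqr_ge0.
    by field; rewrite eN0 -[y - z]opprB sqrrN D0.
  apply: is_derive_eq.
  by rewrite scaler0 add0r subr0 /GRing.scale/= mulr1.
- move=> y _; have D0 : e ^+ 2 + (z - y) ^+ 2 != 0.
    by rewrite gt_eqF// ltr_pwDl ?sqr_ge0// exprn_gt0.
  apply: cvgM; first exact: cvg_cst.
  apply: cvgV => //; apply: cvgD; first exact: cvg_cst.
  have : {for y, continuous (fun y : R => (z - y) ^+ 2)}.
    by apply: differentiable_continuous; apply/derivable1_diffP; exact: ex_derive.
  by [].
Qed.

(** Tonelli makes the integral of the nonnegative function 1 + cos measurable in the parameter;
    subtracting the constant mass leaves [cosT]. The sine version only changes the phase to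
    -pi/2. *)
Lemma measurable_cosT (nu : {finite_measure set TR -> \bar R}) :
  measurable_fun setT (cosT nu).
Proof.
pose h (p : TR * TR) : \bar R := (1 + cos (p.1 * p.2 + 0))%:E.
have mh : measurable_fun setT h.
  apply/measurable_EFinP; apply: measurable_funD; first exact: measurable_cst.
  apply: (measurableT_comp (continuous_measurable_fun (@continuous_cos R))).
  apply: measurable_funD; last exact: measurable_cst.
  by apply: measurable_funM; [exact: measurable_fst|exact: measurable_snd].
have h0 p : (0 <= h p)%E by rewrite lee_fin -lerBlDl sub0r; have := cos_geN1 (p.1 * p.2 + 0).
have := @measurable_fun_fubini_tonelli_F _ _ TR TR R nu h mh h0.
rewrite (_ : fubini_F nu h = EFin \o (fun t => fine (nu setT) + cosT nu t)).
  move=> /measurable_EFinP H.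
  rewrite (_ : cosT nu = (fun t => (fine (nu setT) + cosT nu t) - fine (nu setT))).
    by apply: measurable_funB => //; exact: measurable_cst.
  by apply/funext => t; rewrite addrC addKr.
apply/funext => t; rewrite /fubini_F /h/= integral_1Dcos.
by rewrite cos0 sin0 mulr1 mulr0 subr0.
Qed.

Lemma measurable_sinT (nu : {finite_measure set TR -> \bar R}) :
  measurable_fun setT (sinT nu).
Proof.
pose h (p : TR * TR) : \bar R := (1 + cos (p.1 * p.2 + - (pi / 2)))%:E.
have mh : measurable_fun setT h.
  apply/measurable_EFinP; apply: measurable_funD; first exact: measurable_cst.
  apply: (measurableT_comp (continuous_measurable_fun (@continuous_cos R))).
  apply: measurable_funD; last exact: measurable_cst.
  by apply: measurable_funM; [exact: measurable_fst|exact: measurable_snd].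
have h0 p : (0 <= h p)%E by rewrite lee_fin -lerBlDl sub0r; have := cos_geN1 (p.1 * p.2 + - (pi / 2)).
have := @measurable_fun_fubini_tonelli_F _ _ TR TR R nu h mh h0.
rewrite (_ : fubini_F nu h = EFin \o (fun t => fine (nu setT) + sinT nu t)).
  move=> /measurable_EFinP H.
  rewrite (_ : sinT nu = (fun t => (fine (nu setT) + sinT nu t) - fine (nu setT))).
    by apply: measurable_funB => //; exact: measurable_cst.
  by apply/funext => t; rewrite addrC addKr.
apply/funext => t; rewrite /fubini_F /h/= integral_1Dcos.
by rewrite cosN sinN cos_pihalf sin_pihalf mulr0 mulrN mulr1 sub0r opprK.
Qed.

End poisson_kernel.

(** Reflection exchanges the positive and negative parts. When both have infinite integral the
    difference is an infinite value, which [fine] sends to 0. *)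
Lemma Rintegral_odd (R : realType) (f : R -> R) : measurable_fun setT f ->
  (forall x, f (- x) = - f x) -> \int[@lebesgue_measure R]_x f x = 0.
Proof.
move=> mf fN; rewrite /Rintegral integralE.
have mF : measurable_fun setT (EFin \o f) by exact/measurable_EFinP.
rewrite -(ge0_integral_opp (f := (EFin \o f)^\-)%E)//; last exact: measurable_funeneg.
have -> : (\int[@lebesgue_measure R]_x (EFin \o f)^\- (- x)%R =
    \int[@lebesgue_measure R]_x (EFin \o f)^\+ x)%E.
  by apply: eq_integral => x _; rewrite funeposE funenegE /= fN -?EFinN opprK.
by case: (integral _ _ _) => //= r; rewrite subrr.
Qed.

Section fourier_inversion.
Context {R : realType}.
Local Notation TR := (measurableTypeR R).
Local Notation leb := (@lebesgue_measure R).
Variable nu : {finite_measure set TR -> \bar R}.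
Implicit Types (e w t y z : R).

(* Re (charf nu t * e^{- i t y}) *)
Definition phase y t : R := cosT nu t * cos (t * y) + sinT nu t * sin (t * y).

Definition invF y : R := (2 * pi)^-1 * \int[leb]_t phase y t.

(** [P] is the Abel factor and [K] its transform, pi times the Poisson kernel of the half-plane at
    height e. *)
Let P e t : R := expR (- (e * `|t|)).
Let K e w : R := e / (e ^+ 2 + w ^+ 2).
Let mass : R := fine (nu setT).

Let mP e : measurable_fun setT (P e).
Proof.
apply: (measurableT_comp (@measurable_expR R)).
apply: (measurableT_comp (@oppr_measurable R setT)).
apply: measurable_funM; first exact: measurable_cst.
exact: (continuous_measurable_fun (@norm_continuous _ R^o)).
Qed.

Let mphase y : measurable_fun setT (phase y).
Proof.
apply: measurable_funD; apply: measurable_funM.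
- exact: measurable_cosT.
- apply: (measurableT_comp (continuous_measurable_fun (@continuous_cos R))).
  by apply: measurable_funM => //; exact: measurable_cst.
- exact: measurable_sinT.
- apply: (measurableT_comp (continuous_measurable_fun (@continuous_sin R))).
  by apply: measurable_funM => //; exact: measurable_cst.
Qed.

Let phaseE y t : (\int[nu]_z (1 + cos (t * (z - y)))%:E = (mass + phase y t)%:E)%E.
Proof.
have := integral_1Dcos nu t (- (t * y)); rewrite cosN sinN mulrN opprK => <-.
by apply: eq_integral => z _; congr (1 + cos _)%:E; ring.
Qed.

Let phase_tonelli e y : 0 < e ->
  (\int[leb]_t ((mass + phase y t) * P e t)%:E =
   \int[nu]_z (2 * (e^-1 + K e (z - y)))%:E)%E.
Proof.
move=> e0.
pose h (p : TR * TR) : \bar R := ((1 + cos (p.1 * (p.2 - y))) * P e p.1)%:E.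
have c0 (u : R) : 0 <= 1 + cos u by rewrite -lerBlDl sub0r; have := cos_geN1 u.
have mh : measurable_fun setT h.
  apply/measurable_EFinP; apply: measurable_funM.
    apply: measurable_funD; first exact: measurable_cst.
    apply: (measurableT_comp (continuous_measurable_fun (@continuous_cos R))).
    apply: measurable_funM; first exact: measurable_fst.
    by apply: measurable_funB; [exact: measurable_snd|exact: measurable_cst].
  exact: (measurableT_comp (mP e) measurable_fst).
have h0 p : (0 <= h p)%E by rewrite lee_fin mulr_ge0// expR_ge0.
transitivity (\int[leb]_t \int[nu]_z h (t, z))%E.
  apply: eq_integral => t _; rewrite EFinM -phaseE /h/=.
  rewrite -ge0_integralZr//.
  - apply/measurable_EFinP; apply: measurable_funD; first exact: measurable_cst.
    apply: (measurableT_comp (continuous_measurable_fun (@continuous_cos R))).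
    apply: measurable_funM; first exact: measurable_cst.
    by apply: measurable_funB => //; exact: measurable_cst.
  - by rewrite lee_fin expR_ge0.
rewrite (fubini_tonelli h mh h0).
by apply: eq_integral => z _; rewrite -integral_poisson_cos.
Qed.

Let integral_P e : 0 < e -> (\int[leb]_t (P e t)%:E = (2 / e)%:E)%E.
Proof.
move=> e0; have := integral_poisson_cos 0 e0.
under eq_integral do rewrite mulr0 cos0 EFinM.
rewrite ge0_integralZl//; last first.
  by apply/measurable_EFinP; exact: mP.
move=> h; have : (2^-1%:E * ((1 + 1)%:E * \int[leb]_t (P e t)%:E) =
    2^-1%:E * (2 * (e^-1 + e / (e ^+ 2 + 0 ^+ 2)))%:E)%E by rewrite h.
rewrite muleA -!EFinM (_ : 2^-1 * (1 + 1) = 1 :> R); last by field.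
rewrite mul1e => ->; congr EFin; field.
by rewrite gt_eqF.
Qed.

Let integrable_P e : 0 < e -> leb.-integrable setT (EFin \o P e).
Proof.
move=> e0; apply/integrableP; split; first by apply/measurable_EFinP; exact: mP.
under eq_integral do rewrite /= ger0_norm ?expR_ge0//.
by rewrite integral_P// ltry.
Qed.

Variable D : R -> R.
Hypothesis intD : leb.-integrable setT (EFin \o D).
Hypothesis cosD : forall t, `|cosT nu t| <= D t.
Hypothesis sinD : forall t, `|sinT nu t| <= D t.

Let phaseD y t : `|phase y t| <= 2 * D t.
Proof.
have D0 : 0 <= D t by apply: le_trans (cosD t).
rewrite (le_trans (ler_normD _ _))// mulr_natl mulr2n lerD// normrM -[leRHS]mulr1.
  by rewrite ler_pM// cos_max.
by rewrite ler_pM// sin_max.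
Qed.

Let int2D : leb.-integrable setT (EFin \o (fun t => 2 * D t)).
Proof. exact: (integrableZl _ 2 intD). Qed.

Lemma integrable_phase y : leb.-integrable setT (EFin \o phase y).
Proof.
apply: (le_integrable _ _ _ int2D) => //; first by apply/measurable_EFinP; exact: mphase.
by move=> t _; rewrite /= lee_fin (le_trans (phaseD _ _))// ler_norm.
Qed.

Let P_le1 e t : 0 < e -> P e t <= 1.
Proof. by move=> e0; rewrite -expR0 ler_expR oppr_le0 mulr_ge0// ltW. Qed.

Let phasePD y e t : 0 < e -> `|phase y t * P e t| <= 2 * D t.
Proof.
move=> e0; rewrite normrM -[leRHS]mulr1 ler_pM// ger0_norm ?expR_ge0//.
exact: P_le1.
Qed.

Let int_phaseP y e : 0 < e -> leb.-integrable setT (EFin \o (fun t => phase y t * P e t)).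
Proof.
move=> e0; apply: (le_integrable _ _ _ int2D) => //.
  by apply/measurable_EFinP; apply: measurable_funM; [exact: mphase|exact: mP].
by move=> t _; rewrite /= lee_fin (le_trans (phasePD _ _ e0))// ler_norm.
Qed.

Let K_ge0 e w : 0 < e -> 0 <= K e w.
Proof. by move=> e0; rewrite divr_ge0 ?addr_ge0 ?sqr_ge0// ltW. Qed.

Let K_le e w : 0 < e -> `|K e w| <= e^-1.
Proof.
move=> e0; rewrite ger0_norm ?K_ge0// ler_pdivrMr ?ltr_pwDl ?sqr_ge0 ?exprn_gt0//.
rewrite mulrDr expr2 mulKf ?gt_eqF// lerDl mulr_ge0 ?sqr_ge0// invr_ge0 ltW//.
Qed.

Let mK e y : 0 < e -> measurable_fun setT (fun z => K e (z - y)).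
Proof.
move=> e0; apply: continuous_measurable_fun => z.
have D0 : e ^+ 2 + (z - y) ^+ 2 != 0.
  by rewrite gt_eqF// ltr_pwDl ?sqr_ge0// exprn_gt0.
apply: cvgM; first exact: cvg_cst.
apply: cvgV => //; apply: cvgD; first exact: cvg_cst.
have : {for z, continuous (fun z : R => (z - y) ^+ 2)}.
  by apply: differentiable_continuous; apply/derivable1_diffP; exact: ex_derive.
by [].
Qed.

Let int_K e y : 0 < e -> nu.-integrable setT (EFin \o (fun z => K e (z - y))).
Proof.
by move=> e0; apply: (@bounded_integrable _ nu _ e^-1); [exact: mK|move=> z; exact: K_le].
Qed.

(** In [phase_tonelli] the constant 1 contributes 2 mass / e to both sides; once these finite terms
    are cancelled, the smoothed inversion integral is an average of Cauchy kernels over [nu]. *)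
Let phase_cauchy e y : 0 < e ->
  \int[leb]_t (phase y t * P e t) = 2 * \int[nu]_z K e (z - y).
Proof.
move=> e0; have := phase_tonelli y e0.
have iP := integrable_P e0; have iphP := int_phaseP y e0; have iK := int_K y e0.
under eq_integral do rewrite mulrDl.
rewrite integralD_EFin//=; last exact: (integrableZl _ mass iP).
under eq_integral do rewrite EFinM.
rewrite integralZl// integral_P//.
under [in RHS]eq_integral do rewrite mulrDr.
rewrite [in RHS]integralD_EFin//=; last 2 first.
- exact: finite_measure_integrable_cst.
- exact: (integrableZl _ 2 iK).
have -> : (\int[nu]__ (2 / e)%:E = (2 / e * mass)%:E)%E.
  by rewrite integral_cst// [in RHS]EFinM /mass fineK ?fin_num_measure.
under [X in (_ = _ + X)%E]eq_integral do rewrite EFinM.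
rewrite integralZl//.
rewrite -(@fineK _ (\int[leb]_t (phase y t * P e t)%:E)%E) ?integrable_fin_num//.
rewrite -(@fineK _ (\int[nu]_z (K e (z - y))%:E)%E) ?integrable_fin_num//.
rewrite -!EFinM -!EFinD => -[].
rewrite -/(Rintegral _ _ _) -/(Rintegral _ _ _).
rewrite (_ : mass * (2 / e) = 2 / e * mass); last by rewrite mulrC.
exact: addrI.
Qed.

Let dl (n : nat) : R := n.+1%:R^-1.
Let dl0 n : 0 < dl n. Proof. by rewrite invr_gt0. Qed.
Let dl20 n : 0 < dl n ^+ 2. Proof. by rewrite exprn_gt0. Qed.

(* Translating by delta while smoothing at scale delta^2 makes the limit the
   indicator of a half-open interval, so that atoms need no separate care. *)
Let G n y : R := (2 * pi)^-1 * \int[leb]_t (phase (y + dl n) t * P (dl n ^+ 2) t).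

Let GE n y : G n y = pi^-1 * \int[nu]_z K (dl n ^+ 2) (z - (y + dl n)).
Proof.
have H (q X : R) : q != 0 -> (2 * q)^-1 * (2 * X) = q^-1 * X by move=> q0; field.
by rewrite /G phase_cauchy// H// gt_eqF ?pi_gt0.
Qed.

Let dl_cvg : dl n @[n --> \oo] --> 0.
Proof. exact: cvg_harmonic. Qed.

Let G_cvg y : G n y @[n --> \oo] --> invF y.
Proof.
apply: cvgM; first exact: cvg_cst.
have [||||_ H] := @Rdominated_cvg _ TR R leb setT measurableT
  (fun n t => phase (y + dl n) t * P (dl n ^+ 2) t) (phase y) (fun t => 2 * D t); last exact: H.
- by move=> n; apply: measurable_funM; [exact: mphase|exact: mP].
- move=> t _; rewrite -[phase y t]mulr1.
  have c1 : {for 0, continuous (fun d : R => phase (y + d) t)}.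
    by apply: differentiable_continuous; apply/derivable1_diffP; exact: ex_derive.
  have c2 : {for 0, continuous (fun d : R => expR (- (d ^+ 2 * `|t|)))}.
    by apply: differentiable_continuous; apply/derivable1_diffP; exact: ex_derive.
  apply: cvgM.
    have := continuous_cvg _ c1 dl_cvg; rewrite addr0; exact.
  have := continuous_cvg _ c2 dl_cvg; rewrite expr0n mul0r oppr0 expR0; exact.
- exact: int2D.
- by move=> n t _; exact: phasePD.
Qed.

Let G_ge0 n y : 0 <= G n y.
Proof.
by rewrite GE mulr_ge0 ?invr_ge0 ?pi_ge0// Rintegral_ge0// => z _; exact: K_ge0.
Qed.

(** [invF y] is the limit of the [G n y], each an integral of a positive kernel by [GE]. *)
Lemma invF_ge0 y : 0 <= invF y.
Proof.
rewrite -(cvg_lim _ (@G_cvg y))//; apply: limr_ge.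
  by apply/cvg_ex; exists (invF y); exact: G_cvg.
by apply: nearW => n; exact: G_ge0.
Qed.

Let B : R := (2 * pi)^-1 * \int[leb]_t (2 * D t).

Let G_le n y : G n y <= B.
Proof.
apply: ler_wpM2l; first by rewrite invr_ge0 mulr_ge0 ?pi_ge0.
apply: le_Rintegral => //; first exact: int_phaseP.
by move=> t _; apply: le_trans (ler_norm _) _; exact: phasePD.
Qed.

Let mK0 e : 0 < e -> measurable_fun setT (K e).
Proof.
move=> e0; have := mK 0 e0; rewrite (_ : (fun z => _) = K e)//.
by apply/funext => z; rewrite subr0.
Qed.

Let mK2 n : measurable_fun setT (fun p : TR * TR => K (dl n ^+ 2) (p.2 - (p.1 + dl n))).
Proof.
apply: (measurableT_comp (mK0 (dl20 n))); apply: measurable_funB; first exact: measurable_snd.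
by apply: measurable_funD; [exact: measurable_fst|exact: measurable_cst].
Qed.

Let mG n : measurable_fun setT (G n).
Proof.
pose h (p : TR * TR) : \bar R := (K (dl n ^+ 2) (p.2 - (p.1 + dl n)))%:E.
have mh : measurable_fun setT h by apply/measurable_EFinP; exact: mK2.
have h0 p : (0 <= h p)%E by rewrite lee_fin K_ge0.
have := @measurable_fun_fubini_tonelli_F _ _ TR TR R nu h mh h0.
rewrite (_ : fubini_F nu h = EFin \o (fun y => \int[nu]_z K (dl n ^+ 2) (z - (y + dl n)))).
  move=> /measurable_EFinP H.
  rewrite (_ : G n = (fun y => pi^-1 * (\int[nu]_z K (dl n ^+ 2) (z - (y + dl n))))).
    by apply: measurable_funM => //; exact: measurable_cst.
  by apply/funext => y; rewrite GE.
apply/funext => y; rewrite /fubini_F /h/= fineK//.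
by apply: integrable_fin_num => //; exact: int_K.
Qed.

(** Tonelli lets the Cauchy kernel be integrated first in y over [u, v], which produces
    arctangents. *)
Let int_G n u v : u < v -> \int[leb]_(y in `[u, v]) G n y =
  \int[nu]_z (pi^-1 * (atan ((v + dl n - z) / dl n ^+ 2) - atan ((u + dl n - z) / dl n ^+ 2))).
Proof.
move=> uv; rewrite /Rintegral; congr fine.
pose h (p : TR * TR) : \bar R :=
  (pi^-1 * (K (dl n ^+ 2) (p.2 - (p.1 + dl n)) * \1_`[u, v] p.1))%:E.
have pi0 : 0 <= pi^-1 :> R by rewrite invr_ge0 pi_ge0.
have mh : measurable_fun setT h.
  apply/measurable_EFinP; apply: measurable_funM; first exact: measurable_cst.
  apply: measurable_funM; first exact: mK2.
  have mI : measurable_fun setT (\1_`[u, v] : TR -> R) by exact: measurable_indic.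
  exact: (measurableT_comp mI measurable_fst).
have h0 p : (0 <= h p)%E.
  by rewrite lee_fin; apply: mulr_ge0 => //; apply: mulr_ge0; [exact: K_ge0|].
transitivity (\int[leb]_y \int[nu]_z h (y, z))%E.
  rewrite integral_mkcond; apply: eq_integral => y _; rewrite patchE /h/= indicE.
  case: ifP => _; last first.
    by under eq_integral do rewrite mulr0 mulr0; rewrite integral0.
  under eq_integral do rewrite mulr1 EFinM.
  have iK := int_K (y + dl n) (dl20 n).
  rewrite integralZl// GE EFinM; congr (_ * _)%E.
  by rewrite /Rintegral fineK// integrable_fin_num.
rewrite (fubini_tonelli h mh h0); apply: eq_integral => z _.
transitivity (\int[leb]_(y in `[u, v]) (pi^-1%:E * (K (dl n ^+ 2) ((z - dl n) - y))%:E))%E.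
  rewrite [RHS]integral_mkcond; apply: eq_integral => y _; rewrite patchE /h/= indicE.
  case: ifP => _; last by rewrite !mulr0.
  by rewrite mulr1 EFinM; congr (_ * (K _ _)%:E)%E; ring.
rewrite ge0_integralZl//; first last.
- by move=> y _; rewrite lee_fin K_ge0.
- apply/measurable_EFinP/measurable_funTS; apply: (measurableT_comp (mK0 (dl20 n))).
  by apply: measurable_funB => //; exact: measurable_cst.
rewrite integral_cauchy_itv// -EFinM; congr (_ * (atan (_ / _) - atan (_ / _)))%:E; ring.
Qed.

Let atan_cvg u z : pi^-1 * atan ((u + dl n - z) / dl n ^+ 2) @[n --> \oo] -->
  ((if z <= u then 2^-1 else - 2^-1) : R).
Proof.
have pi0 : pi != 0 :> R by rewrite gt_eqF ?pi_gt0.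
(* With N = 1 / delta the argument is N ((u - z) N + 1). At z = u it equals N and still tends to
   +oo, so the tie falls on the side z <= u; the difference for v and u is thus the indicator of ]u,
   v]. *)
have xE n : (u + dl n - z) / dl n ^+ 2 = n.+1%:R * ((u - z) * n.+1%:R + 1).
  have : n.+1%:R != 0 :> R by [].
  by rewrite /dl; move: n.+1%:R => N N0; field.
under eq_fun do rewrite xE.
case: leP => zu.
  have -> : 2^-1 = pi^-1 * (pi / 2) :> R by rewrite mulrA mulVf ?mul1r.
  apply: cvgM; first exact: cvg_cst.
  apply: ((cvg_pinftyP _ _).1 (@cvgy_atan R)).
  apply: (ger_cvgy _ cvgr_idn); apply: nearW => n.
  rewrite (@le_trans _ _ n.+1%:R)//; first by rewrite ler_nat.
  by rewrite ler_peMr// lerDr mulr_ge0// subr_ge0.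
have -> : - 2^-1 = pi^-1 * - (pi / 2) :> R by rewrite mulrN mulrA mulVf ?mul1r.
apply: cvgM; first exact: cvg_cst.
under eq_fun do rewrite -[X in atan X]opprK atanN.
apply: cvgN; apply: ((cvg_pinftyP _ _).1 (@cvgy_atan R)).
apply: (ger_cvgy _ cvgr_idn); near=> n.
rewrite (@le_trans _ _ n.+1%:R)//; first by rewrite ler_nat.
rewrite -mulrN ler_peMr//.
have : 2 / (z - u) <= n.+1%:R.
  by rewrite (@le_trans _ _ n%:R) ?ler_nat//; near: n; exact: nbhs_infty_ger.
rewrite ler_pdivrMr ?subr_gt0// => h; lra.
Unshelve. all: by end_near. Qed.

Lemma measurable_invF : measurable_fun setT invF.
Proof. by apply: (measurable_fun_cvg mG) => y _; exact: G_cvg. Qed.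

(** Both sides of [int_G] converge by dominated convergence: the Lebesgue side under the uniform
    bound [B] on a bounded interval, the other because the arctangent quotients are at most 1 in
    absolute value. *)
Let invF_oc (u v : R) : u < v ->
  nu `]u, v]%classic = (\int[leb]_(y in `]u, v]) (invF y)%:E)%E.
Proof.
move=> uv.
have [||||iF cF] := @Rdominated_cvg _ TR R leb `[u, v]%classic (measurable_itv _) G invF (cst B).
- by move=> n; apply: measurable_funTS; exact: mG.
- by move=> y _; exact: G_cvg.
- have L : (leb `[u, v]%classic < +oo)%E.
    by rewrite lebesgue_measure_itv/= lte_fin uv -EFinB ltry.
  apply: (@measurable_bounded_integrable _ TR R leb) => //.
  by exists `|B|; split => // M MB x _ /=; rewrite ltW.
- by move=> n y _; rewrite ger0_norm ?G_ge0// G_le.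
have [||||_ cN] := @Rdominated_cvg _ TR R nu setT measurableT
  (fun n z => pi^-1 * (atan ((v + dl n - z) / dl n ^+ 2) - atan ((u + dl n - z) / dl n ^+ 2)))
  (\1_`]u, v]) (cst 1).
- move=> n; have ma (w : R) : measurable_fun setT (fun z : R => atan ((w + dl n - z) / dl n ^+ 2)).
    apply: continuous_measurable_fun => z.
    by apply: differentiable_continuous; apply/derivable1_diffP; exact: ex_derive.
  apply: measurable_funM; first exact: measurable_cst.
  exact: (measurable_funB (ma v) (ma u)).
- move=> z' _; pose z : R := z'; rewrite -/z.
  under eq_fun do rewrite mulrBr.
  have := cvgB (@atan_cvg v z) (@atan_cvg u z).
  suff -> : \1_`]u, v] z = (if z <= v then 2^-1 else - 2^-1) - (if z <= u then 2^-1 else - 2^-1) :> R.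
    by move=> h; exact: h.
  rewrite indicE mem_setE in_itv/=.
  have [zu|zu] := leP z u; have [zv|zv] := leP z v => /=.
  + by rewrite subrr.
  + by move: (le_lt_trans zu (lt_trans uv zv)); rewrite ltxx.
  + by rewrite opprK [LHS](splitr 1) !mul1r.
  + by rewrite subrr.
- exact: finite_measure_integrable_cst.
- move=> n z _; rewrite normrM gtr0_norm ?invr_gt0 ?pi_gt0//.
  rewrite mulrC ler_pdivrMr ?pi_gt0// mul1r ler_norml.
  have h1 w := @atan_ltpi2 R w; have h2 w := @atan_gtNpi2 R w.
  have := h1 ((v + dl n - z) / dl n ^+ 2); have := h2 ((v + dl n - z) / dl n ^+ 2).
  have := h1 ((u + dl n - z) / dl n ^+ 2); have := h2 ((u + dl n - z) / dl n ^+ 2).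
  move=> *; lra.
have E : \int[nu]_z \1_`]u, v] z = \int[leb]_(y in `[u, v]) invF y.
  apply: (cvg_unique _ cN) => //; rewrite (_ : (fun n => _) = (fun n => \int[leb]_(y in `[u, v]) G n y))//.
  by apply/funext => n; rewrite int_G.
have mF : measurable_fun `]u, v] (EFin \o invF).
  by apply/measurable_EFinP; apply: measurable_funTS; exact: measurable_invF.
rewrite integral_itv_obnd_cbnd//.
rewrite -(@fineK _ (\int[leb]_(y in `[u, v]) (invF y)%:E)%E); last exact: integrable_fin_num.
rewrite -/(Rintegral _ _ _) -E /Rintegral integral_indic// setIT.
by rewrite fineK// fin_num_measure.
Qed.

Theorem fourier_inversion (A : set R) : measurable A ->
  nu A = (\int[leb]_(y in A) (invF y)%:E)%E.
Proof.
move=> mA.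
have [m mE] := @density_measure _ TR R leb _ measurable_invF invF_ge0.
rewrite -mE//.
apply: (@measure_unique _ R TR (@ocitv R) (fun n => `](- n%:R), n%:R]%classic) _ _ _ _ nu m) => //.
- exact: ocitvI.
- by move=> n; exists (- n%:R, n%:R).
- apply/seteqP; split => // x _.
  exists (Num.truncn `|x|).+1 => //=; rewrite in_itv/=.
  have := truncnS_gt `|x|; rewrite ltr_norml => /andP[-> /ltW ->//].
- move=> _ [[u v]] _ <- /=.
  have [uv|uv] := ltP u v; last by rewrite set_itv_ge -?leNgt// !measure0.
  by rewrite mE//; exact: invF_oc.
- by move=> k; rewrite -ge0_fin_numE// fin_num_measure.
Qed.

End fourier_inversion.

(** * Decay of the characteristic function of a log-beta law *)

Section decay.
Context {R : realType}.
Local Notation TR := (measurableTypeR R).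
Local Notation leb := (@lebesgue_measure R).
Implicit Types (a s t x y p : R).

Lemma ge0_Rintegral_scale (c : R) (f : R -> R) : 0 < c -> measurable_fun setT f ->
  (forall x, 0 <= f x) ->
  \int[leb]_x f (c * x) = c^-1 * \int[leb]_x f x.
Proof.
move=> c0 mf f0; rewrite /Rintegral.
rewrite (ge0_integral_scale (f := EFin \o f))//; last exact/measurable_EFinP.
have ci0 : 0 < c^-1 by rewrite invr_gt0.
by case: (\int[leb]_x _)%E => //=; rewrite ?gt0_muley ?gt0_muleNy ?lte_fin//= mulr0.
Qed.

Lemma integrable_scale (c : R) (f : R -> R) : 0 < c ->
  leb.-integrable setT (EFin \o f) -> leb.-integrable setT (EFin \o (fun x => f (c * x))).
Proof.
move=> c0 /integrableP[mf fi]; apply/integrableP; split.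
  apply: (measurableT_comp mf); apply: measurable_funM => //; exact: measurable_cst.
rewrite (ge0_integral_scale (f := fun x => `|(EFin \o f) x|%E))//.
  by rewrite lte_mul_pinfty// lee_fin invr_ge0 ltW.
exact: measurableT_comp.
Qed.

Lemma Rintegral_scale (c : R) (f : R -> R) : 0 < c ->
  leb.-integrable setT (EFin \o f) ->
  \int[leb]_x f (c * x) = c^-1 * \int[leb]_x f x.
Proof.
move=> c0 fi; have /integrableP[mf' _] := fi.
have mf : measurable_fun setT f by exact/measurable_EFinP.
have mn : measurable_fun setT (fun x => `|f x|).
  apply: (measurableT_comp _ mf); exact: (continuous_measurable_fun (@norm_continuous _ R^o)).
have ni : leb.-integrable setT (EFin \o (fun x => `|f x|)).
  exact: integrable_norm.
have E : (fun x => f x) = (fun x => (f x + `|f x|) - `|f x|).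
  by apply/funext => x; rewrite addrK.
have si : leb.-integrable setT (EFin \o (fun x => f x + `|f x|)).
  exact: (integrableD measurableT fi ni).
have s0 x : 0 <= f x + `|f x|.
  by have := ler_norm (- f x); rewrite normrN; lra.
transitivity (\int[leb]_x ((f (c * x) + `|f (c * x)|) - `|f (c * x)|)).
  by apply: eq_Rintegral => x _; rewrite addrK.
rewrite RintegralB//; last 2 first.
- exact: (integrable_scale c0 si).
- exact: (integrable_scale c0 ni).
rewrite (ge0_Rintegral_scale (f := fun x => f x + `|f x|))//; last exact: measurable_funD.
rewrite (ge0_Rintegral_scale (f := fun x => `|f x|))//.
rewrite -mulrBr -RintegralB//; congr (_ * _).
by apply: eq_Rintegral => x _; rewrite addrK.
Qed.

Lemma integrable_bw a s : 0 < a -> 0 < s -> leb.-integrable setT (EFin \o bw a s).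
Proof.
move=> a0 s0; apply/integrableP; split; first by apply/measurable_EFinP; exact: measurable_bw.
under eq_integral do rewrite /= ger0_norm ?bw_ge0//.
by rewrite -/(Br a s) ltey_eq Br_fin.
Qed.

(** For 0 < x < 1 the quotient of the two sides is c^a ((1 - c x) / (1 - x))^(s-1), a product of two
    factors at most 1; the second one uses s <= 1. *)
Lemma bw_homo a s x c : 0 < a -> s <= 1 -> 0 < c <= 1 -> x < 1 -> c * bw a s (c * x) <= bw a s x.
Proof.
move=> a0 s1 /andP[c0 c1] x1; rewrite /bw x1 andbT pmulr_rgt0//.
case: ltP => x0 /=; last by rewrite mulr0.
have cx1 : c * x < 1 by rewrite (le_lt_trans _ x1)// ler_piMl// ltW.
have cx0 : 0 < c * x by rewrite mulr_gt0.
rewrite cx1 -[c in c * expR _]lnK// -expRD ler_expR lnM//.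
have l1 : ln c <= 0 by rewrite ln_le0.
have l2 : ln (1 - x) <= ln (1 - c * x).
  by rewrite ler_ln ?posrE ?subr_gt0// lerB// ler_piMl// ltW.
nra.
Qed.

(** Scaling x by lam = e^(-pi/t) shifts t ln x by -pi and negates [g]. Averaging the integral with
    its rescaled copy replaces the weight by half of d(x) = bw(x) - lam bw(lam x). This d has
    integral zero and, by [bw_homo], is nonnegative for x < 1, so its total variation is twice the
    mass of lam bw(lam x) on x >= 1, that is, of bw on [lam, 1]. *)
Lemma half_period_bound a s t (g : R -> R) : 0 < a -> 0 < s <= 1 -> 0 < t ->
  measurable_fun setT g -> (forall u, `|g u| <= 1) -> (forall u, g (u - pi) = - g u) ->
  `|\int[leb]_x (g (t * ln x) * bw a s x)| <=
  \int[leb]_x (bw a s x * \1_`[expR (- (pi / t)), +oo[ x).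
Proof.
move=> a0 /andP[s0 s1] t0 mg g1 gpi.
set lam := expR (- (pi / t)).
have lam0 : 0 < lam by exact: expR_gt0.
have lam1 : lam <= 1 by rewrite -expR0 ler_expR oppr_le0 divr_ge0 ?pi_ge0 ?ltW.
have ib := integrable_bw a0 s0.
have ibl := integrable_scale lam0 ib.
pose f x := g (t * ln x) * bw a s x.
have mgl : measurable_fun setT (fun x => g (t * ln x)).
  apply: (measurableT_comp mg).
  by apply: measurable_funM => //; exact: measurable_ln.
have ifb h : leb.-integrable setT (EFin \o h) -> leb.-integrable setT (EFin \o (fun x => g (t * ln x) * h x)).
  move=> ih; apply: (le_integrable _ _ _ ih) => //.
    have /integrableP[mh _] := ih.
    by apply/measurable_EFinP/measurable_funM => //; exact/measurable_EFinP.
  by move=> x _; rewrite /= lee_fin normrM ler_piMl.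
have I1 : \int[leb]_x f x = - (lam * \int[leb]_x (g (t * ln x) * bw a s (lam * x))).
  have := Rintegral_scale lam0 (ifb _ ib); rewrite -/f => h.
  have -> : \int[leb]_x f x = lam * \int[leb]_x f (lam * x).
    by rewrite h mulrA mulfV ?mul1r ?gt_eqF.
  rewrite -mulrN; congr (_ * _); rewrite -mulN1r -RintegralZl//; last exact: ifb.
  apply: eq_Rintegral => x _; rewrite /f.
  have [x0|x0] := ltP 0 x; last first.
    by rewrite /bw pmulr_rgt0// ltNge x0/= !mulr0.
  rewrite lnM// expRK mulrDr mulrN mulrCA mulfV ?gt_eqF// mulr1 addrC gpi; ring.
have lamE : lam * \int[leb]_x (g (t * ln x) * bw a s (lam * x)) =
    \int[leb]_x (g (t * ln x) * (lam * bw a s (lam * x))).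
  by rewrite -RintegralZl//; [apply: eq_Rintegral => x _; ring|exact: ifb].
have ibl2 : leb.-integrable setT (EFin \o (fun x => lam * bw a s (lam * x))).
  exact: (integrableZl _ lam ibl).
have I2 : 2 * \int[leb]_x f x = \int[leb]_x (g (t * ln x) * (bw a s x - lam * bw a s (lam * x))).
  rewrite mulr_natl mulr2n {2}I1 lamE -RintegralB//; last 2 first.
  - exact: ifb.
  - exact: ifb.
  by apply: eq_Rintegral => x _; rewrite mulrBr.
pose k x := bw a s x * \1_`[lam, +oo[ x.
have ik : leb.-integrable setT (EFin \o k).
  apply: (le_integrable _ _ _ ib) => //.
    apply/measurable_EFinP/measurable_funM; first exact: measurable_bw.
    exact: measurable_indic.
  move=> x _; rewrite /= lee_fin normrM ler_piMr// indicE; case: (_ \in _) => /=.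
    by rewrite normr1.
  by rewrite normr0.
have ikl : leb.-integrable setT (EFin \o (fun x => 2 * (lam * k (lam * x)))).
  exact: (integrableZl _ 2 (integrableZl _ lam (integrable_scale lam0 ik))).
have id : leb.-integrable setT (EFin \o (fun x => bw a s x - lam * bw a s (lam * x))).
  exact: (integrableB _ ib ibl2).
have kE : \int[leb]_x (2 * (lam * k (lam * x))) = 2 * \int[leb]_x k x.
  rewrite RintegralZl//; last exact: (integrableZl _ lam (integrable_scale lam0 ik)).
  rewrite RintegralZl//; last exact: (integrable_scale lam0 ik).
  by rewrite Rintegral_scale// mulVKf// gt_eqF.
have d0 : \int[leb]_x (bw a s x - lam * bw a s (lam * x)) = 0.
  rewrite RintegralB// RintegralZl// Rintegral_scale//. rewrite mulVKf ?gt_eqF//.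
  by rewrite subrr.
(* Pointwise |d| <= d + 2 lam k(lam x), since the negative part of d is carried by x >= 1; adding d
   costs nothing because its integral is 0. *)
rewrite -(ler_pM2l (ltr0Sn R 1)) -[2 in X in X <= _]ger0_norm// -normrM I2 -kE.
rewrite -[leRHS]add0r -d0 -RintegralD//.
apply: (le_trans (le_normr_Rintegral _ _)) => //; first exact: ifb.
apply: le_Rintegral => //.
- exact: (integrable_norm (ifb _ id)).
- exact: (integrableD _ id ikl).
move=> x _; rewrite normrM (@le_trans _ _ `|bw a s x - lam * bw a s (lam * x)|)//.
  by rewrite ler_piMl.
have [x1|x1] := ltP x 1.
  rewrite ger0_norm ?subr_ge0 ?bw_homo ?lam0// lerDl !mulr_ge0 ?bw_ge0//; exact: ltW.
have b0 : bw a s x = 0 by rewrite /bw [x < 1]ltNge x1 andbF.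
rewrite b0 !sub0r normrN ger0_norm; last by rewrite mulr_ge0 ?bw_ge0// ltW.
rewrite /k indicE mem_setE in_itv/= andbT ler_peMr// ?mulr1; last exact: ltW.
lra.
Qed.

End decay.

Section decay2.
Context {R : realType}.
Local Notation TR := (measurableTypeR R).
Local Notation leb := (@lebesgue_measure R).
Implicit Types (a s t u x y p : R).

(** On [e^(-u), 1] one has |ln x| <= u <= pi, so x^(a-1) is at most [E], and 1 - x < u. The rest is
    the integral of (1 - x)^(s-1) over 0 < 1 - x < u, namely u^s / s. *)
Lemma bw_tail a s u : 0 < a -> 0 < s <= 1 -> 0 < u <= pi ->
  \int[leb]_x (bw a s x * \1_`[expR (- u), +oo[ x) <=
  expR (`|a - 1| * pi) * expR (s * ln u) / s.
Proof.
move=> a0 /andP[s0 s1] /andP[u0 upi].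
set E := expR (`|a - 1| * pi).
have mI : measurable_fun setT (fun x => bw a s x * \1_`[expR (- u), +oo[ x).
  by apply: measurable_funM; [exact: measurable_bw|exact: measurable_indic].
(* [q (1 - x)] is ((1 - x) / u)^(s-1) on 0 < 1 - x < u, written through [bw s 1] so that
   [integral_pow01] evaluates it. *)
pose q (v : R) : \bar R := (bw s 1 (u^-1 * v))%:E.
have mq : measurable_fun setT q.
  apply/measurable_EFinP; apply: (measurableT_comp (measurable_bw s 1)).
  by apply: measurable_funM => //; exact: measurable_cst.
have q0 v : (0 <= q v)%E by rewrite lee_fin bw_ge0.
have c0 : 0 <= E * expR ((s - 1) * ln u) by rewrite mulr_ge0 ?expR_ge0.
have qint : (\int[leb]_x q (- x + 1)%R = (u / s)%:E)%E.
  rewrite (ge0_integral_opp (f := fun x => q (x + 1)%R))//.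
    rewrite (ge0_integral_shift 1 (f := q))// /q.
    rewrite (ge0_integral_scale (f := fun v => (bw s 1 v)%:E)) ?invr_gt0//.
    - by rewrite invrK -/(Br s 1) integral_pow01.
    - by apply/measurable_EFinP; exact: measurable_bw.
    - by move=> v; rewrite lee_fin bw_ge0.
  apply: (measurableT_comp mq); apply: measurable_funD => //; exact: measurable_cst.
have mq' : measurable_fun setT (fun x : R => q (- x + 1)%R).
  apply: (measurableT_comp mq); apply: measurable_funD; last exact: measurable_cst.
  exact: oppr_measurable.
have H : (\int[leb]_x (bw a s x * \1_`[expR (- u), +oo[ x)%:E <=
    (E * expR ((s - 1) * ln u))%:E * (u / s)%:E)%E.
  rewrite -qint -ge0_integralZl//.
  apply: ge0_le_integral => //.
  - by move=> x _; rewrite lee_fin mulr_ge0 ?bw_ge0.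
  - exact/measurable_EFinP.
  - by apply: emeasurable_funM => //; exact: measurable_cst.
  move=> x _; rewrite indicE mem_setE in_itv/= andbT -EFinM lee_fin.
  have [ux|ux] := leP (expR (- u)) x; last first.
    by rewrite mulr0 mulr_ge0 ?bw_ge0.
  rewrite mulr1 {1}/bw; case: ifPn => [/andP[x0 x1]|_]; last by rewrite mulr_ge0 ?bw_ge0.
  have v0 : 0 < 1 - x by rewrite subr_gt0.
  have vu : 1 - x < u.
    rewrite ltrBlDr -ltrBlDl (lt_le_trans _ ux)//.
    by rewrite expR_gt1Dx// oppr_eq0 gt_eqF.
  rewrite /bw [- x + 1]addrC [u^-1 * _]mulrC pmulr_lgt0 ?invr_gt0// v0.
  rewrite ltr_pdivrMr// mul1r vu /= subrr mul0r addr0 -!expRD ler_expR.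
  rewrite ln_div ?posrE//.
  have l1 : ln x <= 0 by rewrite ln_le0// ltW.
  have l2 : - u <= ln x by rewrite -[- u]expRK ler_ln ?posrE ?expR_gt0.
  have l3 : (a - 1) * ln x <= `|a - 1| * pi.
    apply: (le_trans (ler_norm _)); rewrite normrM ler_wpM2l//.
    by rewrite ler0_norm// lerNl (le_trans _ l2)// lerN2.
  rewrite [(s - 1) * _ in leLHS](_ : _ = (s - 1) * ln u + (s - 1) * (ln (1 - x) - ln u)); last by ring.
  by rewrite addrA lerD2r lerD2r.
rewrite /Rintegral -lee_fin fineK.
  apply: (le_trans H); rewrite -EFinM lee_fin.
  rewrite -[u in (u / s)]lnK// -mulrA [expR (ln u) / s]mulrC mulrCA -mulrA.
  rewrite -expRD (_ : (s - 1) * ln u + ln u = s * ln u); last by ring.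
  by rewrite le_eqVlt; apply/orP; left; apply/eqP; ring.
rewrite ge0_fin_numE; first by apply: le_lt_trans H _; rewrite -EFinM ltry.
by apply: integral_ge0 => x _; rewrite lee_fin mulr_ge0 ?bw_ge0.
Qed.

(** The bound O(|t|^(-s)) for |t| >= 1 on each component; the exponential form makes exponents add
    under products. *)
Definition decays (phi : R -> R[i]) s := exists2 C, 0 <= C &
  forall t, 1 <= `|t| -> `|complex.Re (phi t)| <= C * expR (- s * ln `|t|) /\
                         `|complex.Im (phi t)| <= C * expR (- s * ln `|t|).

Lemma decaysM phi psi s1 s2 : decays phi s1 -> decays psi s2 ->
  decays (fun t => phi t * psi t) (s1 + s2).
Proof.
move=> [C C0 HC] [C' C'0 HC']; exists (2 * C * C').
  by rewrite !mulr_ge0.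
move=> t t1; have [h1 h2] := HC _ t1; have [h3 h4] := HC' _ t1.
have -> : 2 * C * C' * expR (- (s1 + s2) * ln `|t|) =
    (C * expR (- s1 * ln `|t|)) * (C' * expR (- s2 * ln `|t|)) +
    (C * expR (- s1 * ln `|t|)) * (C' * expR (- s2 * ln `|t|)).
  rewrite (_ : - (s1 + s2) * ln `|t| = - s1 * ln `|t| + - s2 * ln `|t|); last by ring.
  by rewrite expRD; ring.
case: (phi t) h1 h2 => x1 y1 /= h1 h2; case: (psi t) h3 h4 => x2 y2 /= h3 h4.
split.
- by rewrite (le_trans (ler_normB _ _))// lerD// normrM ler_pM.
- by rewrite (le_trans (ler_normD _ _))// lerD// normrM ler_pM.
Qed.

Lemma decaysZ phi s (c : R[i]) : decays phi s -> decays (fun t => c * phi t) s.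
Proof.
move=> [C C0 HC]; exists ((`|complex.Re c| + `|complex.Im c|) * C).
  by rewrite mulr_ge0// addr_ge0.
move=> t t1; have [h1 h2] := HC _ t1.
case: (phi t) h1 h2 => x1 y1 /= h1 h2; case: c => x2 y2 /=.
rewrite mulrDl mulrDl -!mulrA; split.
- by rewrite (le_trans (ler_normB _ _))// lerD// normrM ler_pM.
- by rewrite (le_trans (ler_normD _ _))// lerD// normrM ler_pM.
Qed.

Lemma eq_decays phi psi s : phi =1 psi -> decays phi s -> decays psi s.
Proof. by move=> /funext ->. Qed.

Lemma decays_blm_small a s : 0 < a -> 0 < s <= 1 -> decays (charf (blm a s)) s.
Proof.
move=> a0 s01; have /andP[s0 s1] := s01.
(* The bound of [bw_tail] at u = pi / t, with the factor t^(-s) taken out. *)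
pose C := expR (`|a - 1| * pi) * expR (s * ln pi) / s.
have C0 : 0 <= C by rewrite !mulr_ge0 ?expR_ge0// invr_ge0 ltW.
have H (g : R -> R) t : 1 <= t -> measurable_fun setT g -> (forall u, `|g u| <= 1) ->
    (forall u, g (u - pi) = - g u) ->
    `|\int[blm a s]_y g (t * y)| <= C * expR (- s * ln t).
  move=> t1 mg g1 gpi; have t0 : 0 < t by rewrite (lt_le_trans _ t1).
  rewrite /Rintegral blmE//; last first.
    apply/measurable_EFinP/(measurableT_comp mg).
    by apply: measurable_funM => //; exact: measurable_cst.
  apply: le_trans (half_period_bound a0 s01 t0 mg g1 gpi) _.
  have := @bw_tail a s (pi / t) a0 s01.
  rewrite divr_gt0 ?pi_gt0// ler_pdivrMr// ler_peMr ?pi_ge0// => /(_ isT)/le_trans; apply.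
  rewrite /C ln_div ?posrE ?pi_gt0// mulrBr expRD mulNr.
  by rewrite le_eqVlt; apply/orP; left; apply/eqP; ring.
have Hc t : 1 <= t -> `|cosT (blm a s) t| <= C * expR (- s * ln t).
  move=> t1; apply: H => //; first exact: (continuous_measurable_fun (@continuous_cos R)).
    by move=> u; exact: cos_max.
  by move=> u; rewrite cosB cospi sinpi mulr0 addr0 mulrN1.
have Hs t : 1 <= t -> `|sinT (blm a s) t| <= C * expR (- s * ln t).
  move=> t1; apply: H => //; first exact: (continuous_measurable_fun (@continuous_sin R)).
    by move=> u; exact: sin_max.
  by move=> u; rewrite sinB cospi sinpi mulr0 subr0 mulrN1.
exists C => // t; case: (ger0P t) => [t0|t0] t1 /=; first by split; [exact: Hc|exact: Hs].
have -> : cosT (blm a s) t = cosT (blm a s) (- t).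
  by apply: eq_Rintegral => y _; rewrite mulNr cosN.
have -> : sinT (blm a s) t = - sinT (blm a s) (- t).
  rewrite /sinT -mulN1r -RintegralZl//; last exact: integrable_sin0.
  by apply: eq_Rintegral => y _; rewrite [- t * y]mulNr sinN mulN1r opprK.
by rewrite normrN; split; [exact: Hc|exact: Hs].
Qed.

(** With h = s/2 <= 1, a beta(a, s) variable has, up to normalisation, the law of a product of
    independent beta(a, h) and beta(a + h, h) variables: Gamma(a + i t) / Gamma(a + s + i t) factors
    through Gamma(a + h + i t). The two exponents h add up to s. *)
Lemma decays_blm a s : 0 < a -> 0 < s < 2 -> decays (charf (blm a s)) s.
Proof.
move=> a0 /andP[s0 s2]; pose h := s / 2.
have h0 : 0 < h by rewrite divr_gt0.
have hs : s = h + h by rewrite /h -splitr.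
have h1 : 0 < h <= 1 by rewrite h0/=; lra.
have ah0 : 0 < a + h by rewrite addr_gt0.
have Gh0 : Gamma h%:C%C != 0 by exact: (Gamma_neq0 0 h0).
have := decaysM (decays_blm_small a0 h1) (decays_blm_small ah0 h1); rewrite -hs.
move=> /(decaysZ (Gamma s%:C%C / (Gamma h%:C%C ^+ 2))); apply: eq_decays => t.
have e1 := charf_beta_gamma t a0 h0.
have e2 := charf_beta_gamma t ah0 h0.
have e3 := charf_beta_gamma t a0 s0.
have n2 := Gamma_neq0 t ah0.
have as0 : 0 < a + s by rewrite addr_gt0.
have n3 := Gamma_neq0 t as0.
have ea : a + h + h = a + s by rewrite -addrA -hs.
rewrite ea in e2.
apply: (mulIf n3); rewrite e3.
apply: (mulIf (expf_neq0 2 Gh0)).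
apply: (mulIf n2).
transitivity (Gamma s%:C%C * (charf (blm a h) t * Gamma ((a + h) +i* t)%C) *
   (charf (blm (a + h) h) t * Gamma ((a + s) +i* t)%C)).
  by field.
by rewrite e1 e2; ring.
Qed.

End decay2.

(** * Products of independent beta variables *)

Section beta_products.
Context {R : realType}.
Local Notation TR := (measurableTypeR R).
Local Notation leb := (@lebesgue_measure R).
Implicit Types (a s t u x y c : R) (l : seq (R * R)).
Implicit Types nu m : {finite_measure set TR -> \bar R}.

Lemma convolution_measure_ex m1 m2 : exists nu : {finite_measure set TR -> \bar R},
    (forall f : R -> \bar R, measurable_fun setT f -> (forall x, 0 <= f x)%E ->
      (\int[nu]_x f x = \int[m1]_x \int[m2]_y f (x + y)%R)%E)
  /\ (forall t, charf nu t = charf m1 t * charf m2 t).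
Proof. by have [nu h1 h2] := convolution_measure m1 m2; exists nu. Qed.

Definition convm m1 m2 := projT1 (cid (convolution_measure_ex m1 m2)).

Lemma integral_convm m1 m2 (f : R -> \bar R) :
  measurable_fun setT f -> (forall x, 0 <= f x)%E ->
  (\int[convm m1 m2]_x f x = \int[m1]_x \int[m2]_y f (x + y)%R)%E.
Proof. by rewrite /convm; case: cid => nu /= [h _]; exact: h. Qed.

Lemma charf_convm m1 m2 t : charf (convm m1 m2) t = charf m1 t * charf m2 t.
Proof. by rewrite /convm; case: cid => nu /= [_ h]; exact: h. Qed.

Lemma measurable_integral_shift m (f : R -> \bar R) :
  measurable_fun setT f -> (forall x, 0 <= f x)%E ->
  measurable_fun setT (fun x : R => (\int[m]_y f (x + y)%R)%E).
Proof.
move=> mf f0; pose h (p : TR * TR) : \bar R := f (p.1 + p.2).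
have mh : measurable_fun setT h.
  apply: (measurableT_comp mf).
  by apply: measurable_funD; [exact: measurable_fst|exact: measurable_snd].
have h0 (p : TR * TR) : (0 <= h p)%E by exact: f0.
exact: (@measurable_fun_fubini_tonelli_F _ _ TR TR R m h mh h0).
Qed.

Lemma charf0 nu : charf nu 0 = (fine (nu setT))%:C%C.
Proof.
rewrite /charf; congr Complex.
  rewrite /cosT /Rintegral; congr fine.
  under eq_integral do rewrite mul0r cos0.
  by rewrite integral_cst// mul1e.
by rewrite /sinT; under eq_Rintegral do rewrite mul0r sin0; rewrite Rintegral_cst// mul0r.
Qed.

Lemma charf_dirac0 t : charf (dirac (0 : TR)) t = 1.
Proof.
rewrite /charf; congr Complex.
  rewrite /cosT /Rintegral integral_dirac//.
    by rewrite diracT mul1e/= mulr0 cos0.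
  by apply/measurable_EFinP; exact: measurable_cos0.
rewrite /sinT /Rintegral integral_dirac//.
  by rewrite diracT mul1e/= mulr0 sin0.
by apply/measurable_EFinP; exact: measurable_sin0.
Qed.

(* Law of the logarithm of a product of independent variables with the
   unnormalised beta densities x^(a+c-1) (1-x)^(s-1), for (a, s) in l. *)
Definition betal c l : {finite_measure set TR -> \bar R} :=
  foldr (fun p m => convm (blm (p.1 + c) p.2) m) (dirac (0 : TR)) l.

Definition beta_params c l := all (fun p => (0 < p.1 + c) && (0 < p.2)) l.

Local Open Scope complex_scope.

Lemma charf_betal c l t : beta_params c l ->
  charf (betal c l) t * \prod_(p <- l) Gamma ((p.1 + c + p.2) +i* t) =
  \prod_(p <- l) (Gamma (p.2)%:C * Gamma ((p.1 + c) +i* t)).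
Proof.
elim: l => [|p l IHl] /=; first by rewrite !big_nil mulr1 charf_dirac0.
move=> /andP[/andP[a0 s0] h]; rewrite !big_cons charf_convm -(IHl h).
by rewrite -(charf_beta_gamma t a0 s0) mulrACA.
Qed.

Lemma betal_decays c l : beta_params c l -> all (fun p => p.2 < 2) l ->
  decays (charf (betal c l)) (\sum_(p <- l) p.2).
Proof.
elim: l => [|p l IHl] /=.
  move=> _ _; rewrite big_nil; exists 1 => // t t1.
  by rewrite charf_dirac0 /= normr1 normr0 mul1r oppr0 mul0r expR0.
move=> /andP[/andP[a0 s0] h] /andP[s2 h2]; rewrite big_cons.
apply: (@eq_decays _ (fun t => charf (blm (p.1 + c) p.2) t * charf (betal c l) t)).
  by move=> t; rewrite charf_convm.
by apply: decaysM; [apply: decays_blm => //; rewrite s0|exact: IHl].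
Qed.

Lemma betal_mass c l : beta_params c l ->
  (fine (betal c l setT))%:C * \prod_(p <- l) Gamma (p.1 + c + p.2)%:C =
  \prod_(p <- l) (Gamma (p.2)%:C * Gamma (p.1 + c)%:C).
Proof. by move=> h; rewrite -charf0; exact: (charf_betal 0 h). Qed.

Local Close Scope complex_scope.

Lemma blm_tilt a s c (f : R -> \bar R) : 0 < a -> 0 < s -> 0 < a + c ->
  measurable_fun setT f ->
  (\int[blm a s]_y (f y * (expR (c * y))%:E) = \int[blm (a + c) s]_y f y)%E.
Proof.
move=> a0 s0 ac0 mf; rewrite !blmE//; last first.
  apply: emeasurable_funM => //; apply/measurable_EFinP.
  apply: (measurableT_comp (@measurable_expR R)).
  by apply: measurable_funM => //; exact: measurable_cst.
apply: eq_integral => x _; rewrite -muleA -EFinM; congr (_ * _%:E)%E.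
rewrite /bw; case: ifP => _; last by rewrite mulr0.
by rewrite -expRD; congr expR; ring.
Qed.

(** The factor e^(d y) multiplies each beta weight by x^d. With d = 1 - c this carries the density
    read off on the line Re u = c to the fixed measure at c = 1, and with d = n it computes the n-th
    moment. *)
Lemma betal_tilt c d l (f : R -> \bar R) :
  beta_params c l -> beta_params (c + d) l ->
  measurable_fun setT f -> (forall y, 0 <= f y)%E ->
  (\int[betal c l]_y (f y * (expR (d * y))%:E) = \int[betal (c + d) l]_y f y)%E.
Proof.
have me k : measurable_fun setT (fun y : R => (expR (k * y))%:E).
  apply/measurable_EFinP/(measurableT_comp (@measurable_expR R)).
  by apply: measurable_funM => //; exact: measurable_cst.
elim: l f => [|p l IHl] f /=.
  move=> _ _ mf f0; rewrite !integral_dirac//; last exact: (emeasurable_funM mf (me d)).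
  by rewrite mulr0 expR0 mule1.
move=> /andP[/andP[a0 s0] h] /andP[/andP[a1 _] h1] mf f0.
have mfx x : measurable_fun setT (fun y : R => f (x + y)).
  by apply: (measurableT_comp mf); apply: measurable_funD => //; exact: measurable_cst.
rewrite !integral_convm//; last 2 first.
- exact: (emeasurable_funM mf (me d)).
- by move=> y; rewrite mule_ge0// lee_fin expR_ge0.
have a1' : 0 < p.1 + c + d by rewrite -addrA.
rewrite addrA -(@blm_tilt _ _ d)//; last exact: measurable_integral_shift.
apply: eq_integral => x _.
rewrite -IHl// -ge0_integralZr//; last 2 first.
- exact: (emeasurable_funM (mfx x) (me d)).
- by move=> z _; rewrite mule_ge0// lee_fin expR_ge0.
apply: eq_integral => y _.
by rewrite -muleA -EFinM -expRD; congr (_ * (expR _)%:E)%E; ring.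
Qed.

Lemma betal_null c l (f : R -> \bar R) : beta_params c l -> l != [::] ->
  measurable_fun setT f -> (forall y, 0 <= f y)%E -> (forall y, y < 0 -> f y = 0%E) ->
  (\int[betal c l]_y f y = 0)%E.
Proof.
have blm0 a s (g : R -> \bar R) : 0 < a -> 0 < s -> measurable_fun setT g ->
    (forall y, y < 0 -> g y = 0%E) -> (\int[blm a s]_y g y = 0)%E.
  move=> a0 s0 mg g0; rewrite blmE// integral0_eq// => x _; rewrite /bw.
  by case: ifPn => [/andP[x0 x1]|_]; [rewrite g0 ?mul0e// ln_lt0// x0|rewrite mule0].
(* The tail of the list may become empty, and then the law is the Dirac mass at 0, which is not
   carried by y < 0. The statement for induction therefore asks [f] to vanish also at 0 when the
   list is empty. *)
suff H : beta_params c l -> measurable_fun setT f -> (forall y, 0 <= f y)%E ->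
   (forall y, y <= 0 -> l = [::] -> f y = 0%E) -> (forall y, y < 0 -> f y = 0%E) ->
   (\int[betal c l]_y f y = 0)%E.
  by move=> h /eqP l0 mf f0 fN; apply: H => //.
elim: l f => [|p l IHl] f /=.
  by move=> _ mf f0 f1 _; rewrite integral_dirac// f1// mule0.
move=> /andP[/andP[a0 s0] h] mf f0 _ f1.
rewrite integral_convm// blm0//; first exact: measurable_integral_shift.
move=> x x0; apply: IHl => //.
- by apply: (measurableT_comp mf); apply: measurable_funD => //; exact: measurable_cst.
- by move=> y y0 _; apply: f1; rewrite (le_lt_trans _ x0)// gerDl.
- by move=> y y0; apply: f1; rewrite (lt_trans _ x0)// gtrDl.
Qed.

(** Substituting t = e^y turns t^(-p) on t > 1 into e^(-(p - 1) y) on y > 0, an exponential density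
    up to the factor 1 / (p - 1). *)
Lemma integrable_powR_tail p : 1 < p ->
  leb.-integrable setT (EFin \o (fun t : R => expR (- p * ln t) * \1_`]1, +oo[ t)).
Proof.
move=> p1.
pose f (y : R) : \bar R := (expR (- (p - 1) * y) * \1_`]0, +oo[ y)%:E.
have mf : measurable_fun setT f.
  apply/measurable_EFinP/measurable_funM; last exact: measurable_indic.
  apply: (measurableT_comp (@measurable_expR R)).
  by apply: measurable_funM => //; exact: measurable_cst.
have f0 y : (0 <= f y)%E by rewrite lee_fin mulr_ge0 ?expR_ge0.
apply/integrableP; split.
  apply/measurable_EFinP/measurable_funM; last exact: measurable_indic.
  apply: (measurableT_comp (@measurable_expR R)).
  apply: measurable_funM; first exact: measurable_cst.
  exact: measurable_ln.
have -> : (\int[leb]_x `|(EFin \o (fun t : R => expR (- p * ln t) * \1_`]1%R, +oo[ t)%R) x| = \int[leb]_y f y)%E.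
  rewrite [RHS]ge0_integral_ln// [RHS]integral_mkcond; apply: eq_integral => x _ /=.
  rewrite patchE mem_setE/= in_itv/= andbT ger0_norm ?mulr_ge0 ?expR_ge0//.
  rewrite indicE mem_setE in_itv/= andbT.
  have [x0|x0] := ltP 0 x; last by rewrite ltNge (le_trans x0 ler01)/= mulr0.
  rewrite /f indicE mem_setE in_itv/= andbT -(ln1 R) ltr_ln ?posrE//.
  have xE : x^-1 = expR (- ln x) by rewrite expRN lnK.
  rewrite -EFinM mulrAC xE -expRD; congr (expR _ * _)%:E; ring.
have p10 : 0 < p - 1 by rewrite subr_gt0.
have : ((p - 1)%:E * \int[leb]_y f y = 1)%E.
  rewrite -(integral_exp0y p10) -ge0_integralZl//; last by rewrite lee_fin ltW.
  rewrite [RHS]integral_mkcond; apply: eq_integral => x _.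
  rewrite patchE /f indicE; case: ifP => _; first by rewrite mulr1.
  by rewrite mulr0 mule0.
case: (\int[leb]_y f y)%E => [r _|h|h]; first by rewrite ltry.
  by move: h; rewrite gt0_muley// lte_fin.
by rewrite ltNye.
Qed.

Section density.
Variables (c : R) (l : seq (R * R)).
Hypothesis cl : beta_params c l.
Hypothesis l2 : all (fun p => p.2 < 2) l.
Hypothesis l1 : 1 < \sum_(p <- l) p.2.
Let nu := betal c l.
Let mass : R := fine (nu setT).

(** On [-1, 1] the total mass bounds both transforms. Beyond, the decay exponent is the sum of the
    second entries, which [l1] puts above 1, so the bound is integrable. [q] lives on t > 1 and is
    added to its reflection. *)
Lemma betal_dominated : exists D : R -> R,
  [/\ leb.-integrable setT (EFin \o D), forall t, `|cosT nu t| <= D t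
    & forall t, `|sinT nu t| <= D t].
Proof.
have [C C0 HC] := betal_decays cl l2.
have p1 := l1; set p := \sum_(p <- l) p.2 in p1 HC.
pose q t : R := expR (- p * ln t) * \1_`]1, +oo[ t.
have iq := integrable_powR_tail p1.
have iqN : leb.-integrable setT (EFin \o (fun t => q (- t))).
  have /integrableP[mq fq] := iq; apply/integrableP; split.
    by apply: (measurableT_comp mq); exact: oppr_measurable.
  rewrite (ge0_integral_opp (f := fun x => `|(EFin \o q) x|%E))//.
  exact: measurableT_comp.
have i1 : leb.-integrable setT (EFin \o (\1_`[(-1)%R, 1%R] : R -> R)).
  apply/integrableP; split; first exact/measurable_EFinP/measurable_indic.
  under eq_integral do rewrite /= ger0_norm//.
  rewrite integral_indic// setIT.
  have : (leb `[(-1)%R, 1%R]%classic < +oo)%E.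
    by rewrite lebesgue_measure_itv/=; case: ifP => _; rewrite ?ltry// -EFinB ltry.
  by [].
have mass0 : 0 <= mass by exact: fine_ge0.
exists (fun t => mass * \1_`[(-1)%R, 1%R] t + (C * q t + C * q (- t))).
have q0 t : 0 <= q t by rewrite mulr_ge0 ?expR_ge0.
have cmass t : `|cosT nu t| <= mass.
  apply: (le_trans (le_normr_Rintegral _ _)) => //; first exact: integrable_cos0.
  rewrite -[leRHS]mul1r -Rintegral_cst//; apply: le_Rintegral => //.
  - exact: integrable_norm (integrable_cos0 _ _).
  - exact: finite_measure_integrable_cst.
  - by move=> y _; exact: cos_max.
have smass t : `|sinT nu t| <= mass.
  apply: (le_trans (le_normr_Rintegral _ _)) => //; first exact: integrable_sin0.
  rewrite -[leRHS]mul1r -Rintegral_cst//; apply: le_Rintegral => //.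
  - exact: integrable_norm (integrable_sin0 _ _).
  - exact: finite_measure_integrable_cst.
  - by move=> y _; exact: sin_max.
have key t x : x <= mass -> (1 <= `|t| -> x <= C * expR (- p * ln `|t|)) ->
    x <= mass * \1_`[(-1)%R, 1%R] t + (C * q t + C * q (- t)).
  move=> xm xC; rewrite indicE mem_setE in_itv/= -ler_norml.
  have [t1|t1] := leP `|t| 1.
    by rewrite mulr1 (le_trans xm)// lerDl addr_ge0// mulr_ge0.
  rewrite mulr0 add0r (le_trans (xC (ltW t1)))// -mulrDr ler_wpM2l//.
  rewrite /q !indicE !mem_setE !in_itv/= !andbT.
  move: t1; case: (ger0P t) => t0 t1; rewrite t1 mulr1.
    by rewrite lerDl mulr_ge0 ?expR_ge0.
  by rewrite lerDr mulr_ge0 ?expR_ge0.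
split.
- have i2 := integrableD measurableT (integrableZl measurableT C iq) (integrableZl measurableT C iqN).
  exact: (integrableD measurableT (integrableZl measurableT mass i1) i2).
- by move=> t; apply: key => // t1; have [] := HC _ t1.
- by move=> t; apply: key => // t1; have [] := HC _ t1.
Qed.

Lemma betal_density (A : set R) : measurable A ->
  nu A = (\int[leb]_(y in A) (invF nu y)%:E)%E.
Proof.
by move=> mA; have [D [iD cD sD]] := betal_dominated; exact: fourier_inversion iD cD sD A mA.
Qed.

Lemma betal_density_ge0 y : 0 <= invF nu y.
Proof. by have [D [iD cD sD]] := betal_dominated; exact: invF_ge0 iD cD sD y. Qed.

Lemma measurable_betal_density : measurable_fun setT (invF nu).
Proof. by have [D [iD cD sD]] := betal_dominated; exact: measurable_invF iD cD sD. Qed.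

Lemma integrable_betal_phase y : leb.-integrable setT (EFin \o phase nu y).
Proof. by have [D [iD cD sD]] := betal_dominated; exact: integrable_phase iD cD sD y. Qed.

End density.

End beta_products.

(** * The G-function as a beta-product density *)

Arguments Gamma : simpl never.

Section meijer.
Context {R : realType}.
Local Notation TR := (measurableTypeR R).
Local Notation leb := (@lebesgue_measure R).
Implicit Types (a s t u x y c : R) (l : seq (R * R)).

Definition G a : R := fine (Gr a).

Lemma G_gt0 a : 0 < a -> 0 < G a.
Proof. by move=> a0; rewrite fine_gt0// Gr_gt0//= ltey_eq Gr_fin. Qed.

Lemma GD1 a : 0 < a -> G (a + 1) = a * G a.
Proof. by move=> a0; rewrite /G GrS// fineM// Gr_fin. Qed.

Opaque G.

Lemma GDn a n : 0 < a -> G (a + n%:R) = poch a n * G a.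
Proof.
move=> a0; elim: n => [|n IHn]; first by rewrite addr0 /poch big_ord0 mul1r.
rewrite -addn1 natrD addrA GD1 ?IHn; last by rewrite ltr_wpDr.
by rewrite /poch addn1 big_ord_recr/=; ring.
Qed.

Local Open Scope complex_scope.

Lemma prod_real (I : Type) (s : seq I) (f : I -> R) :
  \prod_(i <- s) (f i)%:C = (\prod_(i <- s) f i)%:C.
Proof. by rewrite rmorph_prod. Qed.

Lemma prod_GammaG (I : eqType) (s : seq I) (f : I -> R) : all (fun i => 0 < f i) s ->
  \prod_(i <- s) Gamma (f i)%:C = (\prod_(i <- s) G (f i))%:C.
Proof.
move=> /allP h; rewrite -prod_real big_seq [RHS]big_seq.
by apply: eq_bigr => i /h fi; rewrite Gamma_real.
Qed.

Lemma betal_massE c l : beta_params c l ->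
  fine (betal c l setT) * \prod_(p <- l) G (p.1 + c + p.2) =
  \prod_(p <- l) G p.2 * \prod_(p <- l) G (p.1 + c).
Proof.
move=> cl; have := betal_mass cl.
have h2 : all (fun p : R * R => 0 < p.2) l by apply: sub_all cl => p /andP[].
have h1 : all (fun p : R * R => 0 < p.1 + c) l by apply: sub_all cl => p /andP[].
have h3 : all (fun p : R * R => 0 < p.1 + c + p.2) l.
  by apply: sub_all cl => p /andP[? ?]; rewrite addr_gt0.
have e1 : \prod_(p <- l) Gamma (p.1 + c)%:C = (\prod_(p <- l) G (p.1 + c))%:C.
  exact: prod_GammaG h1.
have e2 : \prod_(p <- l) Gamma (p.2)%:C = (\prod_(p <- l) G p.2)%:C.
  exact: prod_GammaG h2.
have e3 : \prod_(p <- l) Gamma (p.1 + c + p.2)%:C = (\prod_(p <- l) G (p.1 + c + p.2))%:C.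
  exact: prod_GammaG h3.
rewrite [X in _ = X -> _]big_split/= e1 e2 e3 -!rmorphM/=.
by move=> /(congr1 (@complex.Re R))/=.
Qed.

Lemma measurable_phase_im (nu : {finite_measure set TR -> \bar R}) y :
  measurable_fun setT (fun t => sinT nu t * cos (t * y) - cosT nu t * sin (t * y)).
Proof.
apply: measurable_funB; apply: measurable_funM.
- exact: measurable_sinT.
- apply: (measurableT_comp (continuous_measurable_fun (@continuous_cos R))).
  by apply: measurable_funM => //; exact: measurable_cst.
- exact: measurable_cosT.
- apply: (measurableT_comp (continuous_measurable_fun (@continuous_sin R))).
  by apply: measurable_funM => //; exact: measurable_cst.
Qed.

Lemma cosTN (nu : {finite_measure set TR -> \bar R}) t : cosT nu (- t) = cosT nu t.
Proof. by apply: eq_Rintegral => y _; rewrite mulNr cosN. Qed.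

Lemma sinTN (nu : {finite_measure set TR -> \bar R}) t : sinT nu (- t) = - sinT nu t.
Proof.
rewrite /sinT -[RHS]mulN1r -RintegralZl//; last exact: integrable_sin0.
by apply: eq_Rintegral => y _; rewrite [- t * y]mulNr sinN mulN1r.
Qed.

(** By [charf_betal] the Gamma quotient on the line is the characteristic function of [betal c l]
    divided by the product of the Gamma(b - a). After multiplication by x^(-u) and by du = i dt, the
    real part is odd in t and integrates to 0, while the imaginary part is [phase] up to a constant,
    whose integral is 2 pi [invF]. *)
Lemma meijerG_beta l c x : 0 < x -> beta_params c l ->
  all (fun p => p.2 < 2) l -> 1 < \sum_(p <- l) p.2 ->
  meijerG [seq (p.1 + p.2)%:C | p <- l] [seq (p.1)%:C | p <- l] c x =
  (expR (- c * ln x) / \prod_(p <- l) G p.2 * invF (betal c l) (ln x))%:C.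
Proof.
move=> x0 cl l2 l1; set nu := betal c l; set y := ln x.
set S := \prod_(p <- l) G p.2.
have h2 : all (fun p : R * R => 0 < p.2) l by apply: sub_all cl => p /andP[].
have S0 : S != 0.
  rewrite prodf_seq_neq0; apply/allP => p pl; rewrite gt_eqF// G_gt0//.
  by move/allP : cl => /(_ _ pl) /andP[].
set w := expR (- c * y) / S.
have integrandE t : (\prod_(a <- [seq (p.1)%:C | p <- l]) Gamma (a + (c +i* t))) /
    (\prod_(b <- [seq (p.1 + p.2)%:C | p <- l]) Gamma (b + (c +i* t)))
    * cpow x (- (c +i* t)) * 'i =
    (- (w * (sinT nu t * cos (t * y) - cosT nu t * sin (t * y)))) +i* (w * phase nu y t).
  rewrite !big_map.
  have e2 : \prod_(p <- l) Gamma (p.2)%:C = S%:C by exact: prod_GammaG h2.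
  have := charf_betal t cl; rewrite [X in _ = X -> _]big_split/= -/nu e2.
  have -> : \prod_(p <- l) Gamma ((p.1)%:C + (c +i* t)) = \prod_(p <- l) Gamma ((p.1 + c) +i* t).
    by apply: eq_bigr => p _; congr Gamma; congr Complex => /=; rewrite ?add0r.
  have -> : \prod_(p <- l) Gamma ((p.1 + p.2)%:C + (c +i* t)) = \prod_(p <- l) Gamma ((p.1 + c + p.2) +i* t).
    by apply: eq_bigr => p _; congr Gamma; congr Complex => /=; rewrite ?add0r// addrAC.
  have n0 : \prod_(p <- l) Gamma ((p.1 + c + p.2) +i* t) != 0.
    rewrite prodf_seq_neq0; apply/allP => p pl; apply: Gamma_neq0.
    by move/allP : cl => /(_ _ pl) /andP[? ?]; rewrite addr_gt0.
  move: (\prod_(p <- l) Gamma _) (\prod_(p <- l) Gamma _) n0 => A B B0 h.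
  have -> : A / B = (S^-1)%:C * charf nu t.
    by apply: (mulIf B0); rewrite divfK// -mulrA h mulrA -rmorphM mulVf// mul1r.
  rewrite /cpow -/y /charf /w /phase.
  have -> : cos (complex.Im (- (c +i* t)) * y) = cos (t * y) by rewrite /= mulNr cosN.
  have -> : sin (complex.Im (- (c +i* t)) * y) = - sin (t * y) by rewrite /= mulNr sinN.
  apply/eqP; rewrite eq_complex/=; apply/andP; split; apply/eqP; ring.
rewrite /meijerG /cintegral.
under eq_Rintegral do rewrite integrandE/=.
under [X in _ +i* X]eq_Rintegral do rewrite integrandE/=.
rewrite (Rintegral_odd (f := fun t => - (w * (sinT nu t * cos (t * y) - cosT nu t * sin (t * y))))); last 2 first.
- apply: (measurableT_comp (@oppr_measurable R setT)).
  by apply: measurable_funM; [exact: measurable_cst|exact: measurable_phase_im].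
- by move=> t; rewrite cosTN sinTN [- t * y]mulNr cosN sinN; ring.
rewrite RintegralZl//; last exact: integrable_betal_phase.
have p0 : pi != 0 :> R by rewrite gt_eqF// pi_gt0.
have -> : \int[leb]_t phase nu y t = 2 * pi * invF nu y.
  by rewrite /invF mulVKf// mulf_neq0.
set F := invF nu y.
have -> : (0 +i* (w * (2 * pi * F))) = ((2 * pi)%:C * 'i) * (w * F)%:C :> R[i].
  apply/eqP; rewrite eq_complex/=; apply/andP; split; apply/eqP; ring.
rewrite mulKf// mulf_neq0//.
  by rewrite eq_complex/= negb_and mulf_neq0.
by rewrite eq_complex/= negb_and oner_neq0 orbT.
Qed.

End meijer.

(** * The normalised measure on (0, 1) carrying the beta-product density *)

Section beta_measure.
Context {R : realType}.
Local Notation TR := (measurableTypeR R).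
Local Notation leb := (@lebesgue_measure R).

Lemma exp_pushforward (nu : {finite_measure set TR -> \bar R}) (k0 : R) : 0 <= k0 ->
  exists m : {measure set TR -> \bar R},
    (forall A, measurable A -> m A = k0%:E * nu (expR @^-1` A))%E /\
    (forall f : R -> \bar R, measurable_fun setT f -> (forall x, 0 <= f x)%E ->
      (\int[m]_x f x = k0%:E * \int[nu]_y f (expR y))%E).
Proof.
move=> k00.
pose m h : {measure set TR -> \bar R} := mscale (NngNum k00)
  (@measure_function_pushforward__canonical__measure_function_Measure _ _ _ _ _ nu (expR : TR -> TR) h).
have mexp : measurable_fun setT (expR : TR -> TR) by exact: measurable_expR.
exists (m mexp); split => [A mA //|f mf f0].
rewrite ge0_integral_mscale//=; congr (_ * _)%E.
by rewrite ge0_integral_pushforward.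
Qed.

Variable l : seq (R * R).
Hypothesis l0 : l != [::].
Hypothesis cl : beta_params 1 l.
Hypothesis l2 : all (fun p => p.2 < 2) l.
Hypothesis l1 : 1 < \sum_(p <- l) p.2.

Definition beta_kappa : R :=
  (\prod_(p <- l) G (p.1 + 1 + p.2)) / \prod_(p <- l) G (p.1 + 1).

Let S : R := \prod_(p <- l) G p.2.
(** Beyond [beta_kappa], division by [S] compensates the unnormalised beta weights, each of which
    brings a factor Gamma(b - a). *)
Let k0 : R := beta_kappa / S.

Let pos (f : R * R -> R) : all (fun p => 0 < f p) l -> 0 < \prod_(p <- l) G (f p).
Proof.
by move=> /allP h; rewrite big_seq; apply: prodr_gt0 => p pl; rewrite G_gt0// h.
Qed.

Let h2 : all (fun p : R * R => 0 < p.2) l.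
Proof. by apply: sub_all cl => p /andP[]. Qed.
Let S0 : 0 < S. Proof. exact: pos h2. Qed.

Let kappa0 : 0 < beta_kappa.
Proof.
have h1 : all (fun p : R * R => 0 < p.1 + 1) l by apply: sub_all cl => p /andP[].
have h3 : all (fun p : R * R => 0 < p.1 + 1 + p.2) l.
  by apply: sub_all cl => p /andP[? ?]; rewrite addr_gt0.
by rewrite /beta_kappa divr_gt0//; [exact: pos h3|exact: pos h1].
Qed.

Let k00 : 0 < k0. Proof. by rewrite divr_gt0. Qed.

Let cln n : beta_params (1 + n%:R) l.
Proof.
apply: sub_all cl => p /andP[p1 ->]; rewrite andbT addrA.
by rewrite ltr_wpDr.
Qed.

Let moment n : k0 * fine (betal (1 + n%:R) l setT) =
  \prod_(p <- l) (poch (p.1 + 1) n / poch (p.1 + 1 + p.2) n).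
Proof.
have := betal_massE (cln n).
have h1 : all (fun p : R * R => 0 < p.1 + 1) l by apply: sub_all cl => p /andP[].
have h3 : all (fun p : R * R => 0 < p.1 + 1 + p.2) l.
  by apply: sub_all cl => p /andP[? ?]; rewrite addr_gt0.
have e1 : \prod_(p <- l) G (p.1 + (1 + n%:R)) = \prod_(p <- l) poch (p.1 + 1) n * \prod_(p <- l) G (p.1 + 1).
  rewrite -big_split/= big_seq [RHS]big_seq; apply: eq_bigr => p pl.
  by rewrite addrA GDn//; move/allP : h1 => /(_ _ pl).
have e3 : \prod_(p <- l) G (p.1 + (1 + n%:R) + p.2) = \prod_(p <- l) poch (p.1 + 1 + p.2) n * \prod_(p <- l) G (p.1 + 1 + p.2).
  rewrite -big_split/= big_seq [RHS]big_seq; apply: eq_bigr => p pl.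
  rewrite (_ : p.1 + (1 + n%:R) + p.2 = p.1 + 1 + p.2 + n%:R); last by ring.
  by rewrite GDn//; move/allP : h3 => /(_ _ pl).
have p0 : \prod_(p <- l) poch (p.1 + 1 + p.2) n != 0.
  rewrite prodf_seq_neq0; apply/allP => p pl; rewrite /poch; apply/prodf_neq0 => i _.
  by rewrite gt_eqF// ltr_wpDr//; move/allP : h3 => /(_ _ pl).
have q1 : \prod_(p <- l) G (p.1 + 1) != 0 by rewrite gt_eqF// (pos h1).
have q3 : \prod_(p <- l) G (p.1 + 1 + p.2) != 0 by rewrite gt_eqF// (pos h3).
have q2 : S != 0 by rewrite gt_eqF.
rewrite e1 e3 -/S prodf_div /k0 /beta_kappa => h.
move: (fine _) (\prod_(p <- l) poch (p.1 + 1) n) (\prod_(p <- l) poch (p.1 + 1 + p.2) n)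
  (\prod_(p <- l) G (p.1 + 1)) (\prod_(p <- l) G (p.1 + 1 + p.2)) S p0 q1 q3 q2 h.
move=> X A B C D E B0 C0 D0 E0 h.
apply: (mulIf B0); rewrite divfK//.
apply: (mulIf C0); apply: (mulIf E0).
transitivity (X * (B * D)); first by field; rewrite C0 E0.
by rewrite h; ring.
Qed.

Let nu := betal 1 l.

Let me_exp k : measurable_fun setT (fun y : R => (expR (k * y))%:E).
Proof.
apply/measurable_EFinP/(measurableT_comp (@measurable_expR R)).
by apply: measurable_funM => //; exact: measurable_cst.
Qed.

(** The measure is [k0] times the image of [betal 1 l] under the exponential: the Mellin transform
    of the density at u = 1 is the total mass, so the n-th moment is a multiple of the mass of
    [betal (1 + n%:R) l]. The density formula on an arbitrary line comes from tilting. *)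
Theorem beta_measure : exists m : {measure set TR -> \bar R},
  [/\ (forall c, beta_params c l -> has_density m `]0, 1[
        (fun x => beta_kappa%:C%C * meijerG [seq (p.1 + p.2)%:C%C | p <- l]
                                            [seq (p.1)%:C%C | p <- l] c x)),
      m setT = 1%E, m (~` `]0, 1[) = 0%E &
      forall n, (\int[m]_(x in `]0%R, 1%R[) (x ^+ n)%:E)%E =
        (\prod_(p <- l) (poch (p.1 + 1) n / poch (p.1 + 1 + p.2) n))%:E].
Proof.
have [m [mE mI]] := exp_pushforward nu (ltW k00).
have null : m (~` `]0, 1[) = 0%E.
  rewrite mE; last exact: measurableC.
  have mS : measurable (expR @^-1` (~` `]0, 1[%classic) : set TR).
    by rewrite -[X in measurable X]setTI; apply: measurable_expR => //; exact: measurableC.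
  have H : (\int[nu]_y (\1_(expR @^-1` (~` `]0, 1[%classic) : set TR) y)%:E = 0)%E.
    apply: betal_null => //.
    - exact/measurable_EFinP/measurable_indic.
    - move=> y y0; rewrite indicE memNset//=; apply; rewrite in_itv/= expR_gt0/=.
      by rewrite -expR0 ltr_expR.
  by move: H; rewrite integral_indic// setIT => H; rewrite [X in (_ * X)%E](_ : _ = 0%E) ?mule0.
exists m; split => //.
- move=> c cc; have w0 y := betal_density_ge0 cc l2 l1 y.
  have mw := measurable_betal_density cc l2 l1.
  have GE x : 0 < x -> beta_kappa%:C%C * meijerG [seq (p.1 + p.2)%:C%C | p <- l]
      [seq (p.1)%:C%C | p <- l] c x = (k0 * expR (- c * ln x) * invF (betal c l) (ln x))%:C%C.
    move=> x0; rewrite meijerG_beta// -rmorphM -/S /k0; congr (_%:C%C); ring.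
  split=> [x/=|A mA].
    rewrite in_itv/= => /andP[x0 _]; rewrite GE// lecR.
    by apply: mulr_ge0; [apply: mulr_ge0; [exact: ltW|exact: expR_ge0]|exact: w0].
  have mAD : measurable (A `&` `]0, 1[ : set TR) by exact: measurableI.
  have -> : m A = m (A `&` `]0, 1[).
    have nAD : m (A `\` `]0, 1[) = 0%E.
      apply: (@subset_measure0 _ TR R m (A `\` `]0, 1[) (~` `]0, 1[)) => //.
      - exact: measurableD.
      - exact: measurableC.
    by rewrite (measureDI m mA (measurable_itv `]0, 1[)) [X in (X + _)%E]nAD add0e.
  pose f x := complex.Re (beta_kappa%:C%C * meijerG [seq (p.1 + p.2)%:C%C | p <- l]
      [seq (p.1)%:C%C | p <- l] c x).
  have fE x : 0 < x -> f x = k0 * expR (- c * ln x) * invF (betal c l) (ln x).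
    by move=> x0; rewrite /f GE.
  rewrite -[RHS]/(\int[leb]_(x in A `&` `]0%R, 1%R[) (f x)%:E)%E.
  rewrite mE//.
  have mB : measurable (expR @^-1` (A `&` `]0, 1[) : set TR).
    by rewrite -[X in measurable X]setTI; apply: measurable_expR.
  set B := (expR @^-1` (A `&` `]0, 1[) : set TR) in mB *.
  have -> : (nu B = \int[nu]_y (\1_B y)%:E)%E by rewrite integral_indic// setIT.
  rewrite /nu.
  have e1 : c + (1 - c) = 1 by rewrite addrC subrK.
  have mI1 : measurable_fun setT (fun y : R => (\1_B y)%:E : \bar R).
    by apply/measurable_EFinP; exact: measurable_indic.
  have := @betal_tilt _ c (1 - c) l (fun y => (\1_B y)%:E) cc; rewrite e1 => <- //.
  rewrite (@ge0_integral_density _ TR R leb (invF (betal c l)) (betal c l) mw w0); first last.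
  + by move=> y; rewrite mule_ge0// lee_fin expR_ge0.
  + exact: emeasurable_funM mI1 (me_exp _).
  + by move=> C mC; exact: betal_density.
  rewrite ge0_integral_ln; first last.
  + by move=> y; rewrite !mule_ge0// lee_fin ?expR_ge0.
  + apply: emeasurable_funM; first exact: emeasurable_funM mI1 (me_exp _).
    exact/measurable_EFinP.
  rewrite -ge0_integralZl//; first last.
  + by rewrite lee_fin ltW.
  + by move=> x x0; rewrite !mule_ge0// lee_fin ?expR_ge0// invr_ge0; move: x0; rewrite /= in_itv/= andbT => /ltW.
  + apply: emeasurable_funM; last first.
      apply/measurable_EFinP; apply: open_continuous_measurable_fun => // x.
      rewrite inE/= in_itv/= andbT => x0.
      by apply: inv_continuous; rewrite gt_eqF.
    apply: measurable_funTS; apply: emeasurable_funM.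
      apply: emeasurable_funM; first exact: (measurableT_comp mI1 (@measurable_ln R)).
      exact: (measurableT_comp (me_exp (1 - c)) (@measurable_ln R)).
    by apply/measurable_EFinP; exact: (measurableT_comp mw (@measurable_ln R)).
  rewrite [LHS]integral_mkcond [RHS]integral_mkcond; apply: eq_integral => x _.
  rewrite !patchE mem_setE/= in_itv/= andbT.
  case: ifPn => x0; last first.
    rewrite memNset//= => -[_]; rewrite in_itv/= => /andP[h _].
    by rewrite h in x0.
  rewrite indicE.
  have -> : (ln x \in B) = (x \in A `&` `]0, 1[).
    by apply/idP/idP; rewrite !inE /B/= lnK.
  case: ifPn => xA; last by rewrite !mul0e mule0.
  rewrite fE//= mul1e -!EFinM; congr EFin.
  have xE : x^-1 = expR (- ln x) by rewrite expRN lnK.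
  rewrite xE (_ : (1 - c) * ln x = - c * ln x + ln x); last by ring.
  rewrite expRD lnK// -xE; field.
  by rewrite gt_eqF.
- rewrite mE// preimage_setT.
  have := moment 0; rewrite addr0 big1 => [h|p _].
    have fN : nu setT = (fine (nu setT))%:E by rewrite fineK// fin_num_measure.
    by rewrite [X in (_ * X)%E]fN -EFinM h.
  by rewrite /poch !big_ord0 divr1.
- move=> n.
  have mx : measurable_fun setT (fun x : R => (x ^+ n * \1_`]0, 1[ x)%:E : \bar R).
    apply/measurable_EFinP/measurable_funM; last exact: measurable_indic.
    exact: measurable_funX.
  have -> : (\int[m]_(x in `]0%R, 1%R[) (x ^+ n)%:E = \int[m]_x (x ^+ n * \1_`]0%R, 1%R[ x)%:E)%E.
    rewrite integral_mkcond; apply: eq_integral => x _; rewrite patchE indicE.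
    by case: ifP => _; rewrite ?mulr1 ?mulr0.
  rewrite mI//; last first.
    move=> x; rewrite lee_fin indicE mem_setE in_itv/=.
    have [/andP[x0 _]|_] := boolP (0 < x < 1).
      by rewrite mulr1 exprn_ge0// ltW.
    by rewrite mulr0.
  rewrite -moment [RHS]EFinM fineK ?fin_num_measure//; congr (_ * _)%E.
  have -> : (betal (1 + n%:R) l setT = \int[nu]_y (expR (n%:R * y))%:E)%E.
    rewrite -[LHS]mul1e -integral_cst// /nu.
    rewrite -(@betal_tilt _ 1 n%:R l (cst 1%E))//.
    by apply: eq_integral => y _; rewrite /= mul1e.
  (* The part of the law on y >= 0, that is on x >= 1, is split off; [betal_null] shows that it is
     zero. *)
  have D : (\int[nu]_y (expR (n%:R * y))%:E = \int[nu]_y (expR y ^+ n * \1_`]0%R, 1%R[ (expR y))%:E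
     + \int[nu]_y (expR (n%:R * y) * \1_`[0%R, +oo[ y)%:E)%E.
    rewrite -ge0_integralD//.
    + apply: eq_integral => y _; rewrite -EFinD; congr EFin.
      rewrite !indicE !mem_setE !in_itv/= expR_gt0/= andbT -expRM_natl.
      have -> : (expR y < 1) = (y < 0) by rewrite -expR0 ltr_expR.
      by case: ltP => y0; rewrite ?mulr1 ?mulr0 ?addr0 ?add0r.
    + exact: (measurableT_comp mx (@measurable_expR R)).
    + apply/measurable_EFinP/measurable_funM; last exact: measurable_indic.
      by have /measurable_EFinP := me_exp n%:R.
  rewrite D [X in (_ = _ + X)%E]betal_null ?adde0//.
  - apply/measurable_EFinP/measurable_funM; last exact: measurable_indic.
    by have /measurable_EFinP := me_exp n%:R.
  - by move=> y y0; rewrite indicE mem_setE in_itv/= andbT leNgt y0/= mulr0.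
Qed.

End beta_measure.

(** * Binomial identities and finite differences *)

Section combinatorics.
Variable R : realFieldType.
Implicit Types (n m k r s : nat) (L : seq (R * R)).

(** Coefficient of t^N in (1 - t)^q (1 - t)^(-K-q) = (1 - t)^(-K), by induction on q with Pascal's
    rule. Truncated subtraction gives the right value at K = 0: 1 for N = 0 and 0 otherwise. *)
Lemma sum_signed_bin_mulbin q K N :
  \sum_(k < N.+1) (-1) ^+ k * 'C(q, k)%:R * 'C(N - k + (K + q) - 1, N - k)%:R
  = 'C(N + K - 1, N)%:R :> R.
Proof.
elim: q K N => [|q IH] K N.
  rewrite big_ord_recl/= big1 => [|i _]; last by rewrite bin0n/= mulr0 mul0r.
  by rewrite !mul1r addr0 addn0 subn0.
case: N => [|N]; first by rewrite big_ord_recl big_ord0 addr0 subnn !bin0 !mul1r.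
transitivity ('C(N.+1 + K.+1 - 1, N.+1)%:R - 'C(N + K.+1 - 1, N)%:R : R); last first.
  rewrite (_ : (N.+1 + K.+1 - 1 = (N + K).+1)%N); last by lia.
  rewrite (_ : (N + K.+1 - 1 = N + K)%N); last by lia.
  rewrite (_ : (N.+1 + K - 1 = N + K)%N); last by lia.
  by rewrite binS natrD addrK.
rewrite -!IH -sumrN big_ord_recl [X in _ = X + _]big_ord_recl -addrA -big_split.
congr (_ + _); first by rewrite !bin0 addSnnS.
apply: eq_bigr => i _ /=.
by rewrite /bump/= !add1n binS natrD subSS exprS addSnnS; ring.
Qed.

(** Pairs are (slope, intercept). A polynomial kept as a list of linear factors has its degree
    bounded by the length of the list, on which the inductions run. *)
Definition linear_factors L (x : R) : R := \prod_(p <- L) (p.1 * x + p.2).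

Lemma linear_factors_shift L x :
  linear_factors L (x + 1) = linear_factors [seq (p.1, p.1 + p.2) | p <- L] x.
Proof.
by rewrite /linear_factors big_map; apply: eq_bigr => p _ /=; ring.
Qed.

(** Peel off a factor a m + b. The b-part has fewer factors. In the a-part, m 'C(n+1, m) = (n+1)
    'C(n, m-1) absorbs m and shifts the remaining arguments by 1, which again gives a product of
    linear factors, now with n in place of n + 1. *)
Lemma finite_difference_eq0 n L : (size L < n)%N ->
  \sum_(m < n.+1) (-1) ^+ m * 'C(n, m)%:R * linear_factors L m%:R = 0.
Proof.
move: {2}(size L) (erefl (size L)) => d.
elim: d n L => [|d IH] n L.
  move=> /size0nil -> n0.
  under eq_bigr do rewrite /linear_factors big_nil mulr1.
  have := exprDn (1 : R) (-1) n; rewrite subrr expr0n gtn_eqF//= => h; rewrite [RHS]h.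
  by apply: eq_bigr => i _; rewrite expr1n mul1r mulr_natr.
case: L => // [[a b] L]/= [sL] sn.
case: n sn => // n; rewrite ltnS => sn.
have -> : \sum_(m < n.+2) (-1) ^+ m * 'C(n.+1, m)%:R * linear_factors ((a, b) :: L) m%:R =
  a * \sum_(m < n.+2) (-1) ^+ m * (m%:R * 'C(n.+1, m)%:R) * linear_factors L m%:R +
  b * \sum_(m < n.+2) (-1) ^+ m * 'C(n.+1, m)%:R * linear_factors L m%:R.
  rewrite !mulr_sumr -big_split/=; apply: eq_bigr => i _.
  by rewrite /linear_factors big_cons/=; ring.
rewrite (IH n.+1)//; last by rewrite ltnS ltnW.
rewrite mulr0 addr0 big_ord_recl/= mul0r mulr0 mul0r add0r.
have -> : \sum_(i < n.+1) (-1) ^+ bump 0 i * ((bump 0 i)%:R * 'C(n.+1, bump 0 i)%:R) *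
    linear_factors L (bump 0 i)%:R =
  - n.+1%:R * \sum_(i < n.+1) (-1) ^+ i * 'C(n, i)%:R *
     linear_factors [seq (p.1, p.1 + p.2) | p <- L] i%:R.
  rewrite mulr_sumr; apply: eq_bigr => i _.
  rewrite -linear_factors_shift natr1 /bump/= !add1n -natrM -mul_bin_diag natrM exprS.
  by ring.
by rewrite IH ?size_map ?mulr0.
Qed.

(** Partial fractions give the closed form n! r^n / prod_(i <= n) (r i + g). By Pascal's rule the
    sum for n + 1 is the difference of the sums for n at g and at r + g. *)
Lemma sum_signed_bin_inv n (r g : R) : 0 < r -> 0 < g ->
  0 < \sum_(m < n.+1) (-1) ^+ m * 'C(n, m)%:R / (r * m%:R + g).
Proof.
move=> r0 g0.
suff -> : \sum_(m < n.+1) (-1) ^+ m * 'C(n, m)%:R / (r * m%:R + g) =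
    n`!%:R * r ^+ n / \prod_(i < n.+1) (r * i%:R + g).
  rewrite divr_gt0 ?mulr_gt0 ?exprn_gt0 ?ltr0n ?fact_gt0//.
  by apply: prodr_gt0 => i _; rewrite ltr_wpDl// mulr_ge0// ltW.
elim: n g g0 => [|n IH] g g0.
  by rewrite !big_ord_recl !big_ord0 /= bin0 fact0 !expr0 mulr0 add0r addr0 !mul1r mulr1.
have -> : \sum_(m < n.+2) (-1) ^+ m * 'C(n.+1, m)%:R / (r * m%:R + g) =
  \sum_(m < n.+1) (-1) ^+ m * 'C(n, m)%:R / (r * m%:R + g) -
  \sum_(m < n.+1) (-1) ^+ m * 'C(n, m)%:R / (r * m%:R + (r + g)).
  rewrite big_ord_recl/=.
  under eq_bigr => i _ do rewrite /bump/= add1n binS natrD mulrDr mulrDl.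
  rewrite big_split/= addrA; congr (_ + _).
    rewrite [LHS](_ : _ = \sum_(m < n.+2) (-1) ^+ m * 'C(n, m)%:R / (r * m%:R + g)).
      by rewrite big_ord_recr/= bin_small// mulr0 mul0r addr0.
    by rewrite [RHS]big_ord_recl/= !bin0.
  rewrite -sumrN; apply: eq_bigr => i _.
  by rewrite exprS -natr1 mulrDr mulr1 addrA; ring.
rewrite !IH ?addr_gt0//.
have p1 : \prod_(i < n.+1) (r * i%:R + g) = g * \prod_(i < n) (r * i%:R + (r + g)).
  rewrite big_ord_recl/= mulr0 add0r; congr (_ * _); apply: eq_bigr => i _.
  by rewrite /bump/= -natr1; ring.
have p2 : \prod_(i < n.+1) (r * i%:R + (r + g)) =
    \prod_(i < n) (r * i%:R + (r + g)) * (r * n%:R + (r + g)) by rewrite big_ord_recr.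
have p3 : \prod_(i < n.+2) (r * i%:R + g) =
    g * \prod_(i < n) (r * i%:R + (r + g)) * (r * n%:R + (r + g)).
  by rewrite big_ord_recr/= p1 -natr1; ring.
rewrite p3 p2 p1.
have p0 : \prod_(i < n) (r * i%:R + (r + g)) != 0.
  by apply/prodf_neq0 => i _; rewrite gt_eqF// ltr_wpDl ?addr_gt0// mulr_ge0// ltW.
have q0 : r * n%:R + (r + g) != 0 by rewrite gt_eqF// ltr_wpDl ?addr_gt0// mulr_ge0// ltW.
rewrite factS natrM exprS -natr1.
move: (\prod_(i < n) _) p0 => p p0.
by field; rewrite p0 q0 gt_eqF.
Qed.

(** Write a m + b = (a / r) (r m + g) + (b - a g / r). The first term cancels the denominator and
    leaves fewer than n linear factors, which [finite_difference_eq0] kills; so each factor is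
    replaced by its value at the root -g / r. *)
Lemma finite_difference_div n L (r g : R) : r != 0 ->
  (forall m, r * m%:R + g != 0) -> (size L <= n)%N ->
  \sum_(m < n.+1) (-1) ^+ m * 'C(n, m)%:R * linear_factors L m%:R / (r * m%:R + g)
  = \prod_(p <- L) (p.2 - p.1 * g / r) *
    \sum_(m < n.+1) (-1) ^+ m * 'C(n, m)%:R / (r * m%:R + g).
Proof.
move=> r0 rg; elim: L => [_|[a b] L IH sL].
  rewrite big_nil mul1r; apply: eq_bigr => i _.
  by rewrite /linear_factors big_nil mulr1.
rewrite big_cons/= -mulrA -IH; last exact: ltnW.
rewrite -[RHS]add0r -[X in _ = X + _](mulr0 (a / r)).
rewrite -[X in _ = _ * X + _](finite_difference_eq0 sL).
rewrite !mulr_sumr -big_split/=; apply: eq_bigr => i _.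
rewrite /linear_factors big_cons/=; field.
by rewrite r0 rg.
Qed.

End combinatorics.

(** * The polynomials and their recurrence *)

Section hypergeometric.
Variable R : realType.
Implicit Types (n m k r s N d : nat).

Lemma factD_prod N d : ((N + d)`! = N`! * \prod_(i <- iota 1 d) (N + i))%N.
Proof.
elim: d => [|d IH]; first by rewrite addn0 big_nil muln1.
by rewrite -[d.+1]addn1 iotaD big_cat big_seq1/= mulnA -IH addnA addn1 factS
  mulnC [(1 + d)%N]addnC addn1 addnS.
Qed.

Lemma pochS (z : R) n : poch z n.+1 = poch z n * (z + n%:R).
Proof. by rewrite /poch big_ord_recr. Qed.

(** Gauss multiplication for factorials: raising m by one brings r consecutive new factors, one for
    each Pochhammer symbol. *)
Lemma fact_poch r N m : (0 < r)%N ->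
  (N + r * m)`!%:R = N`!%:R * r%:R ^+ (r * m) *
    \prod_(i <- iota 1 r) poch ((N + i)%:R / r%:R : R) m.
Proof.
move=> r0; have r0' : r%:R != 0 :> R by rewrite pnatr_eq0 -lt0n.
elim: m => [|m IH].
  by rewrite muln0 addn0 expr0 mulr1 big1 ?mulr1// => i _; rewrite /poch big_ord0.
under eq_bigr => i _ do rewrite pochS.
rewrite big_split/= mulrA mulnS [(r + r * m)%N]addnC exprD mulrA.
rewrite [_ * r%:R ^+ r * _](_ : _ = (N + r * m)`!%:R * r%:R ^+ r); last by rewrite IH; ring.
rewrite -mulrA addnA factD_prod natrM; congr (_ * _).
have -> : r%:R ^+ r = \prod_(i <- iota 1 r) r%:R :> R.
  by rewrite big_const_seq count_predT size_iota -Monoid.iteropE.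
rewrite -big_split/= natr_prod.
apply: eq_bigr => i _; rewrite !natrD natrM mulrDr mulrCA divff// mulr1.
by rewrite addrAC.
Qed.

Lemma poch2 m : poch 2 m = m.+1`!%:R :> R.
Proof.
elim: m => [|m IH]; first by rewrite /poch big_ord0.
by rewrite pochS IH [in RHS]factS natrM mulrC -natrD add2n.
Qed.

Lemma pochN n m : (m <= n)%N ->
  poch (- n%:R) m * (n - m)`!%:R = (-1) ^+ m * n`!%:R :> R.
Proof.
elim: m => [|m IH] mn; first by rewrite /poch big_ord0 subn0 expr0 !mul1r.
rewrite exprS -mulrA -IH; last exact: ltnW.
rewrite pochS -(subnSK mn) factS natrM (subnSK mn) natrB; last exact: ltnW.
ring.
Qed.

Lemma pochN_eq0 n m : (n < m)%N -> poch (- n%:R) m = 0 :> R.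
Proof. by move=> nm; rewrite /poch (bigD1 (Ordinal nm))//= addNr mul0r. Qed.

Variable r : nat.
Hypothesis r0 : (0 < r)%N.
Let rho : R := r%:R ^+ r / r.+1%:R ^+ r.+1.

Definition Ppoly n : {poly R} :=
  \poly_(m < n.+1) ('C(n + r + r * m, n - m)%:R * (- rho) ^+ (n - m)).

Let fn0 n : n`!%:R != 0 :> R. Proof. by rewrite pnatr_eq0 -lt0n fact_gt0. Qed.
Let sn0 n : n.+1%:R != 0 :> R. Proof. by rewrite pnatr_eq0. Qed.
Let rn0 : r%:R != 0 :> R. Proof. by rewrite pnatr_eq0 -lt0n. Qed.

(** [fact_poch] with N = r + 1 uses all indices 1..r+1; the last one, absent from the parameters
    a_i, contributes (2)_m = (m + 1)!, which is divided out. *)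
Lemma prod_poch_a m : \prod_(i <- iota 1 r) poch (a_par r i : R) m =
  (r.+1 * m.+1)`!%:R / (r.+1`!%:R * r.+1%:R ^+ (r.+1 * m) * m.+1`!%:R).
Proof.
have := @fact_poch r.+1 r.+1 m isT.
have e : iota 1 r.+1 = iota 1 r ++ [:: r.+1] by rewrite -(addn1 r) iotaD add1n addn1.
rewrite -mulnS e big_cat big_seq1/=.
have -> : (r.+1 + r.+1)%:R / r.+1%:R = 2 :> R by field.
rewrite poch2 => ->.
rewrite [X in _ * (X * _)](_ : _ = \prod_(i <- iota 1 r) poch (a_par r i : R) m).
  by field; rewrite !fn0 /= expf_neq0.
by apply: eq_bigr => i _; congr poch; rewrite /a_par natrD; field.
Qed.

Lemma prod_poch_b n m : \prod_(i <- iota 1 r) poch ((n + r + i)%:R / r%:R : R) m =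
  (n + r + r * m)`!%:R / ((n + r)`!%:R * r%:R ^+ (r * m)).
Proof. by rewrite fact_poch//; field; rewrite fn0 expf_neq0. Qed.

Lemma rhoX m : rho ^+ m = r%:R ^+ (r * m) / r.+1%:R ^+ (r.+1 * m).
Proof. by rewrite /rho expr_div_n -!exprM. Qed.

Let fact_sm m : (r.+1 * m.+1)`!%:R = r.+1%:R * m.+1%:R * (r * m + r + m)`!%:R :> R.
Proof.
rewrite (_ : r.+1 * m.+1 = (r * m + r + m).+1)%N; last by lia.
rewrite factS natrM; congr (_ * _); rewrite -natrM; congr (_%:R); lia.
Qed.

Let binE N k : (k <= N)%N -> 'C(N, k)%:R = N`!%:R / (k`!%:R * (N - k)`!%:R) :> R.
Proof.
move=> kN; rewrite -(bin_fact kN) !natrM; field.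
by rewrite !fn0.
Qed.

Lemma Ppoly_term n m (x : R) : (m <= n)%N ->
  'C(n + r, r)%:R * (- rho) ^+ n *
   ((\prod_(c <- - n%:R :: [seq (n + r + i)%:R / r%:R | i <- iota 1 r]) poch c m) /
    (\prod_(d <- [seq a_par r i | i <- iota 1 r]) poch d m) * (x ^+ m / m`!%:R))
  = (Ppoly n)`_m * x ^+ m.
Proof.
move=> mn; rewrite big_cons !big_map prod_poch_a prod_poch_b coef_poly ltnS mn.
rewrite !binE; [|lia|lia].
rewrite (_ : (n + r + r * m - (n - m) = r * m + r + m)%N); last by lia.
rewrite addnK.
have -> : poch (- n%:R) m = (-1) ^+ m * n`!%:R / (n - m)`!%:R :> R.
  by rewrite -pochN// mulfK.
have -> : (- rho) ^+ n = (- rho) ^+ (n - m) * ((-1) ^+ m * rho ^+ m).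
  by rewrite -exprNn -exprD subnK.
rewrite fact_sm rhoX !factS !natrM.
have s1 : (-1) ^+ m * (-1) ^+ m = 1 :> R by rewrite -expr2 sqrr_sign.
move: ((-1) ^+ m) s1 ((- rho) ^+ (n - m)) => e e1 q.
rewrite -[RHS]mul1r -[X in _ = X * _]e1.
move: (r.+1%:R) (m.+1%:R) (sn0 r) (sn0 m) => S M S0 M0.
by field; rewrite !fn0 S0 M0 !expf_neq0 ?pnatr_eq0 -?lt0n.
Qed.

Lemma lim_series_finite (u : nat -> R) n : (forall m, (n < m)%N -> u m = 0) ->
  limn (series u) = \sum_(m < n.+1) u m.
Proof.
move=> u0; apply: lim_near_cst => //; near=> N.
have nN : (n < N)%N by near: N; exists n.+1.
rewrite /series/= (big_cat_nat (n := n.+1))//= big_mkord [X in _ + X]big1_seq ?addr0// => i.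
by rewrite mem_index_iota => /andP[_ /andP[ni _]]; rewrite u0.
Unshelve. all: by end_near. Qed.

Lemma pFq_Ppoly n (x : R) :
  'C(n + r, r)%:R * (- rho) ^+ n *
   pFq (- n%:R :: [seq (n + r + i)%:R / r%:R | i <- iota 1 r])
       [seq a_par r i | i <- iota 1 r] x = (Ppoly n).[x].
Proof.
rewrite /pFq (@lim_series_finite _ n) => [|m nm]; last first.
  by rewrite big_cons pochN_eq0// !mul0r.
rewrite mulr_sumr (@horner_coef_wide _ n.+1) ?size_poly//.
by apply: eq_bigr => i _; rewrite Ppoly_term// -ltnS.
Qed.

(** The ceiling rounds n - j up to a multiple of r, adding (j - n) mod r, so the numerator of
    b_j^(n-1) is n + r + 1 + ((j - n) mod r). The summand [n * r] keeps the natural subtraction from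
    truncating. *)
Lemma b_shiftE n j : (0 < j <= r)%N ->
  b_shift r n j = (n + r + ((j + n * r - n) %% r).+1)%:R / r%:R :> R.
Proof.
move=> /andP[j0 jr].
set N := (j + n * r - n)%N; set e := (N %% r)%N.
have Ne : N = (N %/ r * r + e)%N by rewrite -divn_eq.
have nN : (n <= j + n * r)%N by rewrite ltnW// -[n]muln1 (@leq_ltn_trans (n * r)) ?muln1 ?leq_pmulr// -add1n leq_add2r.
have er : (e < r)%N by rewrite ltn_mod.
have H : (n%:R - j%:R) / r%:R = n%:R - (N %/ r)%:R - e%:R / r%:R :> R.
  have : N%:R = j%:R + n%:R * r%:R - n%:R :> R by rewrite natrB// natrD natrM.
  rewrite {1}Ne natrD natrM => h.
  apply: (mulIf rn0); rewrite mulfVK// !mulrBl mulfVK//.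
  by move: h; lra.
have C : Num.ceil ((n%:R - j%:R) / r%:R : R) = (n%:Z - (N %/ r)%:Z)%R.
  apply: ceil_def; rewrite H rmorphB/= !rmorphB/=.
  have e1 : 0 <= e%:R / r%:R :> R by rewrite divr_ge0.
  have e2 : e%:R / r%:R < 1 :> R by rewrite ltr_pdivrMr ?ltr0n// mul1r ltr_nat.
  rewrite -!pmulrn; apply/andP; split; lra.
rewrite /b_shift C rmorphB/= -!pmulrn.
have -> : n%:R - (N %/ r)%:R = (n%:R - j%:R) / r%:R + e%:R / r%:R :> R by rewrite H subrK.
rewrite /b_par !natrD -!natr1; field.
by [].
Qed.

(** As j runs over 1..r, so do the residues of j - n, in another order. Products over the shifted
    parameters are symmetric, which identifies the defining parameters with those of (b). *)
Lemma perm_b_shift n :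
  perm_eq [seq b_shift r n j : R | j <- iota 1 r]
          [seq (n + r + i)%:R / r%:R | i <- iota 1 r].
Proof.
pose f j := ((j + n * r - n) %% r).+1.
have -> : [seq b_shift r n j : R | j <- iota 1 r] =
    [seq (n + r + i)%:R / r%:R | i <- [seq f j | j <- iota 1 r]].
  rewrite -map_comp; apply/eq_in_map => j; rewrite mem_iota => jr.
  by rewrite b_shiftE//; lia.
have U : uniq [seq f j | j <- iota 1 r].
  rewrite map_inj_in_uniq ?iota_uniq// => i j; rewrite !mem_iota => ir jr [].
  have nr : (n <= n * r)%N by rewrite leq_pmulr.
  rewrite -!addnBA// => /eqP; rewrite eqn_modDr => /eqP.
  have [->|ir'] := eqVneq i r; have [->|jr'] := eqVneq j r => //.
  - by rewrite modnn modn_small; lia.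
  - by rewrite modnn modn_small; lia.
  - by rewrite !modn_small; lia.
apply: perm_map; apply: uniq_perm => //; first exact: iota_uniq.
have [||_ //] := @uniq_min_size _ [seq f j | j <- iota 1 r] (iota 1 r) U.
  by move=> _ /mapP[j _ ->]; rewrite mem_iota add1n ltnS /f ltn_mod r0.
by rewrite size_map size_iota.
Qed.

Lemma PE n (x : R) : P r n x = (Ppoly n).[x].
Proof.
rewrite -pFq_Ppoly /P /pFq.
have pb m : \prod_(1 <= j < r.+1) poch (b_shift r n j : R) m =
    \prod_(i <- iota 1 r) poch ((n + r + i)%:R / r%:R) m.
  by rewrite /index_iota subn1 -(big_map (fun j => b_shift r n j : R) xpredT (fun b => poch b m))
    (perm_big _ (perm_b_shift n)) big_map.
congr (_ * _); last first.
  congr (limn (series _)); apply/funext => m; rewrite !big_cons.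
  by rewrite (perm_big _ (perm_b_shift n)).
rewrite pb prod_poch_b /index_iota subn1 prod_poch_a binE ?leq_addl// addnK.
rewrite [(- rho) ^+ n]exprNn rhoX fact_sm.
rewrite (_ : (n + r + r * n = r * n + r + n)%N); last by lia.
rewrite !factS !natrM.
move: (r.+1%:R) (n.+1%:R) (sn0 r) (sn0 n) => S M S0 M0.
by field; rewrite !fn0 S0 M0 !expf_neq0.
Qed.

(** Moving the sum to the left makes [Ppoly n.+1] its k = 0 term. The coefficient of x^m is then
    [sum_signed_bin_mulbin] with q = r + 1 and K = (r + 1) m, all powers of rho collecting into
    one. *)
Lemma Ppoly_recurrence n : Ppoly n.+1 = 'X * Ppoly n -
  \sum_(0 <= k < (minn n r).+1) ('C(r.+1, k.+1)%:R * rho ^+ k.+1) *: Ppoly (n - k).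
Proof.
have -> : \sum_(0 <= k < (minn n r).+1) ('C(r.+1, k.+1)%:R * rho ^+ k.+1) *: Ppoly (n - k) =
  \sum_(k < n.+1) ('C(r.+1, k.+1)%:R * rho ^+ k.+1) *: Ppoly (n - k).
  rewrite -(big_mkord xpredT (fun k => ('C(r.+1, k.+1)%:R * rho ^+ k.+1) *: Ppoly (n - k))).
  rewrite [RHS](big_cat_nat (n := (minn n r).+1))//=; last by rewrite ltnS geq_minl.
  rewrite [X in _ + X]big1_seq ?addr0// => i; rewrite mem_index_iota => /andP[_ h].
  by rewrite bin_small ?mul0r ?scale0r//; lia.
suff H : Ppoly n.+1 + \sum_(k < n.+1) ('C(r.+1, k.+1)%:R * rho ^+ k.+1) *: Ppoly (n - k) =
    'X * Ppoly n by rewrite -H addrK.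
apply/polyP => m; rewrite coefD coef_sum coefXM.
under eq_bigr => k _ do rewrite coefZ coef_poly.
rewrite !coef_poly.
have [mn|mn] := ltnP m n.+2; last first.
  rewrite big1 ?addr0; last by move=> k _; rewrite ifF ?mulr0//; lia.
  by case: m mn => // m mn /=; rewrite ifF//; lia.
set N := (n.+1 - m)%N.
pose g k : R := (-1) ^+ k * 'C(r.+1, k)%:R * 'C(N - k + (r.+1 * m + r.+1) - 1, N - k)%:R.
transitivity ((- rho) ^+ N * \sum_(k < N.+1) g k).
  rewrite (big_ord_widen n.+2); last by rewrite ltnS leq_subr.
  rewrite mulr_sumr [RHS]big_mkcond [RHS]big_ord_recl; congr (_ + _).
    rewrite /= /g bin0 subn0 !mul1r mulrC; congr (_ * 'C(_, _)%:R); lia.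
  apply: eq_bigr => k _; rewrite /= /bump/= add1n !ltnS /g.
  have -> : (m <= n - k)%N = (k < N)%N by rewrite /N; have := ltn_ord k; lia.
  case: ifPn => kN; last by rewrite mulr0.
  rewrite (_ : (n - k - m = N - k.+1)%N); last by rewrite /N; lia.
  rewrite (_ : (N - k.+1 + (r.+1 * m + r.+1) - 1 = n - k + r + r * m)%N); last by rewrite /N; lia.
  have -> : (- rho) ^+ N = (- rho) ^+ (N - k.+1) * ((-1) ^+ k.+1 * rho ^+ k.+1).
    by rewrite -exprNn -exprD subnK.
  have s1 : (-1) ^+ k.+1 * (-1) ^+ k.+1 = 1 :> R by rewrite -expr2 sqrr_sign.
  rewrite [RHS](_ : _ = ((-1) ^+ k.+1 * (-1) ^+ k.+1) * ('C(r.+1, k.+1)%:R * rho ^+ k.+1 *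
    ('C(n - k + r + r * m, N - k.+1)%:R * (- rho) ^+ (N - k.+1)))); last by ring.
  by rewrite s1 mul1r.
rewrite sum_signed_bin_mulbin.
(* For m = 0 the parameter K is 0 while N = n + 1 > 0, so the binomial vanishes, as does the
   constant term on the right. *)
case: m mn @N @g => [|m] mn N g /=.
  by rewrite muln0 addn0 bin_small ?mulr0// /N; lia.
rewrite ifT; last by lia.
rewrite mulrC /N subSS; congr ('C(_, _)%:R * _); lia.
Qed.

Lemma size_Ppoly n : size (Ppoly n) = n.+1.
Proof. by rewrite size_poly_eq// subnn bin0 expr0 mulr1 oner_neq0. Qed.

Lemma Ppoly_monic n : Ppoly n \is monic.
Proof.
by rewrite monicE lead_coefE size_Ppoly coef_poly ltnSn subnn bin0 expr0 mulr1.
Qed.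

End hypergeometric.

(** * Orthogonality sums *)

Section orthogonality_sums.
Variables (R : realType) (r : nat).
Hypothesis r0 : (0 < r)%N.
Let rho : R := r%:R ^+ r / r.+1%:R ^+ r.+1.
Implicit Types (n m k j : nat).

Definition jacobi_moment j k : R := rho ^+ k / k.+1%:R * 'C(r.+1 * k.+1 + j, k)%:R.

Let fn0 n : n`!%:R != 0 :> R. Proof. by rewrite pnatr_eq0 -lt0n fact_gt0. Qed.

(** The quotient ((r+1)(m+N+1) + c)! / ((r+1)(m+N+1))!, as linear factors in m. *)
Let block N c : seq (R * R) := [seq (r.+1%:R, (r.+1 * N.+1 + i)%:R) | i <- iota 1 c].

Let blocks k j : seq (R * R) := flatten [seq block t r | t <- iota 0 k] ++ block k j.

Let size_blocks k j : size (blocks k j) = (r * k + j)%N.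
Proof.
rewrite size_cat size_map size_iota size_flatten /shape -map_comp sumnE big_map.
congr (_ + _)%N.
under eq_bigr => i _ do rewrite /= size_map size_iota.
by rewrite big_const_seq count_predT size_iota iter_addn_0.
Qed.

Let fact_block N d m :
  (r.+1 * (m + N.+1) + d)`!%:R =
  (r.+1 * (m + N.+1))`!%:R * linear_factors (block N d) m%:R :> R.
Proof.
rewrite (factD_prod _ d) natrM; congr (_ * _); rewrite /linear_factors big_map natr_prod.
by apply: eq_bigr => i _ /=; rewrite mulnDr -addnA natrD natrM.
Qed.

(** Between (r+1) m + r and (r+1)(m+k+1) + j there are k + 1 multiples of r + 1, giving (r+1)^(k+1)
    (m+k+1)! / m!. The other integers form k full blocks of r factors and a last one of j, hence
    degree r k + j. *)
Let fact_blocks k j m :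
  (r.+1 * (m + k.+1) + j)`!%:R * m`!%:R =
  (r.+1 * m + r)`!%:R * r.+1%:R ^+ k.+1 * linear_factors (blocks k j) m%:R *
  (m + k.+1)`!%:R :> R.
Proof.
rewrite fact_block /linear_factors big_cat/= -!/(linear_factors _ _).
suff H : (r.+1 * (m + k.+1))`!%:R * m`!%:R = (r.+1 * m + r)`!%:R * r.+1%:R ^+ k.+1 *
    linear_factors (flatten [seq block t r | t <- iota 0 k]) m%:R * (m + k.+1)`!%:R :> R.
  by rewrite mulrAC H; ring.
elim: k => [|k IH].
  rewrite /linear_factors big_nil mulr1 expr1 addn1 (_ : r.+1 * m.+1 = (r.+1 * m + r).+1)%N; last by lia.
  rewrite !factS !natrM (_ : (r.+1 * m + r).+1 = r.+1 * m.+1)%N; last by lia.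
  by rewrite natrM; ring.
have -> : iota 0 k.+1 = iota 0 k ++ [:: k] by rewrite -(addn1 k) iotaD add0n.
rewrite map_cat flatten_cat /linear_factors big_cat/= cats0 -!/(linear_factors _ _).
rewrite (_ : r.+1 * (m + k.+2) = (r.+1 * (m + k.+1) + r).+1)%N; last by lia.
rewrite (_ : m + k.+2 = (m + k.+1).+1)%N; last by lia.
rewrite !factS !natrM fact_block (_ : (r.+1 * (m + k.+1) + r).+1 = r.+1 * (m + k.+1).+1)%N; last by lia.
rewrite natrM [r.+1%:R ^+ k.+2]exprS.
transitivity (r.+1%:R * (m + k.+1).+1%:R * linear_factors (block k r) m%:R *
  ((r.+1 * (m + k.+1))`!%:R * m`!%:R)); first by ring.
by rewrite IH; ring.
Qed.

Let binE N k : (k <= N)%N -> 'C(N, k)%:R = N`!%:R / (k`!%:R * (N - k)`!%:R) :> R.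
Proof.
move=> kN; rewrite -(bin_fact kN) !natrM; field.
by rewrite !fn0.
Qed.

(** All dependence on the position of n relative to r k + j is left in the last factorial quotient:
    it is a polynomial in m of degree n - r k - j - 1 if n > r k + j, and the reciprocal of one
    linear factor if n = r k + j. *)
Let termE n k j m : (m <= n)%N ->
  (Ppoly R r n)`_m * jacobi_moment j (k + m) =
  rho ^+ (n + k) * (-1) ^+ n * r.+1%:R ^+ k.+1 / n`!%:R *
  ((-1) ^+ m * 'C(n, m)%:R * linear_factors (blocks k j) m%:R *
   ((n + r + r * m)`!%:R / (r * m + (r * k + r.+1 + j))`!%:R)).
Proof.
move=> mn; rewrite coef_poly ltnS mn /jacobi_moment.
have kmS : (k + m).+1%:R != 0 :> R by rewrite pnatr_eq0.
rewrite !binE; [|lia..].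
rewrite (_ : n + r + r * m - (n - m) = r.+1 * m + r)%N; last by lia.
rewrite (_ : r.+1 * (k + m).+1 + j - (k + m) = r * m + (r * k + r.+1 + j))%N; last by lia.
have -> : (r.+1 * (k + m).+1 + j)`!%:R = (r.+1 * m + r)`!%:R * r.+1%:R ^+ k.+1 *
   linear_factors (blocks k j) m%:R * (m + k.+1)`!%:R / m`!%:R :> R.
  by rewrite -fact_blocks mulfK//; congr (_`!%:R); lia.
rewrite addnS factS natrM [(m + k)%N]addnC.
rewrite -/rho -[- rho]mulN1r exprMn.
have -> : rho ^+ (n + k) = rho ^+ (n - m) * rho ^+ (k + m).
  by rewrite -exprD; congr (_ ^+ _); lia.
have -> : (-1) ^+ n = (-1) ^+ (n - m) * (-1) ^+ m :> R by rewrite -exprD subnK.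
have s1 : (-1) ^+ m * (-1) ^+ m = 1 :> R by rewrite -expr2 sqrr_sign.
move: ((-1) ^+ m) s1 => e e1.
move: (k + m).+1%:R kmS => M M0.
move: (linear_factors _ _) (rho ^+ (n - m)) (rho ^+ (k + m)) ((-1) ^+ (n - m)) (r.+1%:R ^+ k.+1) => A B C D E.
transitivity ((e * e) * (B * C * D * E / n`!%:R * (n`!%:R / (m`!%:R * (n - m)`!%:R) * A *
   ((n + r + r * m)`!%:R / (r * m + (r * k + r.+1 + j))`!%:R)))); last by ring.
rewrite e1 mul1r; field.
by rewrite M0 !fn0.
Qed.

Lemma sum_moment_eq0 n k j : (r * k + j < n)%N ->
  \sum_(m < n.+1) (Ppoly R r n)`_m * jacobi_moment j (k + m) = 0.
Proof.
move=> kn.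
(* The degree of the last quotient, chosen so that (r k + j) + d = n - 1 < n. *)
pose d := (n - (r * k + j).+1)%N.
pose L' : seq (R * R) := [seq (r%:R, (r * k + r.+1 + j + i)%:R) | i <- iota 1 d].
have sL : (size (blocks k j ++ L') < n)%N.
  by rewrite size_cat size_blocks size_map size_iota /d; lia.
have H m : (n + r + r * m)`!%:R / (r * m + (r * k + r.+1 + j))`!%:R = linear_factors L' m%:R :> R.
  rewrite (_ : n + r + r * m = r * m + (r * k + r.+1 + j) + d)%N; last by rewrite /d; lia.
  rewrite (factD_prod _ d) natrM mulrAC divff// mul1r /linear_factors big_map natr_prod.
  by apply: eq_bigr => i _ /=; rewrite -addnA natrD natrM.
under eq_bigr => m _.
  rewrite termE; last by rewrite -ltnS.
  rewrite H -[_ * _ * linear_factors L' _]mulrA.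
  rewrite (_ : linear_factors (blocks k j) m%:R * _ = linear_factors (blocks k j ++ L') m%:R); last first.
    by rewrite /linear_factors [RHS]big_cat.
  over.
by rewrite -mulr_sumr finite_difference_eq0// mulr0.
Qed.

Lemma sum_moment_neq0 k j (n := (r * k + j)%N) : (j < r)%N ->
  \sum_(m < n.+1) (Ppoly R r n)`_m * jacobi_moment j (k + m) != 0.
Proof.
move=> jr.
(* [P p] says that the factor p is negative at the root -(n + r + 1) / r of the denominator, so no
   factor of the remainder vanishes. Even the bound (r+1)(k+1) + j on the intercepts satisfies it,
   since n = r k + j. *)
pose P (p : R * R) := p.2 * r%:R < p.1 * (n + r.+1)%:R.
have P0 i : (i <= r.+1 * k.+1 + j)%N -> P (r.+1%:R, i%:R).
  move=> ik; rewrite /P/= -!natrM ltr_nat /n.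
  apply: (@leq_ltn_trans ((r.+1 * k.+1 + j) * r)); first by rewrite leq_mul2r ik orbT.
  nia.
have blockP : all P (blocks k j).
  rewrite /blocks all_cat; apply/andP; split.
    have : all (fun t => t < k)%N (iota 0 k) by apply/allP => t; rewrite mem_iota.
    elim: (iota 0 k) => //= t s IH /andP[tk sk]; rewrite all_cat IH// andbT.
    rewrite /block all_map; apply/allP => i; rewrite mem_iota => ir /=; apply: P0.
    have : (r.+1 * t.+2 <= r.+1 * k.+1)%N by rewrite leq_mul2l; lia.
    by rewrite !mulnS; lia.
  rewrite /block all_map; apply/allP => i; rewrite mem_iota => ij /=.
  by apply: P0; lia.
have rn0 : 0 < r%:R :> R by rewrite ltr0n.
have rm m : r%:R * m%:R + (n + r.+1)%:R != 0 :> R.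
  by rewrite gt_eqF// ltr_wpDl// ltr0n addnS.
have H m : (n + r + r * m)`!%:R / (r * m + (r * k + r.+1 + j))`!%:R =
    (r%:R * m%:R + (n + r.+1)%:R)^-1 :> R.
  rewrite (_ : r * m + (r * k + r.+1 + j) = (n + r + r * m).+1)%N; last by rewrite /n; lia.
  rewrite factS natrM invfM mulrCA divff// mulr1 -natrM -natrD; congr (_%:R^-1); lia.
under eq_bigr => m _.
  rewrite termE; last by rewrite -ltnS.
  rewrite H.
  over.
rewrite -mulr_sumr (finite_difference_div _ rm) ?size_blocks//; last by rewrite gt_eqF.
have S0 := @sum_signed_bin_inv R n r%:R (n + r.+1)%:R rn0.
rewrite mulf_neq0//; last rewrite mulf_neq0//.
- rewrite /rho !mulf_neq0 ?expf_neq0 ?invr_eq0 ?mulf_neq0 ?expf_neq0 ?invr_eq0 ?expf_neq0 ?oppr_eq0 ?oner_neq0 ?fn0 ?gt_eqF//.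
- rewrite prodf_seq_neq0; apply/allP => p pb /=.
  by rewrite lt_eqF// subr_lt0 ltr_pdivlMr//; exact: (allP blockP).
- by rewrite gt_eqF// S0// ltr0n addnS.
Qed.

End orthogonality_sums.

(** * The beta parameters of the theorem *)

Section instantiation.
Context {R : realType}.
Variables (r k : nat).
Hypothesis kr : (k < r)%N.
Local Open Scope complex_scope.

Let r0 : (0 < r)%N. Proof. exact: leq_ltn_trans kr. Qed.
Let h := (r + 1 - k)%N.
Let rn0 : 0 < r%:R :> R. Proof. by rewrite ltr0n. Qed.
Let sn0 : 0 < r.+1%:R :> R. Proof. by rewrite ltr0n. Qed.
Let fn0 n : n`!%:R != 0 :> R. Proof. by rewrite pnatr_eq0 -lt0n fact_gt0. Qed.

(** [bump h] enumerates the indices other than h in increasing order, which fixes the pairing of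
    lower with upper parameters. *)
Lemma filter_iota_neq : [seq i <- iota 1 r.+1 | i != h] = [seq bump h j | j <- iota 1 r].
Proof.
have -> : r.+1 = (h.-1 + (1 + k))%N by rewrite /h; lia.
have -> : iota 1 r = iota 1 h.-1 ++ iota h k.
  have -> : r = (h.-1 + k)%N by rewrite /h; lia.
  by rewrite iotaD add1n prednK// /h; lia.
rewrite !iotaD !filter_cat map_cat.
have -> : (1 + h.-1 = h)%N by rewrite /h; lia.
rewrite /= eqxx/= addn1; congr (_ ++ _).
  have -> : [seq i <- iota 1 h.-1 | i != h] = iota 1 h.-1.
    by apply/all_filterP/allP => i; rewrite mem_iota; lia.
  rewrite -[LHS]map_id; apply/eq_in_map => i; rewrite mem_iota /bump => ih.
  by rewrite leqNgt (_ : (i < h)%N)//; lia.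
have -> : [seq i <- iota h.+1 k | i != h] = iota h.+1 k.
  by apply/all_filterP/allP => i; rewrite mem_iota; lia.
rewrite -add1n iotaDl; apply/eq_in_map => i; rewrite mem_iota /bump => /andP[-> _].
by [].
Qed.

Let hI : h \in iota 1 r.+1. Proof. by rewrite mem_iota /h; lia. Qed.

Let sumD1 (F : nat -> R) :
  \sum_(i <- iota 1 r.+1) F i = F h + \sum_(i <- iota 1 r.+1 | i != h) F i.
Proof. by rewrite (bigD1_seq h hI (iota_uniq _ _)). Qed.

Let prodD1 (F : nat -> R) :
  \prod_(i <- iota 1 r.+1) F i = F h * \prod_(i <- iota 1 r.+1 | i != h) F i.
Proof. by rewrite (bigD1_seq h hI (iota_uniq _ _)). Qed.

(** The pairs (a_j, b_j - a_j). The skipped index h = r + 1 - k is the one with (k + h) / (r + 1) =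
    1. *)
Definition jacobi_params : seq (R * R) :=
  [seq ((k + bump h j)%:R / r.+1%:R,
        (k + j + 1)%:R / r%:R - (k + bump h j)%:R / r.+1%:R) | j <- iota 1 r].

Let jacobi_b j : (k + bump h j)%:R / r.+1%:R +
  ((k + j + 1)%:R / r%:R - (k + bump h j)%:R / r.+1%:R) = (k + j + 1)%:R / r%:R :> R.
Proof. by rewrite addrC subrK. Qed.

Lemma G_lowerE : G_lower r k = [seq (p.1)%:C | p <- jacobi_params] :> seq R[i].
Proof. by rewrite /G_lower filter_iota_neq -!map_comp. Qed.

Lemma G_upperE : G_upper r k = [seq (p.1 + p.2)%:C | p <- jacobi_params] :> seq R[i].
Proof.
rewrite /G_upper /jacobi_params -map_comp; apply: eq_map => j /=.
by rewrite jacobi_b.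
Qed.

Lemma jacobi_params_neq0 : jacobi_params != [::].
Proof. by rewrite -size_eq0 size_map size_iota -lt0n. Qed.

Lemma jacobi_params_gt0 : all (fun p => (0 < p.1) && (0 < p.2)) jacobi_params.
Proof.
rewrite /jacobi_params all_map; apply/allP => j; rewrite mem_iota => jr /=.
apply/andP; split; first by rewrite divr_gt0// ltr0n /bump; lia.
rewrite subr_gt0 ltr_pdivrMr// mulrAC ltr_pdivlMr// -!natrM ltr_nat.
by rewrite /bump; case: (h <= j)%N => /=; nia.
Qed.

Lemma jacobi_params_lt2 : all (fun p => p.2 < 2) jacobi_params.
Proof.
rewrite /jacobi_params all_map; apply/allP => j; rewrite mem_iota => jr /=.
apply: (@lt_le_trans _ _ ((k + j + 1)%:R / r%:R)).
  by rewrite ltrBlDr ltrDl divr_gt0// ltr0n /bump; lia.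
rewrite ler_pdivrMr// -natrM ler_nat; lia.
Qed.

Let sum_iota c n : \sum_(i <- iota 1 n) (c + i)%:R * 2 = (n * (2 * c + n + 1))%:R :> R.
Proof.
elim: n => [|n IH]; first by rewrite big_nil.
rewrite -[in iota _ _](addn1 n) iotaD big_cat big_seq1 IH add1n.
by rewrite /= !(natrM, natrD) -natr1; ring.
Qed.

Lemma jacobi_params_sum : 1 < \sum_(p <- jacobi_params) p.2.
Proof.
rewrite big_map sumrB.
have e1 : \sum_(j <- iota 1 r) (k + j + 1)%:R / r%:R = (2 * k + r + 3)%:R / 2 :> R.
  apply: (@mulIf _ (r%:R * 2)); first by rewrite mulf_neq0// gt_eqF.
  transitivity (\sum_(j <- iota 1 r) (k.+1 + j)%:R * 2 : R).
    rewrite mulr_suml; apply: eq_bigr => j _.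
    rewrite (_ : k + j + 1 = k.+1 + j)%N; last by lia.
    by field; rewrite gt_eqF.
  by rewrite sum_iota natrM (_ : 2 * k.+1 + r + 1 = 2 * k + r + 3)%N; [field|lia].
(* The sum over all r + 1 indices minus the omitted term, which equals 1. *)
have e2 : \sum_(j <- iota 1 r) (k + bump h j)%:R / r.+1%:R = (2 * k + r)%:R / 2 :> R.
  rewrite -(big_map (bump h) xpredT (fun i => (k + i)%:R / r.+1%:R)) -filter_iota_neq.
  rewrite big_filter.
  have := sum_iota k r.+1; rewrite sumD1.
  rewrite (_ : (k + h) = r.+1)%N; last by rewrite /h; lia.
  rewrite -!mulr_suml natrM.
  move: (\sum_(i <- _ | _) _) => S hS.
  have -> : S = ((r.+1 * (2 * k + r.+1 + 1))%:R - r.+1%:R * 2) / 2 by rewrite natrM -hS; field.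
  rewrite (_ : 2 * k + r.+1 + 1 = (2 * k + r) + 2)%N; last by lia.
  by rewrite natrM natrD; field.
rewrite e1 e2 -mulrBl (_ : 2 * k + r + 3 = 3 + (2 * k + r))%N; last by lia.
rewrite natrD addrK; lra.
Qed.

Lemma beta_params1 : beta_params 1 jacobi_params.
Proof. by apply: sub_all jacobi_params_gt0 => p /andP[p1 ->]; rewrite andbT addr_gt0. Qed.

Lemma meijer_line_beta c : meijer_line (G_lower r k) c -> beta_params c jacobi_params.
Proof.
move=> H; apply/allP => p pl.
have /andP[_ ->] := allP jacobi_params_gt0 _ pl; rewrite andbT.
have := H (p.1)%:C; rewrite G_lowerE => /(_ (map_f _ pl))/=.
by rewrite -subr_gt0 opprK addrC.
Qed.

Lemma kappaE : kappa r k = (beta_kappa jacobi_params)%:C :> R[i].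
Proof.
rewrite /kappa /beta_kappa rmorphM/= fmorphV/= !big_map.
have pos1 j : (0 < (r.+1 + k + j)%:R / r.+1%:R :> R) by rewrite divr_gt0// ltr0n.
have pos2 j : (0 < (r.+1 + k + j)%:R / r%:R :> R) by rewrite divr_gt0// ltr0n.
rewrite /index_iota !subSS !subn0 -[X in _ / X]big_filter filter_iota_neq big_map.
rewrite !addn1 !prod_GammaG; [|exact/allP..].
congr ((_)%:C / (_)%:C); apply: eq_bigr => j _; congr G.
  rewrite /= -addrA [1 + _]addrC addrA jacobi_b.
  rewrite (_ : r.+1 + k + j = k + j + 1 + r)%N; last by lia.
  by rewrite natrD mulrDl divff ?gt_eqF.
rewrite /= (_ : r.+1 + k + bump h j = k + bump h j + r.+1)%N; last by lia.
by rewrite natrD mulrDl divff ?gt_eqF.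
Qed.

Lemma jacobi_moment_prod n :
  \prod_(p <- jacobi_params) (poch (p.1 + 1) n / poch (p.1 + 1 + p.2) n) =
  jacobi_moment R r k n.
Proof.
rewrite prodf_div !big_map/=.
have -> : \prod_(j <- iota 1 r) poch ((k + bump h j)%:R / r.+1%:R + 1 : R) n =
    (r.+1 + k + r.+1 * n)`!%:R / ((r.+1 + k)`!%:R * r.+1%:R ^+ (r.+1 * n) * n.+1`!%:R).
  rewrite -(big_map (bump h) xpredT (fun i => poch ((k + i)%:R / r.+1%:R + 1) n)) -filter_iota_neq.
  rewrite big_filter.
  (* The omitted index h contributes (2)_n = (n + 1)!, to be divided out of the full product. *)
  have := @fact_poch R r.+1 (r.+1 + k) n isT.
  rewrite prodD1.
  rewrite (_ : (r.+1 + k + h) = 2 * r.+1)%N; last by rewrite /h; lia.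
  rewrite natrM mulfK ?gt_eqF// poch2 => ->.
  rewrite [X in _ * (_ * X)](_ : _ = \prod_(i <- iota 1 r.+1 | i != h) poch ((k + i)%:R / r.+1%:R + 1) n).
    by field; rewrite !fn0 expf_neq0// gt_eqF.
  by apply: eq_bigr => i _; congr poch; rewrite !natrD; field.
have -> : \prod_(j <- iota 1 r) poch ((k + bump h j)%:R / r.+1%:R + 1 +
     ((k + j + 1)%:R / r%:R - (k + bump h j)%:R / r.+1%:R) : R) n =
    (r.+1 + k + r * n)`!%:R / ((r.+1 + k)`!%:R * r%:R ^+ (r * n)).
  have := @fact_poch R r (r.+1 + k) n r0 => ->.
  rewrite [X in _ = _ * X / _](_ : _ = \prod_(j <- iota 1 r) poch ((k + j + 1)%:R / r%:R + 1) n).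
    apply: (@mulIf _ ((r.+1 + k)`!%:R * r%:R ^+ (r * n))).
      by rewrite mulf_neq0// expf_neq0// gt_eqF.
    rewrite divfK ?mulf_neq0 ?expf_neq0 ?gt_eqF ?ltr0n ?fact_gt0// mulrC; congr (_ * _).
    by apply: eq_bigr => i _; congr poch; rewrite addrAC jacobi_b.
  apply: eq_bigr => i _; congr poch.
  rewrite (_ : r.+1 + k + i = k + i + 1 + r)%N; last by lia.
  by rewrite [RHS]addrC natrD mulrDl divff ?gt_eqF// addrC.
rewrite /jacobi_moment rhoX.
have -> : 'C(r.+1 * n.+1 + k, n)%:R = (r.+1 + k + r.+1 * n)`!%:R / (n`!%:R * (r.+1 + k + r * n)`!%:R) :> R.
  have nk : (n <= r.+1 * n.+1 + k)%N by lia.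
  have <- : (r.+1 * n.+1 + k - n = r.+1 + k + r * n)%N by lia.
  have <- : (r.+1 * n.+1 + k = r.+1 + k + r.+1 * n)%N by lia.
  move: (r.+1 * n.+1 + k)%N nk => N nN.
  by rewrite -(bin_fact nN) !natrM; field; rewrite !fn0.
rewrite [n.+1`!]factS natrM.
have S0 : n.+1%:R != 0 :> R by rewrite pnatr_eq0.
have E1 : r%:R ^+ (r * n) != 0 :> R by rewrite expf_neq0// gt_eqF.
have E2 : r.+1%:R ^+ (r.+1 * n) != 0 :> R by rewrite expf_neq0// gt_eqF.
move: (n.+1%:R) (r%:R ^+ _) (r.+1%:R ^+ _) S0 E1 E2 => S X Y S0 E1 E2.
by field; rewrite !fn0 S0 E1 E2.
Qed.

End instantiation.

(** * Integrals of polynomials from moments, and assembly of the theorem *)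

Section polynomial_integrals.
Context {R : realType}.
Local Notation TR := (measurableTypeR R).
Variables (m : {measure set TR -> \bar R}) (c : nat -> R).
Hypothesis m0 : m (~` `]0, 1[) = 0%E.
Hypothesis mc : forall n, (\int[m]_(x in `]0%R, 1%R[) (x ^+ n)%:E)%E = (c n)%:E.

Let mX n : measurable_fun setT (fun x : TR => (x ^+ n)%:E).
Proof. by apply/measurable_EFinP; exact: measurable_funX. Qed.

(** The complement of (0, 1) is null, and on (0, 1) the monomial is nonnegative, so its absolute
    integral is the given finite moment. This passes from integrals over (0, 1) to the whole line,
    where [r_orthogonal] is stated. *)
Lemma integrable_monomial n : m.-integrable setT (fun x : TR => (x ^+ n)%:E).
Proof.
apply/(@negligible_integrable _ TR R m setT (~` `]0, 1[)) => //; first exact: measurableC.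
rewrite setTD setCK; apply/integrableP; split; first exact: measurable_funTS.
rewrite (eq_integral (fun x : TR => (x ^+ n)%:E)); first by rewrite mc ltry.
move=> x; rewrite inE/= in_itv/= => /andP[x0 _].
by rewrite ger0_norm// exprn_ge0// ltW.
Qed.

Lemma integral_monomial n : (\int[m]_x (x ^+ n)%:E = (c n)%:E)%E.
Proof.
rewrite (@negligible_integral _ TR R m setT (~` `]0, 1[))//; last exact: integrable_monomial.
  by rewrite setTD setCK.
exact: measurableC.
Qed.

Lemma integral_monomial_poly k (p : {poly R}) :
  m.-integrable setT (fun x : TR => (x ^+ k * p.[x])%:E) /\
  (\int[m]_x (x ^+ k * p.[x])%:E = (\sum_(i < size p) p`_i * c (k + i))%:E)%E.
Proof.
have H N : m.-integrable setT (fun x : TR => (\sum_(i < N) p`_i * x ^+ (k + i))%:E) /\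
    (\int[m]_x (\sum_(i < N) p`_i * x ^+ (k + i))%:E = (\sum_(i < N) p`_i * c (k + i))%:E)%E.
  elim: N => [|N [iN EN]].
    have -> : (fun x : TR => (\sum_(i < 0) p`_i * x ^+ (k + i))%:E) = cst 0%E.
      by apply/funext => x; rewrite big_ord0.
    by rewrite big_ord0; split; [exact: integrable0|rewrite integral0].
  have iM : m.-integrable setT (fun x : TR => (p`_N)%:E * (x ^+ (k + N))%:E)%E.
    by apply: integrableZl => //; exact: integrable_monomial.
  have -> : (fun x : TR => (\sum_(i < N.+1) p`_i * x ^+ (k + i))%:E) =
      (fun x : TR => (\sum_(i < N) p`_i * x ^+ (k + i))%:E + (p`_N)%:E * (x ^+ (k + N))%:E)%E.
    by apply/funext => x; rewrite big_ord_recr.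
  split; first exact: integrableD.
  rewrite integralD//= EN integralZl//; last exact: integrable_monomial.
  by rewrite integral_monomial big_ord_recr.
have E : (fun x : TR => (x ^+ k * p.[x])%:E) = (fun x : TR => (\sum_(i < size p) p`_i * x ^+ (k + i))%:E).
  apply/funext => x; rewrite horner_coef mulr_sumr; congr EFin.
  by apply: eq_bigr => i _; rewrite exprD; ring.
by rewrite E.
Qed.

End polynomial_integrals.

Local Open Scope complex_scope.

Theorem theorem8p5 (R : realType) (r : nat) (hr : (0 < r)%N) :
  let rho : R := r%:R ^+ r / r.+1%:R ^+ r.+1 in
  [/\ (forall (n : nat) (x : R),
         P r n.+1 x = x * P r n x
           - \sum_(0 <= k < (minn n r).+1)
               'C(r.+1, k.+1)%:R * rho ^+ k.+1 * P r (n - k)%N x),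
      (forall (n : nat) (x : R),
         P r n x = 'C(n + r, r)%:R * (- rho) ^+ n
           * pFq (- n%:R :: [seq (n + r + i)%:R / r%:R | i <- iota 1 r])
                 [seq (r + 1 + i)%:R / r.+1%:R | i <- iota 1 r] x)
    & exists mu : 'I_r -> {measure set (measurableTypeR R) -> \bar R},
        [/\ (forall (k : 'I_r) (c : R), meijer_line (G_lower r k) c ->
               has_density (mu k) `]0, 1[
                 (fun x => kappa r k
                           * meijerG (G_upper r k) (G_lower r k) c x)),
            (forall k : 'I_r, mu k setT = 1%E),
            (forall (k : 'I_r) (n : nat),
               (\int[mu k]_(x in `]0%R, 1%R[) (x ^+ n)%:E)%E
               = (rho ^+ n * ((n.+1)%:R)^-1
                  * 'C(r.+1 * n.+1 + k, n)%:R)%:E)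
          & r_orthogonal (P r) mu]].
Proof.
move=> rho; split.
- move=> n x; rewrite !PE// Ppoly_recurrence// hornerD hornerN hornerM hornerX horner_sum.
  by congr (_ - _); apply: eq_bigr => k _; rewrite hornerZ PE.
- move=> n x; rewrite PE// -pFq_Ppoly//; congr (_ * pFq _ _ x).
  by apply: eq_map => i; rewrite /a_par addn1 natrD mulrDl divff// pnatr_eq0.
(* The nullity of the complement is recorded together with the required properties, because
   orthogonality integrates over the whole line. *)
have ex (k : 'I_r) : exists m : {measure set (measurableTypeR R) -> \bar R},
  [/\ (forall c, meijer_line (G_lower r k) c -> has_density m `]0, 1[
         (fun x => kappa r k * meijerG (G_upper r k) (G_lower r k) c x)),
      m setT = 1%E, m (~` `]0, 1[) = 0%E &
      forall n, (\int[m]_(x in `]0%R, 1%R[) (x ^+ n)%:E)%E = (jacobi_moment R r k n)%:E].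
  have kr := ltn_ord k.
  have [m [dm m1 m0 mI]] := beta_measure (@jacobi_params_neq0 R r k kr) (beta_params1 kr)
    (@jacobi_params_lt2 R r k kr) (jacobi_params_sum kr).
  exists m; split => // [c cl|n].
    by rewrite kappaE// G_lowerE// G_upperE//; apply: dm; exact: meijer_line_beta.
  by rewrite mI jacobi_moment_prod.
have [mu muP] := choice ex.
exists mu; split.
- by move=> k; have [] := muP k.
- by move=> k; have [] := muP k.
- by move=> k n; have [_ _ _ ->] := muP k.
split=> [n|j k n f].
  by exists (Ppoly R r n); split; [exact: Ppoly_monic|exact: size_Ppoly|move=> x; rewrite PE].
have [_ _ m0 mI] := muP j.
have [iP EP] := integral_monomial_poly m0 mI k (Ppoly R r n).
rewrite size_Ppoly in EP.
have fE : f = (fun x => (x ^+ k * (Ppoly R r n).[x])%:E).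
  by apply/funext => x; rewrite /f PE.
rewrite fE; split => // [nE|nE]; rewrite EP.
  by rewrite eqe nE sum_moment_neq0.
by rewrite sum_moment_eq0// -addn1.
Qed.
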